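(* Let $\mathbb F$ be an algebraically closed field with a nonidentity involution $a\mapsto\bar a$. (a) Each square matrix $A$ over $\mathbb F$ is *congruent to a direct sum, determined uniquely up to permutation of summands, of tridiagonal matrices of the following two types (with $n$ a positive integer): (i) the $n\times n$ matrix with zero diagonal, all superdiagonal entries (positions $(j,j+1)$) equal to $1$, and all subdiagonal entries (positions $(j+1,j)$) equal to $\lambda$, where $\lambda\in\mathbb F$, $|\lambda|\ne1$, each nonzero $\lambda$ is determined up to replacement by $\bar\lambda^{-1}$, and $\lambda=0$ if $n$ is odd (one can take $|\lambda|<1$ if $n$ is even); (ii) $\mu Q_n$, where $\mu\in\mathbb F$, $|\mu|=1$, and $Q_n$ is the $n\times n$ matrix with diagonal $(1,0,\dots,0)$, all superdiagonal entries equal to $1$, and subdiagonal entry in position $(j+1,j)$ equal to $(-1)^j$ (so the subdiagonal is $-1,1,-1,1,\dots$). (b) The Kronecker canonical form of $(A^*,A)$ under equivalence determines the direct sum asserted in (a) uniquely up to permutation of summands and multiplication of any direct summand of type (ii) by $-1$. For each direct summand $B$ of type (i) or (ii), the Kronecker canonical form of $(B^*,B)$ is as follows: - if $B$ is of type (i): $(F_k,G_k)\oplus(F_k^T,G_k^T)$ if $n=2k+1$, and $(J_k(\bar\lambda),I_k)\oplus(I_k,J_k(\lambda))$ if $n=2k$; - if $B=\mu Q_n$ is of type (ii): $(I_n,J_n((-1)^{n+1}\bar\mu^{-1}\mu))$.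
   Context: An involution on $\mathbb F$ is a bijection $a\mapsto\bar a$ with $\overline{a+b}=\bar a+\bar b$, $\overline{ab}=\bar a\bar b$, $\bar{\bar a}=a$. Put $\mathbb P=\{\lambda\in\mathbb F:\bar\lambda=\lambda\}$ and fix $i\in\mathbb F$ with $i^2=-1$. It is known that $\mathbb F$ has characteristic $0$, each element of $\mathbb F$ is uniquely of the form $a+bi$ with $a,b\in\mathbb P$, $\overline{a+bi}=a-bi$, and $\mathbb P$ has a unique linear ordering making it an ordered field, whose positive elements are exactly the squares of nonzero elements of $\mathbb P$. The modulus $|a+bi|$ is the unique nonnegative square root in $\mathbb P$ of $a^2+b^2$. For a matrix $S$, $S^*=\bar S^T$. Square matrices $A,A'$ are *congruent if $S^*AS=A'$ for some nonsingular $S$. Matrix pairs $(A,B)$ and $(A',B')$ are equivalent if there are nonsingular $R,S$ with $RAS=A'$ and $RBS=B'$. Direct sums of pairs are taken componentwise: $(A,B)\oplus(A',B')=(A\oplus A',B\oplus B')$. $I_n$ is the $n\times n$ identity matrix and $J_n(\lambda)$ is the $n\times n$ upper triangular Jordan block with eigenvalue $\lambda$ (ones on the superdiagonal). For $n\ge 0$, $F_n$ and $G_n$ are the $n\times(n+1)$ matrices $F_n=[\,I_n\ |\ 0\,]$ (identity followed by a zero column) and $G_n=[\,0\ |\ I_n\,]$ (zero column followed by the identity); $F_0=G_0$ is the $0\times 1$ matrix (taking a direct sum with it adjoins a zero column; with its transpose, a zero row). Kronecker's theorem: each pair of matrices of the same size is equivalent to a direct sum, determined uniquely up to permutation of summands,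 of pairs of the form $(I_n,J_n(\lambda))$, $(J_n(0),I_n)$, $(F_n,G_n)$, $(F_n^T,G_n^T)$; this direct sum is the Kronecker canonical form of the pair. A summand written $(J_k(\nu),I_k)$ with $\nu\ne0$ stands for the equivalent canonical pair $(I_k,J_k(\nu^{-1}))$. *)

(* Defs.v *)
From HB Require Import structures.
From mathcomp Require Import all_boot all_order all_algebra.

Set Implicit Arguments.
Unset Strict Implicit.
Unset Printing Implicit Defensive.

Import GRing.Theory.
Local Open Scope ring_scope.

Definition fixed_elt (F : fieldType) (bar : F -> F) (a : F) : Prop := bar a = a.

(* The order of the fixed field P: its positive elements are the squares of
   the nonzero elements of P. *)
Definition Ppos (F : fieldType) (bar : F -> F) (x : F) : Prop :=
  exists c : F, [/\ fixed_elt bar c, c != 0 & x = c ^+ 2].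

Definition Pnneg (F : fieldType) (bar : F -> F) (x : F) : Prop :=
  x = 0 \/ Ppos bar x.

Definition Plt (F : fieldType) (bar : F -> F) (x y : F) : Prop :=
  Ppos bar (y - x).

(* [modulus bar im x r] reads |x| = r, where im is the chosen square root of
   -1: with x = a + b im and a, b in P, r is the nonnegative element of P such
   that r^2 = a^2 + b^2. *)
Definition modulus (F : fieldType) (bar : F -> F) (im x r : F) : Prop :=
  exists a b : F,
    [/\ fixed_elt bar a, fixed_elt bar b & x = a + b * im] /\
    [/\ fixed_elt bar r, Pnneg bar r & r ^+ 2 = a ^+ 2 + b ^+ 2].

Definition star (F : fieldType) (bar : F -> F) (m n : nat) (A : 'M[F]_(m, n)) :
  'M[F]_(n, m) := (map_mx bar A)^T.

(* The two relations below compare matrices whose sizes need only be provably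
   equal, as is the case for direct sums. *)
Definition star_congruent (F : fieldType) (bar : F -> F) (m n : nat)
    (A : 'M[F]_m) (B : 'M[F]_n) : Prop :=
  exists e : m = n, exists2 S : 'M[F]_m,
    S \in unitmx & castmx (e, e) (star bar S *m A *m S) = B.

Definition pair_equivalent (F : fieldType) (m n m' n' : nat)
    (A B : 'M[F]_(m, n)) (A' B' : 'M[F]_(m', n')) : Prop :=
  exists (em : m = m') (en : n = n') (R : 'M[F]_m) (S : 'M[F]_n),
    [/\ R \in unitmx, S \in unitmx,
        castmx (em, en) (R *m A *m S) = A' &
        castmx (em, en) (R *m B *m S) = B'].

Fixpoint dsum (F : fieldType) (T : Type) (r c : T -> nat)
    (M : forall t : T, 'M[F]_(r t, c t)) (s : seq T) :
  'M[F]_(sumn (map r s), sumn (map c s)) :=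
  match s with
  | [::] => 0
  | t :: s' => block_mx (M t) 0 0 (dsum M s')
  end.

Definition jordan (F : fieldType) (n : nat) (lambda : F) : 'M[F]_n :=
  \matrix_(p < n, q < n)
    if q == p :> nat then lambda else if q == p.+1 :> nat then 1 else 0.

Definition Fmx (F : fieldType) (n : nat) : 'M[F]_(n, n.+1) :=
  \matrix_(p < n, q < n.+1) (q == p :> nat)%:R.

Definition Gmx (F : fieldType) (n : nat) : 'M[F]_(n, n.+1) :=
  \matrix_(p < n, q < n.+1) (q == p.+1 :> nat)%:R.

(* KIJ n l = (I_n, J_n(l)), KJI n = (J_n(0), I_n), KFG n = (F_n, G_n) and
   KFGT n = (F_n^T, G_n^T). *)
Inductive ksummand (F : fieldType) : Type :=
  | KIJ of nat & F
  | KJI of nat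
  | KFG of nat
  | KFGT of nat.
Arguments KJI {F} _.
Arguments KFG {F} _.
Arguments KFGT {F} _.

Definition krows (F : fieldType) (t : ksummand F) : nat :=
  match t with KIJ n _ => n | KJI n => n | KFG n => n | KFGT n => n.+1 end.

Definition kcols (F : fieldType) (t : ksummand F) : nat :=
  match t with KIJ n _ => n | KJI n => n | KFG n => n.+1 | KFGT n => n end.

Definition kfst (F : fieldType) (t : ksummand F) : 'M[F]_(krows t, kcols t) :=
  match t with
  | KIJ n _ => 1%:M
  | KJI n => jordan n 0
  | KFG n => Fmx F n
  | KFGT n => (Fmx F n)^T
  end.

Definition ksnd (F : fieldType) (t : ksummand F) : 'M[F]_(krows t, kcols t) :=
  match t with
  | KIJ n l => jordan n l
  | KJI n => 1%:M
  | KFG n => Gmx F n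
  | KFGT n => (Gmx F n)^T
  end.

(* The parameter n may be 0 only in the singular summands, where it gives a
   zero column or a zero row. *)
Definition kvalid (F : fieldType) (t : ksummand F) : bool :=
  match t with KIJ n _ => 0 < n | KJI n => 0 < n | _ => true end%N.

(* The canonical pair that (J_k(nu), I_k) stands for. *)
Definition kJnuI (F : fieldType) (k : nat) (nu : F) : ksummand F :=
  if nu == 0 then KJI k else KIJ k nu^-1.

(* The sequence K lists, in some order, the summands of the Kronecker canonical
   form of (A, B). *)
Definition is_KCF (F : fieldType) (m n : nat) (A B : 'M[F]_(m, n))
    (K : seq (ksummand F)) : Prop :=
  all (@kvalid F) K /\ pair_equivalent A B (dsum (@kfst F) K) (dsum (@ksnd F) K).

(* TypeI n l stands for [tridiagI n l] and TypeII n mu for [mu *: Qmx F n]. *)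
Inductive csummand (F : fieldType) : Type :=
  | TypeI of nat & F
  | TypeII of nat & F.

Definition csummand_code (F : fieldType) (t : csummand F) :
  (nat * F + nat * F)%type :=
  match t with TypeI n l => inl (n, l) | TypeII n m => inr (n, m) end.

Definition csummand_decode (F : fieldType) (x : (nat * F + nat * F)%type) :
  csummand F :=
  match x with inl p => TypeI p.1 p.2 | inr p => TypeII p.1 p.2 end.

Lemma csummand_codeK (F : fieldType) :
  cancel (@csummand_code F) (@csummand_decode F).
Proof. by case. Qed.

HB.instance Definition _ (F : fieldType) :=
  Equality.copy (csummand F) (can_type (@csummand_codeK F)).

Definition csize (F : fieldType) (t : csummand F) : nat :=
  match t with TypeI n _ => n | TypeII n _ => n end.

Definition tridiagI (F : fieldType) (n : nat) (lambda : F) : 'M[F]_n :=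
  \matrix_(p < n, q < n)
    if q == p.+1 :> nat then 1 else if p == q.+1 :> nat then lambda else 0.

(* Indices start at 0 here, so the subdiagonal entry (-1)^j in position
   (j+1, j) becomes (-1)^(q+1) in position (q+1, q). *)
Definition Qmx (F : fieldType) (n : nat) : 'M[F]_n :=
  \matrix_(p < n, q < n)
    if q == p.+1 :> nat then 1
    else if p == q.+1 :> nat then (-1) ^+ q.+1
    else if (p == 0 :> nat) && (q == 0 :> nat) then 1 else 0.

Definition cmx (F : fieldType) (t : csummand F) : 'M[F]_(csize t) :=
  match t with TypeI n l => tridiagI n l | TypeII n m => m *: Qmx F n end.

Definition cvalid (F : fieldType) (bar : F -> F) (im : F) (t : csummand F) :
  Prop :=
  match t with
  | TypeI n l =>
      [/\ (0 < n)%N, exists2 r : F, modulus bar im l r & r != 1 &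
          odd n -> l = 0]
  | TypeII n m => (0 < n)%N /\ modulus bar im m 1
  end.

Definition canonical_sum_of (F : fieldType) (bar : F -> F) (im : F) (n : nat)
    (A : 'M[F]_n) (s : seq (csummand F)) : Prop :=
  (forall t, t \in s -> cvalid bar im t) /\
  star_congruent bar A (dsum (@cmx F) s).

Definition cnormal (F : fieldType) (bar : F -> F) (im : F) (t : csummand F) :
  Prop :=
  match t with
  | TypeI n l =>
      ~~ odd n -> exists2 r : F, modulus bar im l r & Plt bar r 1
  | TypeII _ _ => True
  end.

Definition same_upto_inv (F : fieldType) (bar : F -> F) (t t' : csummand F) :
  bool :=
  match t, t' with
  | TypeI n l, TypeI n' l' =>
      (n == n') && ((l' == l) || (l != 0) && (l' == (bar l)^-1))
  | TypeII n m, TypeII n' m' => (n == n') && (m' == m)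
  | _, _ => false
  end.

(* -(mu Q_n) = (-mu) Q_n *)
Definition same_upto_inv_sign (F : fieldType) (bar : F -> F)
    (t t' : csummand F) : bool :=
  match t, t' with
  | TypeII n m, TypeII n' m' => (n == n') && ((m' == m) || (m' == - m))
  | _, _ => same_upto_inv bar t t'
  end.

Definition perm_upto (T : eqType) (e : rel T) (s s' : seq T) : Prop :=
  exists2 u : seq T, perm_eq s u & all2 e u s'.

Definition KCF_of_csummand (F : fieldType) (bar : F -> F) (t : csummand F) :
  seq (ksummand F) :=
  match t with
  | TypeI n l =>
      if odd n then [:: KFG n./2; KFGT n./2]
      else [:: kJnuI n./2 (bar l); KIJ n./2 l]
  | TypeII n m => [:: KIJ n ((-1) ^+ n.+1 * (bar m)^-1 * m)]
  end.

(* Main.v *)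
(* Matrices act on row vectors, so *congruence reads [A |-> S *m A *m star S].

   Existence, by induction on the size. If some z kills A on both sides, split
   off a zero block. If A is otherwise singular, A pairs its left kernel
   nondegenerately with a complement, and it becomes a smaller matrix D bordered
   by columns and an identity block; reducing D first, only the columns that are
   independent modulo the range of D matter, and they extend each nilpotent
   block of D by two. If A is nonsingular, take a Jordan block of the cosquare
   A A^-* for an eigenvalue l: when |l| <> 1 it pairs with the block for
   conj(l)^-1 to give a type (i) summand, and when |l| = 1 a polarization
   argument makes the form nonsingular on a single chain, which is then
   determined up to sign because a self-adjoint unit of the centralizer of a
   Jordan block is plus or minus a square.

   Uniqueness. The multiplicity of an indecomposable pair X in a pair Y is the
   rank of the pairing Hom(Y, X) x Hom(X, Y) -> End(X)/rad, so the Kronecker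
   form of (A^*, A) determines the summands up to the signs of type (ii). The
   signs are recovered by an inertia argument: on the Jordan chains for the
   eigenvalue of the cosquare of mu Q_n, A induces, up to a constant factor, a
   Hermitian form whose positive index is the multiplicity of mu Q_n. *)

Require Import Defs.
From HB Require Import structures.
From mathcomp Require Import all_boot all_order all_algebra.
From mathcomp Require Import ring zify.

Set Implicit Arguments.
Unset Strict Implicit.
Unset Printing Implicit Defensive.

Import GRing.Theory.
Local Open Scope ring_scope.

(** * The ordered field of fixed elements *)

(** One fact is used throughout: the matrices commuting with a Jordan block form a local ring of
    upper triangular matrices with constant diagonals, and the entry [0 0] is its residue map. The
    corner entry decides invertibility, is multiplicative, and is conjugated when, for an eigenvalue
    of modulus one, the conjugate transpose carries the ring to itself. Multiplicities of Kronecker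
    summands, square roots in the centralizer and the Hermitian form behind the signs of type (ii)
    all come from it. The order of the fixed field is not built. An element counts as nonnegative
    when it is a norm [c * bar c], and this notion is used through square roots, closure under sums
    and definiteness. Existence of Kronecker forms is not assumed either: the canonical sum of [A]
    yields one for [(A^*, A)]. Counting the summands [KIJ] and [KFGT] is enough to recognise every
    class of canonical summands up to sign. *)

Section Involution.

Variables (F : closedFieldType) (bar : {rmorphism F -> F}).
Hypotheses (barK : involutive bar) (bar_nonid : exists a : F, bar a != a).
Variables (im : F) (im_sqr : im ^+ 2 = -1).

Lemma exists_sqrt (a : F) : exists b, b ^+ 2 = a.
Proof.
have [b hb] := solve_monicpoly (fun i => if i == 0%N then a else 0) (isT : (0 < 2)%N).
by exists b; rewrite hb !big_ord_recl big_ord0 /= expr0 mulr1 mul0r !addr0.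
Qed.

Lemma char_neq2 : (2%:R : F) != 0.
Proof.
apply/eqP => h2; have [a ha] := bar_nonid.
have opp (x : F) : - x = x.
  by apply/eqP; rewrite eq_sym -subr_eq0 opprK -mulr2n -mulr_natl h2 mul0r.
pose d := bar a - a; have d0 : d != 0 by rewrite subr_eq0.
have bd : bar d = d by rewrite rmorphB /= barK -opprB opp.
(* Were the characteristic 2, we would have [bar y = y + 1], while the
   Artin-Schreier equation [v ^+ 2 + v = y * bar y], whose roots are [y] and
   [y + 1], would have a root fixed by [bar]. *)
pose y := a / d.
have by1 : bar y = y + 1.
  by rewrite /y fmorph_div bd; apply: (mulIf d0); rewrite mulrDl !divfK // mul1r addrC subrK.
pose c := y * bar y.
have [z hz] : exists z, z ^+ 2 + z = c * y.
  have [b hb] := solve_monicpoly (fun i => if i == 0%N then c * y else -1) (isT : (0 < 2)%N).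
  exists b; rewrite hb !big_ord_recl big_ord0 /=.
  by rewrite expr0 expr1; ring.
have bc : bar c = c by rewrite /c rmorphM /= barK mulrC.
have [v hv bv] : exists2 v, v ^+ 2 + v = c & bar v = v.
  exists (z + bar z); last by rewrite rmorphD /= barK addrC.
  have h1 : bar z ^+ 2 + bar z = c * bar y.
    by rewrite -bc -rmorphM -hz rmorphD rmorphXn.
  have -> : (z + bar z) ^+ 2 + (z + bar z)
    = (z ^+ 2 + z) + (bar z ^+ 2 + bar z) + 2%:R * (z * bar z) by ring.
  rewrite h2 mul0r addr0 hz h1 by1 mulrDr mulr1 addrA.
  by rewrite -mulr2n -mulr_natl h2 mul0r add0r.
have : (y + v) * (y + v + 1) = 0.
  have -> : (y + v) * (y + v + 1) = y * (y + 1) + (v ^+ 2 + v) + 2%:R * (y * v) by ring.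
  by rewrite hv h2 mul0r addr0 -by1 -/c -mulr2n -mulr_natl h2 mul0r.
move/eqP; rewrite mulf_eq0 => /orP [] /eqP h.
  have : bar (y + v) = 0 by rewrite h rmorph0.
  rewrite rmorphD /= by1 bv addrAC h add0r => /eqP; by rewrite oner_eq0.
have : bar (y + v + 1) = 0 by rewrite h rmorph0.
rewrite !rmorphD rmorph1 /= by1 bv (addrAC y) h add0r => /eqP; by rewrite oner_eq0.
Qed.

(** Were [im] fixed, a square root e of a nonzero d with [bar d = - d] would satisfy [bar e = s * e]
    for a fixed s with [s ^+ 2 = -1], and applying [bar] twice would give [e = - e]. *)
Lemma bar_im : bar im = - im.
Proof.
have : bar im ^+ 2 = im ^+ 2 by rewrite -rmorphXn /= im_sqr rmorphN1.
move/eqP; rewrite eqf_sqr => /orP [/eqP bi|/eqP//].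
have [a ha] := bar_nonid.
pose d := bar a - a; have d0 : d != 0 by rewrite subr_eq0.
have bd : bar d = - d by rewrite rmorphB /= barK opprB.
have [e he] := exists_sqrt d.
have h : bar e ^+ 2 = (im * e) ^+ 2 by rewrite exprMn im_sqr he mulN1r -bd -he rmorphXn.
have [s [bs s0 hs]] : exists s, [/\ bar s = s, s ^+ 2 = -1 & bar e = s * e].
  move/eqP: h; rewrite eqf_sqr => /orP [] /eqP ->; first by exists im.
  by exists (- im); rewrite rmorphN sqrrN mulNr bi.
have : e = - e by rewrite -{1}[e]barK hs rmorphM /= hs bs mulrA -expr2 s0 mulN1r.
move=> /eqP; rewrite -subr_eq0 opprK -mulr2n -mulr_natl mulf_eq0 (negPf char_neq2) /=.
by move=> /eqP e0; move: d0; rewrite -he e0 expr0n eqxx.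
Qed.

(* The nonnegative elements of the fixed field are exactly the norms. *)
Definition nneg (x : F) : Prop := exists c, x = c * bar c.

Lemma nneg_norm (x : F) : nneg (x * bar x). Proof. by exists x. Qed.

Lemma nneg0 : nneg 0. Proof. by exists 0; rewrite mul0r. Qed.

Lemma nneg1 : nneg 1. Proof. by exists 1; rewrite rmorph1 mulr1. Qed.

Lemma bar_norm (x : F) : bar (x * bar x) = x * bar x.
Proof. by rewrite rmorphM /= barK mulrC. Qed.

(** A square root of [c * bar c] is [z * bar z] with [z ^+ 2 = c], which is again a norm. *)
Lemma nneg_sqrt (x : F) : nneg x -> exists2 r, bar r = r /\ nneg r & r ^+ 2 = x.
Proof.
case=> c ->; have [z <-] := exists_sqrt c.
exists (z * bar z); first by rewrite bar_norm; split=> //; exists z.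
by rewrite exprMn rmorphXn.
Qed.

(** With fixed roots c and d, the sum [c ^+ 2 + d ^+ 2] is the norm of [c + im * d], since
    [bar im = - im]. *)
Lemma nnegD (x y : F) : nneg x -> nneg y -> nneg (x + y).
Proof.
move=> /nneg_sqrt [c [bc _] <-] /nneg_sqrt [d [bd _] <-].
exists (c + im * d); rewrite rmorphD rmorphM /= bc bd bar_im.
by rewrite mulNr mulrC -subr_sqr exprMn im_sqr mulN1r opprK.
Qed.

Lemma nneg_sum (I : Type) (r : seq I) (P : pred I) (f : I -> F) :
  (forall i, P i -> nneg (f i)) -> nneg (\sum_(i <- r | P i) f i).
Proof. by move=> hf; elim/big_ind: _ => //; [exact: nneg0 | exact: nnegD]. Qed.

(** Fixed roots c of [x] and d of [- x] satisfy [c = im * d] up to sign; [bar] negates the right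
    side, so c is both fixed and negated. *)
Lemma nneg_anti (x : F) : nneg x -> nneg (- x) -> x = 0.
Proof.
move=> /nneg_sqrt [c [bc _] hc] /nneg_sqrt [d [bd _] hd].
have : c ^+ 2 = (im * d) ^+ 2 by rewrite exprMn im_sqr hd mulN1r opprK.
have c0 : bar c = - c -> x = 0.
  rewrite bc => /eqP; rewrite -subr_eq0 opprK -mulr2n -mulr_natl mulf_eq0.
  by rewrite (negPf char_neq2) /= -hc => /eqP ->; rewrite expr0n.
move/eqP; rewrite eqf_sqr => /orP [] /eqP e; apply: c0.
  by rewrite e rmorphM /= bar_im bd mulNr.
by rewrite e rmorphN rmorphM /= bar_im bd mulNr.
Qed.

(** A square root c of [x] is fixed or negated by [bar], so [x] is [c * bar c] or its opposite. *)
Lemma nneg_real (x : F) : bar x = x -> nneg x \/ nneg (- x).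
Proof.
move=> bx; have [c hc] := exists_sqrt x.
have : bar c ^+ 2 = c ^+ 2 by rewrite -rmorphXn hc.
move/eqP; rewrite eqf_sqr => /orP [] /eqP e; [left | right]; exists c; rewrite e.
  by rewrite -expr2.
by rewrite mulrN -expr2 hc.
Qed.

Lemma norm_eq0 (x : F) : (x * bar x == 0) = (x == 0).
Proof. by rewrite mulf_eq0 fmorph_eq0 orbb. Qed.

Lemma nneg_add_eq0 (x y : F) : nneg x -> nneg y -> x + y = 0 -> x = 0.
Proof.
move=> hx hy h; apply: nneg_anti => //.
by rewrite (_ : - x = y) //; apply/eqP; rewrite eq_sym -addr_eq0 addrC h.
Qed.

Lemma nneg_nat (n : nat) : nneg n%:R.
Proof. by elim: n => [|n IH]; [exact: nneg0 | rewrite -natr1; apply: nnegD => //; exact: nneg1]. Qed.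

Lemma natr_neq0 (n : nat) : (0 < n)%N -> (n%:R : F) != 0.
Proof.
case: n => // n _; apply/eqP; rewrite -nat1r => h.
by have /eqP := nneg_add_eq0 nneg1 (nneg_nat n) h; rewrite oner_eq0.
Qed.

(** Real and imaginary parts occur only here; afterwards the modulus is handled through
    [x * bar x]. *)
Lemma modulusP (x r : F) :
  modulus bar im x r <-> [/\ bar r = r, nneg r & r ^+ 2 = x * bar x].
Proof.
have pn y : Pnneg bar y <-> nneg y.
  split=> [[->|[c [bc c0 ->]]]|].
  - exact: nneg0.
  - by exists c; rewrite bc -expr2.
  - move=> /nneg_sqrt [c [bc _] <-].
    have [->|c0] := eqVneq c 0; first by left; rewrite expr0n.
    by right; exists c.
have h2 := char_neq2; have im0 : im != 0.
  by apply/eqP => e; move: im_sqr; rewrite e expr0n => /eqP; rewrite eq_sym oppr_eq0 oner_eq0.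
split=> [[a [b [[ba bb ->] [br /pn hr ->]]]]|[br hr e]].
  split=> //; rewrite rmorphD rmorphM /= bar_im ba bb.
  by rewrite mulrN mulrC -subr_sqr exprMn im_sqr mulrN1 opprK.
exists ((x + bar x) / 2%:R), ((x - bar x) / (2%:R * im)).
have b2 : bar 2%:R = 2%:R by rewrite rmorph_nat.
split; split.
- by rewrite /fixed_elt fmorph_div b2 rmorphD /= barK addrC.
- by rewrite /fixed_elt fmorph_div rmorphM rmorphB /= b2 barK bar_im mulrN invrN mulrN -mulNr opprB.
- by field; rewrite im0 h2.
- by [].
- exact/pn.
- have ii : im^-1 = - im by apply: (mulfI im0); rewrite mulfV // mulrN -expr2 im_sqr opprK.
  rewrite e invfM ii.
  transitivity (((x + bar x) / 2%:R) ^+ 2 + ((x - bar x) / 2%:R) ^+ 2 * im ^+ 2); last by ring.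
  by rewrite im_sqr; field.
Qed.

Lemma modulus_exists (x : F) : exists r, modulus bar im x r.
Proof.
have [r [br hr] e] := nneg_sqrt (nneg_norm x).
by exists r; apply/modulusP.
Qed.

Lemma modulus1P (x : F) : modulus bar im x 1 <-> x * bar x = 1.
Proof.
split=> [/modulusP [_ _ <-]|e]; first by rewrite expr1n.
by apply/modulusP; rewrite e rmorph1 expr1n; split=> //; exact: nneg1.
Qed.

Lemma modulus_neq1P (x : F) :
  (exists2 r, modulus bar im x r & r != 1) <-> x * bar x != 1.
Proof.
split=> [[r /modulusP [br hr <-] r1]|h].
  rewrite sqrf_eq1 negb_or r1 /=; apply/eqP => e; move: hr; rewrite e => h.
  by have /eqP := nneg_anti nneg1 h; rewrite oner_eq0.
have [r hr] := modulus_exists x; exists r => //.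
by apply: contraNneq h => e; apply/eqP/modulus1P; rewrite -e.
Qed.

End Involution.

(** * Jordan blocks *)

Section Jordan.

Variable F : fieldType.

Lemma shiftE (m : nat) (i j : 'I_m) : jordan (F := F) m 0 i j = (j == i.+1 :> nat)%:R.
Proof. by rewrite !mxE; case: eqP => [->|_]; [rewrite ltn_eqF | case: eqP]. Qed.

Lemma jordanE (m : nat) (l : F) : jordan m l = l%:M + jordan m 0.
Proof.
apply/matrixP => i j; rewrite [RHS]mxE shiftE !mxE.
have -> : (i == j) = (j == i :> nat) by rewrite eq_sym.
by case: eqP => [->|_]; [rewrite ltn_eqF // addr0 | rewrite add0r; case: eqP].
Qed.

(** The function [f] extends [X] by a zero row at index [m], so the last row of the product is not a
    special case. *)
Lemma mul_shift_l (m n : nat) (X : 'M[F]_(m, n)) (f : nat -> nat -> F) :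
  (forall i j, X i j = f i j) -> (forall j, f m j = 0) ->
  forall i j, (jordan m 0 *m X) i j = f i.+1 j.
Proof.
move=> hX f0 i j; rewrite mxE.
have [lt_im|ge_im] := ltnP i.+1 m; last first.
  have -> : i.+1 = m by apply/eqP; rewrite eqn_leq ge_im ltn_ord.
  rewrite f0 big1 // => k _; rewrite shiftE ltn_eqF ?mul0r //.
  exact: leq_trans (ltn_ord k) ge_im.
rewrite (bigD1 (Ordinal lt_im)) //= hX shiftE /= eqxx mul1r big1 ?addr0 //.
move=> k; rewrite -(inj_eq val_inj) /= => /negPf hk.
by rewrite shiftE hk mul0r.
Qed.

(** Here [f] is [P] moved one column to the right, with a zero column at index 0. *)
Lemma mul_shift_r (m n : nat) (P : 'M[F]_(n, m)) (f : nat -> nat -> F) :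
  (forall i j, P i j = f i j.+1) -> (forall i, f i 0%N = 0) ->
  forall i j, (P *m jordan m 0) i j = f i j.
Proof.
move=> hP f0 i j; rewrite mxE.
case: j => [[|j] lt_jm] /=.
  by rewrite f0 big1 // => k _; rewrite shiftE mulr0.
have lt_j : (j < m)%N by apply: ltnW.
rewrite (bigD1 (Ordinal lt_j)) //= hP shiftE /= eqxx mulr1 big1 ?addr0 //.
move=> k; rewrite -(inj_eq val_inj) /= => /negPf hk.
by rewrite shiftE /= eqSS eq_sym hk mulr0.
Qed.

(** Extension by zero to all pairs of naturals, so that shifted indices need no bound proofs. *)
Definition entry (n m : nat) (C : 'M[F]_(n, m)) (i j : nat) : F :=
  if insub i is Some i' then if insub j is Some j' then C i' j' else 0 else 0.

Lemma entryE n m (C : 'M[F]_(n, m)) (i : 'I_n) (j : 'I_m) : entry C i j = C i j.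
Proof. by rewrite /entry !valK. Qed.

Lemma entry_row n m (C : 'M[F]_(n, m)) i j : (n <= i)%N -> entry C i j = 0.
Proof. by move=> h; rewrite /entry insubF // ltnNge h. Qed.

Lemma entry_col n m (C : 'M[F]_(n, m)) i j : (m <= j)%N -> entry C i j = 0.
Proof. by move=> h; rewrite /entry; case: insub => // ?; rewrite insubF // ltnNge h. Qed.

Section Intertwiner.

Variables (n m : nat) (C : 'M[F]_(n, m)).
Hypothesis shiftC : jordan n 0 *m C = C *m jordan m 0.

Let shift_entry (i : 'I_n) (j : 'I_m) :
  entry C i.+1 j = if nat_of_ord j is j'.+1 then entry C i j' else 0 :> F.
Proof.
rewrite -(mul_shift_l (X := C) (f := entry C)) ?shiftC; last 2 first.
- by move=> ? ?; rewrite entryE.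
- by move=> ?; rewrite entry_row.
rewrite (mul_shift_r (P := C) (f := fun a b => if b is b'.+1 then entry C a b' else 0)) //.
by move=> ? ?; rewrite entryE.
Qed.

Lemma intertwiner_col0 i : entry C i.+1 0 = 0.
Proof.
have [lt_in|ge_in] := ltnP i n; last by rewrite entry_row // (leq_trans ge_in).
have [m0|m0] := posnP m; first by rewrite entry_col ?m0.
by have := shift_entry (Ordinal lt_in) (Ordinal m0).
Qed.

Lemma intertwiner_shift i j k : (j + k < m)%N -> entry C (i + k) (j + k) = entry C i j.
Proof.
elim: k => [|k IH]; rewrite ?addn0 // !addnS => lt_jm.
have [lt_in|ge_in] := ltnP (i + k) n.
  by have /= -> := shift_entry (Ordinal lt_in) (Ordinal lt_jm); apply: IH; exact: ltnW.
by rewrite entry_row ?(leq_trans ge_in) // -IH ?entry_row //; exact: ltnW.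
Qed.

Lemma intertwiner_lower i j : (j < i)%N -> (j < m)%N -> entry C i j = 0.
Proof.
move=> lt_ji lt_jm; have := @intertwiner_shift (i - j) 0 j; rewrite subnK ?(ltnW lt_ji) //.
move=> -> //; case: (i - j)%N (subn_gt0 j i) => [|d _]; last exact: intertwiner_col0.
by rewrite lt_ji.
Qed.

(** Along its diagonal, position [(0, j)] reaches the last column at row [m.-1 - j], which is
    already below the matrix. *)
Lemma intertwiner_row0 j : (j < m)%N -> (n <= m.-1 - j)%N -> entry C 0 j = 0.
Proof.
move=> lt_jm h; rewrite -(@intertwiner_shift 0 j (m.-1 - j)); last by lia.
by rewrite entry_row.
Qed.

End Intertwiner.

Lemma commutant_diag (m : nat) (C : 'M[F]_m.+1) :
  jordan m.+1 0 *m C = C *m jordan m.+1 0 -> forall i, C i i = C 0 0.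
Proof.
move=> hC i; rewrite -!entryE -(@intertwiner_shift _ _ _ hC 0 0 i) ?add0n //.
Qed.

Lemma commutant_trig (m : nat) (C : 'M[F]_m) :
  jordan m 0 *m C = C *m jordan m 0 -> is_trig_mx C^T.
Proof.
move=> hC; apply/is_trig_mxP => i j lt_ij.
by rewrite mxE -entryE (intertwiner_lower hC).
Qed.

Lemma trmx_exp (n : nat) (A : 'M[F]_n) k : (A ^+ k)^T = A^T ^+ k.
Proof.
elim: k => [|k IH]; first by rewrite !expr0 trmx1.
by rewrite exprS exprSr -!mulmxE trmx_mul IH.
Qed.

(** Triangularity and the constant diagonal leave a single eigenvalue, so Cayley-Hamilton applies.
    The transpose is there because [is_trig_mx] means lower triangular. *)
Lemma commutant_nilp (m : nat) (C : 'M[F]_m.+1) :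
  jordan m.+1 0 *m C = C *m jordan m.+1 0 -> (C - (C 0 0)%:M) ^+ m.+1 = 0.
Proof.
move=> hC; have hT := Cayley_Hamilton C^T.
move: hT; rewrite char_poly_trig ?commutant_trig //.
rewrite (eq_bigr (fun _ => 'X - (C 0 0)%:P)); last by move=> i _; rewrite mxE commutant_diag.
rewrite prodr_const card_ord rmorphXn rmorphB /= horner_mx_X horner_mx_C => h.
apply: trmx_inj; rewrite trmx0 -{}h.
by rewrite trmx_exp linearB /= tr_scalar_mx.
Qed.

Lemma col_mulmx (m n p : nat) (A : 'M[F]_(m, n)) (B : 'M_(n, p)) j :
  col j (A *m B) = A *m col j B.
Proof. by rewrite !colE mulmxA. Qed.

Section Chain.

Variables (n m : nat) (D : 'M[F]_n) (x : 'rV[F]_n) (v : 'cV[F]_n).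
Hypotheses (m_gt0 : (0 < m)%N) (xDm : x *m D ^+ m = 0) (Dmv : D ^+ m *m v = 0)
  (xDv : x *m D ^+ m.-1 *m v != 0).

(** The rows [x *m D ^+ i] and the columns [D ^+ (m - j.+1) *m v] are dual chains up to the matrix
    [H] of their products. It is upper triangular with the nonzero value [x *m D ^+ m.-1 *m v] on
    the diagonal and commutes with the shift, so [P *m invmx H] is still a chain and is a right
    inverse of [X]. *)
Lemma jordan_chain : exists (X : 'M[F]_(m, n)) (P : 'M[F]_(n, m)),
  [/\ X *m P = 1%:M, X *m D = jordan m 0 *m X & D *m P = P *m jordan m 0].
Proof.
pose X : 'M_(m, n) := \matrix_(i < m, j < n) (x *m D ^+ i) 0 j.
pose P : 'M_(n, m) := \matrix_(i < n, j < m) (D ^+ (m - j.+1) *m v) i 0.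
have rowX i : row i X = x *m D ^+ i by apply/rowP => j; rewrite !mxE.
have colP j : col j P = D ^+ (m - j.+1) *m v by apply/colP => i; rewrite !mxE.
have XD : X *m D = jordan m 0 *m X.
  apply/matrixP => i j.
  rewrite (mul_shift_l (f := fun a b => entry (x *m D ^+ a) 0 b)).
  - rewrite (entryE _ (0 : 'I_1) j) exprSr -mulmxE mulmxA -rowX -row_mul.
    by rewrite [RHS]mxE.
  - by move=> a b; rewrite (entryE _ (0 : 'I_1)) mxE.
  - move=> a; rewrite xDm /entry; case: insub => // ?; case: insub => // ?.
    by rewrite mxE.
have DP : D *m P = P *m jordan m 0.
  apply/matrixP => i j.
  rewrite (mul_shift_r (f := fun a b => entry (D ^+ (m - b) *m v) a 0)).
  - rewrite (entryE _ i (0 : 'I_1)) -(subnSK (ltn_ord j)) exprS -mulmxE -mulmxA -colP.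
    by rewrite -col_mulmx [RHS]mxE.
  - by move=> a b; rewrite (entryE _ _ (0 : 'I_1)) mxE.
  - move=> a; rewrite subn0 Dmv /entry; case: insub => // ?; case: insub => // ?.
    by rewrite mxE.
pose H := X *m P.
have HE i j : H i j = (x *m D ^+ (i + (m - j.+1)) *m v) 0 0.
  rewrite exprD -mulmxE mulmxA -mulmxA -rowX -colP !mxE.
  by apply: eq_bigr => k _; rewrite !mxE.
have Hu : H \in unitmx.
  rewrite unitmxE -det_tr det_trig; last first.
    apply/is_trig_mxP => i j lt_ij; rewrite mxE HE.
    have -> : (j + (m - i.+1) = m + (j - i.+1))%N by have := ltn_ord i; lia.
    by rewrite exprD -mulmxE mulmxA xDm !mul0mx mxE.
  rewrite unitfE; apply/prodf_neq0 => i _; rewrite mxE HE.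
  have -> : (i + (m - i.+1) = m.-1)%N by have := ltn_ord i; lia.
  apply: contraNneq xDv => h; apply/eqP/matrixP => a b.
  by rewrite !ord1 h mxE.
have NH : jordan m 0 *m H = H *m jordan m 0 by rewrite mulmxA -XD -!mulmxA DP.
exists X, (P *m invmx H); split=> //; first by rewrite mulmxA mulmxV.
rewrite mulmxA DP -!mulmxA; congr (_ *m _).
by rewrite -[LHS](mulKmx Hu) (mulmxA H) -NH mulmxK.
Qed.

End Chain.

Lemma mx_neq0 (m n : nat) (A : 'M[F]_(m, n)) : A != 0 -> exists i j, A i j != 0.
Proof.
move=> A0; case: (pickP [pred ij : 'I_m * 'I_n | A ij.1 ij.2 != 0]) => [[i j] h|h].
  by exists i, j.
by move: A0; rewrite (_ : A = 0) ?eqxx //; apply/matrixP => i j; rewrite mxE; apply/eqP/negbFE/(h (i, j)).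
Qed.

Lemma similar_jordan (m : nat) (T : 'M[F]_m) (l : F) :
  (0 < m)%N -> (T - l%:M) ^+ m = 0 -> (T - l%:M) ^+ m.-1 != 0 ->
  exists2 X : 'M[F]_m, X \in unitmx & X *m T = jordan m l *m X.
Proof.
move=> m_gt0 Tm Tm1.
have [i [j hij]] := mx_neq0 Tm1.
have [|||X [P [XP XT _]]] := @jordan_chain m m (T - l%:M) (delta_mx 0 i) (delta_mx j 0) m_gt0.
- by rewrite Tm mulmx0.
- by rewrite Tm mul0mx.
- apply: contraNneq hij => /matrixP /(_ 0 0); rewrite -rowE -colE !mxE => ->.
  by [].
exists X; first by have [] := mulmx1_unit XP.
by rewrite jordanE mulmxDl -XT mulmxBr mul_scalar_mx mul_mx_scalar addrC subrK.
Qed.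

(** Take the least [m.+1] at which the ranks of the powers of [D] become stationary. A row [x]
    killed by [D ^+ m.+1] but not by [D ^+ m] then starts a chain of maximal length, and some column
    killed by [D ^+ m.+1] pairs with its end, which supplies the dual chain. *)
Lemma jordan_summand (n : nat) (T : 'M[F]_n) (l : F) :
  T - l%:M \notin unitmx ->
  exists (m : nat) (X : 'M[F]_(m.+1, n)) (P : 'M[F]_(n, m.+1)),
  [/\ X *m P = 1%:M, X *m T = jordan m.+1 l *m X & T *m P = P *m jordan m.+1 l].
Proof.
set D := T - l%:M => Dsing.
have stab : exists k, \rank (D ^+ k) == \rank (D ^+ k.+1).
  case: (pickP [pred k : 'I_n.+1 | \rank (D ^+ k) == \rank (D ^+ k.+1)]) => [k hk|h].
    by exists k.
  (* Ranks cannot drop [n.+1] times in a row. *)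
  have : forall k, (k <= n.+1)%N -> (\rank (D ^+ k) + k <= n)%N.
    elim=> [_|k IH lt_kn]; first by rewrite addn0 rank_leq_row.
    have := IH (ltnW lt_kn); have := h (Ordinal lt_kn) => /= hk.
    have : (\rank (D ^+ k.+1) <= \rank (D ^+ k))%N by rewrite exprSr -mulmxE mxrankM_maxl.
    by move: hk; lia.
  by move=> /(_ n.+1 (leqnn _)); lia.
case: (ex_minnP stab) => [[|m]] /eqP rk_eq min_m.
  move: Dsing; rewrite -row_free_unit -row_leq_rank -[D in \rank D]expr1 -rk_eq.
  by rewrite expr0 mxrank1 leqnn.
have [i hi] : exists i, row i (kermx (D ^+ m.+1)) *m D ^+ m != 0.
  apply/existsP; apply: contraT => /existsPn h.
  have : kermx (D ^+ m.+1) *m D ^+ m = 0.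
    by apply/row_matrixP => i; rewrite row_mul row0; have := h i; rewrite negbK => /eqP.
  move/sub_kermxP/mxrankS; rewrite !mxrank_ker => le1.
  suff /min_m : \rank (D ^+ m) == \rank (D ^+ m.+1) by rewrite ltnn.
  have : (\rank (D ^+ m.+1) <= \rank (D ^+ m))%N by rewrite exprSr -mulmxE mxrankM_maxl.
  by have := rank_leq_row (D ^+ m); have := rank_leq_row (D ^+ m.+1); lia.
set x := row i _ in hi.
have xD : x *m D ^+ m.+1 = 0 by rewrite /x -row_mul mulmx_ker row0.
(* Were it inside, a preimage [z] would be killed by [D ^+ m.+2], hence by [D ^+ m.+1] as the ranks
   are stationary, and [x *m D ^+ m] would vanish. *)
have : ~~ (x *m D ^+ m <= D ^+ m.+1)%MS.
  apply: contraNN hi => /submxP [z hz].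
  have zD : z *m D ^+ m.+2 = 0.
    by rewrite exprSr -mulmxE mulmxA -hz -mulmxA mulmxE -exprSr.
  have : (kermx (D ^+ m.+2) <= kermx (D ^+ m.+1))%MS.
    have sub : (kermx (D ^+ m.+1) <= kermx (D ^+ m.+2))%MS.
      by apply/sub_kermxP; rewrite [D ^+ m.+2]exprSr -mulmxE mulmxA mulmx_ker mul0mx.
    by rewrite -(mxrank_leqif_sup sub) !mxrank_ker rk_eq.
  by move/(submx_trans (introT sub_kermxP zD))/sub_kermxP => h; rewrite hz h.
rewrite submxE => hc.
have [j hj] : exists j, x *m D ^+ m *m col j (cokermx (D ^+ m.+1)) != 0.
  have [i0 [j hj]] := mx_neq0 hc; exists j; apply: contraNneq hj => h.
  by move/matrixP/(_ i0 0): h; rewrite -col_mulmx !mxE => ->.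
have [||X [P [XP XD DP]]] := @jordan_chain n m.+1 D x _ _ xD _ hj => //.
  by rewrite -col_mulmx mulmx_coker col0.
exists m, X, P; split=> //.
  by rewrite jordanE mulmxDl -XD mulmxBr mul_scalar_mx mul_mx_scalar addrC subrK.
by rewrite jordanE mulmxDr -DP mulmxBl mul_scalar_mx mul_mx_scalar addrC subrK.
Qed.

End Jordan.

(** * Conjugate transposes, equivalence and *congruence *)

Section Star.

Variables (F : fieldType) (bar : {rmorphism F -> F}).

Local Notation "A ^h" := (star bar A) (at level 2, format "A ^h").

Lemma starE m n (A : 'M[F]_(m, n)) i j : A^h i j = bar (A j i).
Proof. by rewrite !mxE. Qed.

Lemma starM m n p (A : 'M[F]_(m, n)) (B : 'M_(n, p)) : (A *m B)^h = B^h *m A^h.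
Proof. by rewrite /star map_mxM trmx_mul. Qed.

Lemma star0 m n : (0 : 'M[F]_(m, n))^h = 0.
Proof. by rewrite /star map_mx0 trmx0. Qed.

Lemma star_scalar n a : (a%:M : 'M[F]_n)^h = (bar a)%:M.
Proof. by rewrite /star map_scalar_mx tr_scalar_mx. Qed.

Lemma star1 n : (1%:M : 'M[F]_n)^h = 1%:M.
Proof. by rewrite star_scalar rmorph1. Qed.

Lemma starD m n (A B : 'M[F]_(m, n)) : (A + B)^h = A^h + B^h.
Proof. by rewrite /star map_mxD linearD. Qed.

Lemma starN m n (A : 'M[F]_(m, n)) : (- A)^h = - A^h.
Proof. by rewrite /star map_mxN linearN. Qed.

Lemma starB m n (A B : 'M[F]_(m, n)) : (A - B)^h = A^h - B^h.
Proof. by rewrite starD starN. Qed.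

Lemma starZ m n a (A : 'M[F]_(m, n)) : (a *: A)^h = bar a *: A^h.
Proof. by rewrite /star map_mxZ linearZ. Qed.

Lemma star_row_mx m n1 n2 (A : 'M[F]_(m, n1)) (B : 'M_(m, n2)) :
  (row_mx A B)^h = col_mx A^h B^h.
Proof. by rewrite /star map_row_mx tr_row_mx. Qed.

Lemma star_col_mx m1 m2 n (A : 'M[F]_(m1, n)) (B : 'M_(m2, n)) :
  (col_mx A B)^h = row_mx A^h B^h.
Proof. by rewrite /star map_col_mx tr_col_mx. Qed.

Lemma star_block_mx m1 m2 n1 n2 (A : 'M[F]_(m1, n1)) (B : 'M_(m1, n2)) C (D : 'M_(m2, n2)) :
  (block_mx A B C D)^h = block_mx A^h C^h B^h D^h.
Proof. by rewrite /star map_block_mx tr_block_mx. Qed.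

Definition starmxE := (star_row_mx, star_col_mx, star_block_mx, star0, star1).

Lemma star_unit n (A : 'M[F]_n) : (A^h \in unitmx) = (A \in unitmx).
Proof. by rewrite /star unitmx_tr map_unitmx. Qed.

Lemma mxrank_star m n (A : 'M[F]_(m, n)) : \rank A^h = \rank A.
Proof. by rewrite /star mxrank_tr mxrank_map. Qed.

Hypothesis barK : involutive bar.

Lemma starK m n (A : 'M[F]_(m, n)) : A^h^h = A.
Proof. by apply/matrixP => i j; rewrite !starE barK. Qed.

End Star.

Section Isomorphism.

Variable F : fieldType.

(* Invertible matrices whose two dimensions need not be convertible. *)
Definition isomx m n (R : 'M[F]_(m, n)) : bool := (m == n) && row_free R.

Lemma isomxE n (R : 'M[F]_n) : isomx R = (R \in unitmx).
Proof. by rewrite /isomx eqxx row_free_unit. Qed.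

Lemma isomx1 n : isomx (1%:M : 'M[F]_n).
Proof. by rewrite isomxE unitmx1. Qed.

Lemma isomx_rinv m n (R : 'M[F]_(m, n)) S : m = n -> R *m S = 1%:M -> isomx R.
Proof. by move=> e h; apply/andP; split; [exact/eqP | apply/row_freeP; exists S]. Qed.

Lemma isomxP m n (R : 'M[F]_(m, n)) :
  isomx R -> exists S : 'M_(n, m), [/\ isomx S, R *m S = 1%:M & S *m R = 1%:M].
Proof.
case/andP => /eqP e; case: _ / e R => R; rewrite row_free_unit => h.
by exists (invmx R); rewrite isomxE unitmx_inv mulmxV ?mulVmx.
Qed.

Lemma isomxM m n p (R : 'M[F]_(m, n)) (S : 'M_(n, p)) : isomx R -> isomx S -> isomx (R *m S).
Proof.
move=> /isomxP [R' [/andP [/eqP em _] RR' _]] /isomxP [S' [/andP [/eqP en _] SS' _]].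
apply: (@isomx_rinv _ _ _ (S' *m R')); first by rewrite -em en.
by rewrite -mulmxA (mulmxA S) SS' mul1mx.
Qed.

Lemma isomx_block m n m' n' (R : 'M[F]_(m, n)) (S : 'M_(m', n')) :
  isomx R -> isomx S -> isomx (block_mx R 0 0 S).
Proof.
move=> /isomxP [R' [/andP [/eqP em _] RR' _]] /isomxP [S' [/andP [/eqP en _] SS' _]].
apply: (@isomx_rinv _ _ _ (block_mx R' 0 0 S')); first by rewrite em en.
by rewrite mulmx_block !mulmx0 !mul0mx !addr0 add0r RR' SS' -scalar_mx_block.
Qed.

Lemma isomx_tr m n (R : 'M[F]_(m, n)) : isomx R -> isomx R^T.
Proof.
move=> /isomxP [S [/andP [/eqP e _] _ SR]].
by apply: (@isomx_rinv _ _ _ S^T) => //; rewrite -trmx_mul SR trmx1.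
Qed.

(** The identity matrix, with rows and columns indexed by the two bracketings of the sum. *)
Definition rowA m1 m2 m3 : 'M[F]_(m1 + m2 + m3, m1 + (m2 + m3)) :=
  col_mx (col_mx (row_mx 1%:M 0) (row_mx 0 (row_mx 1%:M 0))) (row_mx 0 (row_mx 0 1%:M)).

(** The permutation matrix that exchanges the first two of three blocks. *)
Definition rowCA m1 m2 m3 : 'M[F]_(m2 + (m1 + m3), m1 + (m2 + m3)) :=
  col_mx (row_mx 0 (row_mx 1%:M 0)) (col_mx (row_mx 1%:M 0) (row_mx 0 (row_mx 0 1%:M))).

Definition mxsimp :=
  (tr_row_mx, tr_col_mx, trmx0, trmx1, row_mx0, col_mx0, block_mx0,
   mulmx0, mul0mx, mulmx1, mul1mx, addr0, add0r,
   mul_row_col, mul_col_row).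

Definition zsimp := (mulmx0, mul0mx, addr0, add0r).

Definition mxsplit := (mul_col_mx, mul_mx_row).

Lemma rowA_iso m1 m2 m3 : isomx (rowA m1 m2 m3).
Proof.
apply: (@isomx_rinv _ _ _ (rowA m1 m2 m3)^T); first by rewrite addnA.
by rewrite /rowA !mxsimp !mxsplit !mxsimp -!scalar_mx_block.
Qed.

Lemma rowCA_iso m1 m2 m3 : isomx (rowCA m1 m2 m3).
Proof.
apply: (@isomx_rinv _ _ _ (rowCA m1 m2 m3)^T); first by rewrite addnCA.
by rewrite /rowCA !mxsimp !mxsplit !mxsimp -!scalar_mx_block.
Qed.

End Isomorphism.

(** Equality on summands is what allows them to be counted in a sequence. *)
Definition ksummand_code (F : fieldType) (t : ksummand F) : nat * F + (nat + (nat + nat)) :=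
  match t with
  | KIJ n l => inl (n, l)
  | KJI n => inr (inl n)
  | KFG n => inr (inr (inl n))
  | KFGT n => inr (inr (inr n))
  end.

Definition ksummand_decode (F : fieldType) (x : nat * F + (nat + (nat + nat))) : ksummand F :=
  match x with
  | inl p => KIJ p.1 p.2
  | inr (inl n) => KJI n
  | inr (inr (inl n)) => KFG n
  | inr (inr (inr n)) => KFGT n
  end.

Lemma ksummand_codeK (F : fieldType) : cancel (@ksummand_code F) (@ksummand_decode F).
Proof. by case. Qed.

HB.instance Definition _ (F : fieldType) :=
  Equality.copy (ksummand F) (can_type (@ksummand_codeK F)).

Section PairEquivalence.

Variable F : fieldType.

(** Rectangular transition matrices avoid the casts of [pair_equivalent]. *)
Definition peq m n m' n' (A B : 'M[F]_(m, n)) (A' B' : 'M_(m', n')) : Prop :=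
  exists (R : 'M_(m', m)) (S : 'M_(n, n')),
  [/\ isomx R, isomx S, R *m A *m S = A' & R *m B *m S = B'].

Lemma pair_equivalentP m n m' n' (A B : 'M[F]_(m, n)) (A' B' : 'M_(m', n')) :
  pair_equivalent A B A' B' <-> peq A B A' B'.
Proof.
split=> [[em [en [R [S [Ru Su hA hB]]]]]|[R [S [/andP [/eqP em Rf] /andP [/eqP en Sf] hA hB]]]].
  case: _ / em A' B' hA hB; case: _ / en => A' B' hA hB.
  by exists R, S; rewrite !isomxE -hA -hB !castmx_id.
move: A' B' R S Rf Sf hA hB; rewrite em -en => A' B' R S; rewrite !row_free_unit => Ru Su hA hB.
by exists erefl, erefl, R, S; rewrite !castmx_id.
Qed.

Lemma peq_refl m n (A B : 'M[F]_(m, n)) : peq A B A B.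
Proof. by exists 1%:M, 1%:M; rewrite !isomx1 !mulmx1 !mul1mx. Qed.

Lemma peq_trans m n m' n' p q (A B : 'M[F]_(m, n)) (A' B' : 'M_(m', n')) (C D : 'M_(p, q)) :
  peq A B A' B' -> peq A' B' C D -> peq A B C D.
Proof.
move=> [R [S [Ri Si <- <-]]] [R' [S' [Ri' Si' <- <-]]].
by exists (R' *m R), (S *m S'); rewrite !isomxM // !mulmxA.
Qed.

Lemma peq_sym m n m' n' (A B : 'M[F]_(m, n)) (A' B' : 'M_(m', n')) :
  peq A B A' B' -> peq A' B' A B.
Proof.
move=> [R [S [/isomxP [R' [Ri' _ RR]] /isomxP [S' [Si' SS _]] <- <-]]].
exists R', S'; split=> //.
  by rewrite !mulmxA RR mul1mx -mulmxA SS mulmx1.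
by rewrite !mulmxA RR mul1mx -mulmxA SS mulmx1.
Qed.

Lemma peq_block m1 n1 m1' n1' m2 n2 m2' n2'
  (A1 B1 : 'M[F]_(m1, n1)) (A1' B1' : 'M_(m1', n1'))
  (A2 B2 : 'M[F]_(m2, n2)) (A2' B2' : 'M_(m2', n2')) :
  peq A1 B1 A1' B1' -> peq A2 B2 A2' B2' ->
  peq (block_mx A1 0 0 A2) (block_mx B1 0 0 B2) (block_mx A1' 0 0 A2') (block_mx B1' 0 0 B2').
Proof.
move=> [R [S [Ri Si <- <-]]] [R' [S' [Ri' Si' <- <-]]].
exists (block_mx R 0 0 R'), (block_mx S 0 0 S'); rewrite !isomx_block //.
by rewrite !mulmx_block !zsimp.
Qed.

Lemma peqA m1 n1 m2 n2 m3 n3 (A1 B1 : 'M[F]_(m1, n1)) (A2 B2 : 'M_(m2, n2)) (A3 B3 : 'M_(m3, n3)) :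
  peq (block_mx A1 0 0 (block_mx A2 0 0 A3)) (block_mx B1 0 0 (block_mx B2 0 0 B3))
      (block_mx (block_mx A1 0 0 A2) 0 0 A3) (block_mx (block_mx B1 0 0 B2) 0 0 B3).
Proof.
exists (rowA _ _ _ _), (rowA _ _ _ _)^T; rewrite ?isomx_tr ?rowA_iso //.
have mulA (C1 : 'M[F]_(m1, n1)) (C2 : 'M_(m2, n2)) (C3 : 'M_(m3, n3)) :
  rowA F _ _ _ *m block_mx C1 0 0 (block_mx C2 0 0 C3) *m (rowA _ _ _ _)^T
   = block_mx (block_mx C1 0 0 C2) 0 0 C3.
  by rewrite /rowA !mul_col_mx !mul_row_block !mxsimp !mul_mx_row !mxsimp;
  congr (col_mx _ _); rewrite -[LHS]/(block_mx _ _ _ _) block_mxEh col_mx0.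
by rewrite !mulA.
Qed.

Lemma peqCA m1 n1 m2 n2 m3 n3 (A1 B1 : 'M[F]_(m1, n1)) (A2 B2 : 'M_(m2, n2)) (A3 B3 : 'M_(m3, n3)) :
  peq (block_mx A1 0 0 (block_mx A2 0 0 A3)) (block_mx B1 0 0 (block_mx B2 0 0 B3))
      (block_mx A2 0 0 (block_mx A1 0 0 A3)) (block_mx B2 0 0 (block_mx B1 0 0 B3)).
Proof.
exists (rowCA _ _ _ _), (rowCA _ _ _ _)^T; rewrite ?isomx_tr ?rowCA_iso //.
have mulCA (C1 : 'M[F]_(m1, n1)) (C2 : 'M_(m2, n2)) (C3 : 'M_(m3, n3)) :
  rowCA F _ _ _ *m block_mx C1 0 0 (block_mx C2 0 0 C3) *m (rowCA _ _ _ _)^T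
   = block_mx C2 0 0 (block_mx C1 0 0 C3).
  by rewrite /rowCA !mul_col_mx !mul_row_block !mxsimp !mul_mx_row !mxsimp;
  congr (col_mx _ _); rewrite -[LHS]/(block_mx _ _ _ _) block_mxEh col_mx0.
by rewrite !mulCA.
Qed.

Lemma peq_block00 m n (A B : 'M[F]_(m, n)) (Z : 'M_(0, 0)) :
  peq (block_mx A 0 0 Z) (block_mx B 0 0 Z) A B.
Proof.
exists (row_mx 1%:M 0), (col_mx 1%:M 0); split.
- by apply: (@isomx_rinv _ _ _ _ (col_mx 1%:M 0)); rewrite ?addn0 // !mxsimp.
- rewrite -[col_mx _ _]trmxK; apply: isomx_tr; rewrite tr_col_mx trmx1 trmx0.
  by apply: (@isomx_rinv _ _ _ _ (col_mx 1%:M 0)); rewrite ?addn0 // !mxsimp.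
- by rewrite mul_row_block !mxsimp.
- by rewrite mul_row_block !mxsimp.
Qed.

Local Notation ksum1 := (dsum (@kfst F)).
Local Notation ksum2 := (dsum (@ksnd F)).

Lemma peq_dsum_cat (s t : seq (ksummand F)) :
  peq (ksum1 (s ++ t)) (ksum2 (s ++ t))
      (block_mx (ksum1 s) 0 0 (ksum1 t)) (block_mx (ksum2 s) 0 0 (ksum2 t)).
Proof.
elim: s => [|x s IH] /=.
  apply: peq_sym; exists (row_mx 0 1%:M), (col_mx 0 1%:M); split.
  - by apply: (@isomx_rinv _ _ _ _ (col_mx 0 1%:M)); rewrite ?addn0 // !mxsimp.
  - rewrite -[col_mx _ _]trmxK; apply: isomx_tr; rewrite tr_col_mx trmx1 trmx0.
    by apply: (@isomx_rinv _ _ _ _ (col_mx 0 1%:M)); rewrite ?addn0 // !mxsimp.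
  - by rewrite mul_row_block !mxsimp.
  - by rewrite mul_row_block !mxsimp.
exact: peq_trans (peq_block (peq_refl _ _) IH) (peqA _ _ _ _ _ _).
Qed.

Lemma peq_dsum_mid (s t : seq (ksummand F)) x :
  peq (ksum1 (s ++ x :: t)) (ksum2 (s ++ x :: t)) (ksum1 (x :: s ++ t)) (ksum2 (x :: s ++ t)).
Proof.
elim: s => [|y s IH] /=; first exact: peq_refl.
exact: peq_trans (peq_block (peq_refl _ _) IH) (peqCA _ _ _ _ _ _).
Qed.

Lemma peq_dsum_perm (s t : seq (ksummand F)) :
  perm_eq s t -> peq (ksum1 s) (ksum2 s) (ksum1 t) (ksum2 t).
Proof.
elim: s t => [|x s IH] t; first by rewrite perm_sym => /perm_nilP ->; exact: peq_refl.
move=> hp; have xt : x \in t by rewrite -(perm_mem hp) mem_head.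
move: hp; case/splitPr: xt => t1 t2 hp.
apply: peq_trans (peq_sym (peq_dsum_mid _ _ _)).
apply: peq_block (peq_refl _ _) (IH _ _).
by move: hp; rewrite perm_sym -cat1s perm_catCA perm_cons perm_sym.
Qed.

End PairEquivalence.

Section Congruence.

Variables (F : fieldType) (bar : {rmorphism F -> F}).
Hypothesis barK : involutive bar.

Local Notation "A ^h" := (star bar A) (at level 2, format "A ^h").

(** Cast-free like [peq]; here [S] is the conjugate transpose of the matrix in [star_congruent]. *)
Definition cong m n (A : 'M[F]_m) (B : 'M_n) : Prop :=
  exists2 S : 'M_(n, m), isomx S & S *m A *m S^h = B.

Lemma star_congruentP m n (A : 'M[F]_m) (B : 'M_n) :
  star_congruent bar A B <-> cong A B.
Proof.
split=> [[e [S Su <-]]|[S /andP [/eqP e Sf] hB]].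
  case: _ / e; exists S^h; first by rewrite isomxE star_unit.
  by rewrite castmx_id (starK barK).
move: S Sf B hB; rewrite e => S; rewrite row_free_unit => Su B hB.
by exists erefl, S^h; rewrite ?star_unit // castmx_id (starK barK).
Qed.

Lemma cong_refl m (A : 'M[F]_m) : cong A A.
Proof. by exists 1%:M; rewrite ?isomx1 // star1 mul1mx mulmx1. Qed.

Lemma cong_trans m n p (A : 'M[F]_m) (B : 'M_n) (C : 'M_p) :
  cong A B -> cong B C -> cong A C.
Proof.
move=> [S Si <-] [T Ti <-]; exists (T *m S); first exact: isomxM.
by rewrite starM !mulmxA.
Qed.

Lemma cong_sym m n (A : 'M[F]_m) (B : 'M_n) : cong A B -> cong B A.
Proof.
move=> [S /isomxP [T [Ti ST TS]] <-]; exists T => //.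
by rewrite !mulmxA TS mul1mx -mulmxA -starM TS star1 mulmx1.
Qed.

Lemma cong_block m1 n1 m2 n2 (A : 'M[F]_m1) (B : 'M_n1) (A' : 'M[F]_m2) (B' : 'M_n2) :
  cong A B -> cong A' B' -> cong (block_mx A 0 0 A') (block_mx B 0 0 B').
Proof.
move=> [S Si <-] [S' Si' <-]; exists (block_mx S 0 0 S'); first exact: isomx_block.
by rewrite star_block_mx !mulmx_block !star0 !zsimp.
Qed.

Lemma cong_peq m n (A : 'M[F]_m) (B : 'M_n) : cong A B -> peq A^h A B^h B.
Proof.
move=> [S Si <-]; exists S, S^h; split=> //; last by rewrite !starM (starK barK) mulmxA.
case/isomxP: Si => T [/andP [/eqP e _] _ TS].
by apply: (@isomx_rinv _ _ _ _ T^h) => //; rewrite -starM TS star1.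
Qed.

Lemma cong_gram m n (A : 'M[F]_m) (X : 'M_(n, m)) : isomx X -> cong A (X *m A *m X^h).
Proof. by move=> Xi; exists X. Qed.

Lemma cong_split m k l (A : 'M[F]_m) (X : 'M_(k, m)) (U : 'M_(l, m)) :
  isomx (col_mx X U) -> X *m A *m U^h = 0 -> U *m A *m X^h = 0 ->
  cong A (block_mx (X *m A *m X^h) 0 0 (U *m A *m U^h)).
Proof.
by move=> Wi XU UX; exists (col_mx X U) => //; rewrite star_col_mx mul_col_mx mul_col_row XU UX.
Qed.

Lemma congA m1 m2 m3 (A1 : 'M[F]_m1) (A2 : 'M_m2) (A3 : 'M_m3) :
  cong (block_mx A1 0 0 (block_mx A2 0 0 A3)) (block_mx (block_mx A1 0 0 A2) 0 0 A3).
Proof.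
exists (rowA _ _ _ _); first exact: rowA_iso.
by rewrite /rowA !mul_col_mx !mul_row_block !mxsimp !starmxE !mul_mx_row !mxsimp;
  congr (col_mx _ _); rewrite -[LHS]/(block_mx _ _ _ _) block_mxEh col_mx0.
Qed.

Lemma congCA m1 m2 m3 (A1 : 'M[F]_m1) (A2 : 'M_m2) (A3 : 'M_m3) :
  cong (block_mx A1 0 0 (block_mx A2 0 0 A3)) (block_mx A2 0 0 (block_mx A1 0 0 A3)).
Proof.
exists (rowCA _ _ _ _); first exact: rowCA_iso.
by rewrite /rowCA !mul_col_mx !mul_row_block !mxsimp !starmxE !mul_mx_row !mxsimp;
  congr (col_mx _ _); rewrite -[LHS]/(block_mx _ _ _ _) block_mxEh col_mx0.
Qed.

Lemma cong_block00 m (A : 'M[F]_m) (Z : 'M_0) : cong (block_mx A 0 0 Z) A.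
Proof.
exists (row_mx 1%:M 0).
  by apply: (@isomx_rinv _ _ _ _ (col_mx 1%:M 0)); rewrite ?addn0 // !mxsimp.
by rewrite !starmxE mul_row_block !mxsimp.
Qed.

Lemma cong_00block m (A : 'M[F]_m) (Z : 'M_0) : cong (block_mx Z 0 0 A) A.
Proof.
exists (row_mx 0 1%:M).
  by apply: (@isomx_rinv _ _ _ _ (col_mx 0 1%:M)); rewrite ?addn0 // !mxsimp.
by rewrite !starmxE mul_row_block !mxsimp.
Qed.

Local Notation csum := (dsum (@cmx F)).

Lemma cong_dsum_cat (s t : seq (csummand F)) :
  cong (csum (s ++ t)) (block_mx (csum s) 0 0 (csum t)).
Proof.
elim: s => [|x s IH] /=; first exact/cong_sym/cong_00block.
exact: cong_trans (cong_block (cong_refl _) IH) (congA _ _ _).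
Qed.

Lemma cong_dsum_mid (s t : seq (csummand F)) x :
  cong (csum (s ++ x :: t)) (csum (x :: s ++ t)).
Proof.
elim: s => [|y s IH] /=; first exact: cong_refl.
exact: cong_trans (cong_block (cong_refl _) IH) (congCA _ _ _).
Qed.

Lemma cong_dsum_perm (s t : seq (csummand F)) : perm_eq s t -> cong (csum s) (csum t).
Proof.
elim: s t => [|x s IH] t; first by rewrite perm_sym => /perm_nilP ->; exact: cong_refl.
move=> hp; have xt : x \in t by rewrite -(perm_mem hp) mem_head.
move: hp; case/splitPr: xt => t1 t2 hp.
apply: cong_trans (cong_sym (cong_dsum_mid _ _ _)).
apply: cong_block (cong_refl _) (IH _ _).
by move: hp; rewrite perm_sym -cat1s perm_catCA perm_cons perm_sym.
Qed.

Lemma cong_dsum_all2 (e : rel (csummand F)) (s t : seq (csummand F)) :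
  (forall x y, x \in s -> y \in t -> e x y -> cong (cmx x) (cmx y)) ->
  all2 e s t -> cong (csum s) (csum t).
Proof.
elim: s t => [|x s IH] [|y t] //= h; first by move=> _; exact: cong_refl.
move=> /andP [exy hst]; apply: cong_block; first by apply: h; rewrite ?mem_head.
by apply: IH hst => a b ha hb; apply: h; rewrite inE ?ha ?hb orbT.
Qed.

End Congruence.

(** * Nonsingular blocks *)

Lemma horner_mx_intertwine (F : fieldType) (m : nat) (A A' B : 'M[F]_m.+1) (p : {poly F}) :
  A *m B = B *m A' -> horner_mx A p *m B = B *m horner_mx A' p.
Proof.
move=> AB; elim/poly_ind: p => [|p c IH]; first by rewrite !rmorph0 mul0mx mulmx0.
rewrite !rmorphD !rmorphM /= !horner_mx_X !horner_mx_C -!mulmxE mulmxDl mulmxDr.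
by rewrite -mulmxA AB mulmxA IH mulmxA mul_scalar_mx mul_mx_scalar.
Qed.

Section SingleBlock.

Variables (F : closedFieldType) (bar : {rmorphism F -> F}).
Hypotheses (barK : involutive bar) (bar_nonid : exists a : F, bar a != a).
Variables (im : F) (im_sqr : im ^+ 2 = -1).

Local Notation "A ^h" := (star bar A) (at level 2, format "A ^h").

Lemma star_horner_mx (m : nat) (A : 'M[F]_m.+1) (p : {poly F}) :
  (horner_mx A p)^h = horner_mx A^h (map_poly bar p).
Proof.
elim/poly_ind: p => [|p c IH]; first by rewrite !rmorph0 star0.
rewrite !rmorphD !rmorphM /= map_polyX map_polyC /= !horner_mx_X !horner_mx_C -!mulmxE.
rewrite starD starM IH star_scalar; congr (_ + _).
exact/esym/horner_mx_intertwine.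
Qed.

(** A truncation of the binomial series for the square root of [1 + 'X]. Its coefficients are fixed
    by [bar], so that evaluating it commutes with the conjugate transpose. *)
Lemma sqrt_poly (k : nat) : exists p q : {poly F},
  [/\ map_poly bar p = p, map_poly bar q = q, p`_0 = 1 & p ^+ 2 = 1 + 'X + 'X^(k.+1) * q].
Proof.
elim: k => [|k [p [q [bp bq p0 hp]]]].
  exists 1, (-1); split; rewrite ?rmorphN ?rmorph1 ?coef1 //.
  by rewrite expr1n mulrN1 addrK.
(* Chosen so that subtracting [a *: 'X^(k.+1)] from [p] cancels the constant term of the remainder,
   as [p] has constant term 1. *)
pose a := q`_0 / 2%:R.
have ba : bar a = a.
  by rewrite /a fmorph_div rmorph_nat -{2}bq coef_map.
pose r := q - (a *+ 2) *: p + a ^+ 2 *: 'X^(k.+1).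
have br : map_poly bar r = r.
  rewrite /r rmorphD rmorphB /= !map_polyZ /= map_polyXn bp bq !(rmorphMn, rmorphXn) /= ba.
  by [].
have r0 : r`_0 = 0.
  rewrite !coefD coefN !coefZ p0 coefXn /= mulr0 addr0 mulr1.
  by rewrite -mulr_natr /a divfK ?subrr // (char_neq2 barK bar_nonid).
exists (p - a *: 'X^(k.+1)), (drop_poly 1 r); split.
- by rewrite rmorphB /= map_polyZ /= map_polyXn bp ba.
- by apply/polyP => i; rewrite coef_map /= !coef_drop_poly -{2}br coef_map.
- by rewrite coefB coefZ coefXn p0 mulr0 subr0.
- have -> : 'X^(k.+2) * drop_poly 1 r = 'X^(k.+1) * r.
    rewrite -[in RHS](poly_take_drop 1 r) [X in X + _](_ : _ = 0).
      by rewrite add0r exprSr expr1 -mulrA; congr (_ * _); rewrite mulrC.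
    by apply/polyP => i; rewrite coef_take_poly coef0; case: i => [|i]; rewrite ?r0.
  rewrite sqrrB hp /r -!mul_polyC; ring.
Qed.

(* [B = C B0] with [C] in the centralizer of the Jordan block; its corner entry is
   real, and up to its sign [C] is a square [R *m R] with [R *m B0 = B0 *m R^h]. *)
Lemma single_block_cong (m : nat) (l : F) (B B0 : 'M[F]_m.+1) :
  l != 0 -> B \in unitmx -> B0 \in unitmx ->
  B = jordan m.+1 l *m B^h -> B0 = jordan m.+1 l *m B0^h ->
  cong bar B B0 \/ cong bar B (- B0).
Proof.
set J := jordan m.+1 l => l0 Bu B0u hB hB0.
pose C := B *m invmx B0.
have CB0 : C *m B0 = B by rewrite mulmxKV.
have Ju : J \in unitmx.
  by move: Bu; rewrite hB unitmx_mul => /andP [].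
(* Using the relation twice shows that [J] is an isometry of both forms, which is why [C] commutes
   with [J]. *)
have JBJ (X : 'M[F]_m.+1) : X = J *m X^h -> J *m X *m J^h = X.
  move=> h; have hs : X^h = X *m J^h by rewrite {1}h starM (starK barK).
  by rewrite -mulmxA -hs -h.
have CJ : J *m C = C *m J.
  have Jhu : J^h \in unitmx by rewrite star_unit.
  apply: (can_inj (mulmxK B0u)); apply: (can_inj (mulmxK Jhu)).
  rewrite -!(mulmxA J) CB0 mulmxA JBJ //.
  by rewrite -!(mulmxA C) !mulmxA -(mulmxA C) -(mulmxA C) JBJ.
have CN : jordan m.+1 0 *m C = C *m jordan m.+1 0.
  by move: CJ; rewrite /J jordanE mulmxDl mulmxDr mul_scalar_mx mul_mx_scalar => /addrI.
have CBh : C *m B0 = B0 *m C^h.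
  by rewrite CB0 hB -CB0 starM mulmxA -hB0.
set g := C 0 0; pose N := C - g%:M.
have Nnil : N ^+ m.+1 = 0 := commutant_nilp CN.
have Cu : C \in unitmx by rewrite unitmx_mul Bu unitmx_inv.
have g0 : g != 0.
  apply/eqP => e; have : C ^+ m.+1 = 0 by rewrite -Nnil /N e rmorph0 subr0.
  move=> h; have : C ^+ m.+1 \is a GRing.unit by rewrite unitrX.
  by rewrite h unitr0.
(* [B0] conjugates [C] into [C^h], so their traces agree; both diagonals are constant and the
   characteristic is zero. *)
have bg : bar g = g.
  have : \tr C = \tr (C^h).
    by rewrite -[C in LHS](mulmxK B0u) CBh mxtrace_mulC mulKmx.
  rewrite /mxtrace (eq_bigr (fun=> g)); last by move=> i _; exact: commutant_diag.
  rewrite [RHS](eq_bigr (fun=> bar g)); last by move=> i _; rewrite starE commutant_diag.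
  rewrite !sumr_const card_ord => h.
  apply: (mulIf (natr_neq0 barK bar_nonid im_sqr (ltn0Sn m))).
  by rewrite !mulr_natr h.
pose N1 := g^-1 *: N.
have N1nil : N1 ^+ m.+1 = 0 by rewrite /N1 exprZn Nnil scaler0.
have N1B0 : N1 *m B0 = B0 *m N1^h.
  rewrite /N1 starZ fmorphV bg -scalemxAl -scalemxAr /N starB star_scalar bg.
  by rewrite mulmxBl mulmxBr CBh mul_scalar_mx mul_mx_scalar.
have [p [q [bp _ _ hp]]] := sqrt_poly m.
pose R := horner_mx N1 p.
have RR : R *m R = g^-1 *: C.
  rewrite mulmxE -expr2 /R -rmorphXn hp !rmorphD rmorphM !rmorphXn /= rmorph1 horner_mx_X.
  by rewrite N1nil mul0r addr0 /N1 /N scalerBr -scalemx1 scalerA mulVf // scale1r addrC subrK.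
have RB0 : R *m B0 = B0 *m R^h.
  by rewrite /R star_horner_mx bp; exact: horner_mx_intertwine.
have Ru : R \in unitmx.
  have : R *m R \in unitmx by rewrite RR unitmxZ // unitfE invr_eq0.
  by rewrite unitmx_mul andbb.
have RBR : R *m B0 *m R^h = g^-1 *: B.
  by rewrite -mulmxA -RB0 mulmxA RR -scalemxAl CB0.
(* [e] is the sign of [g] and [c] a fixed square root of [e * g]; then [c *: R] carries [e *: B0] to
   [B]. *)
have main (e : F) : (e == 1) || (e == -1) -> nneg bar (e * g) -> cong bar B (e *: B0).
  move=> he /(nneg_sqrt barK) [c [bc _] hc].
  have ee : e * e = 1 by case/orP: he => /eqP ->; rewrite ?mulr1 // mulrNN mulr1.
  have c0 : c != 0.
    apply: contraNneq g0 => c0; move: hc; rewrite c0 expr0n => /esym/eqP.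
    rewrite mulf_eq0 => /orP [/eqP e0|//].
    by move: ee; rewrite e0 mul0r => /esym/eqP; rewrite oner_eq0.
  apply: cong_sym => //; exists (c *: R); first by rewrite isomxE unitmxZ // unitfE.
  rewrite starZ bc -!scalemxAl -!scalemxAr -scalemxAl RBR !scalerA.
  have -> : c * (c * e) * g^-1 = (e * e) * (g * g^-1) by rewrite mulrA -expr2 hc; ring.
  by rewrite ee mulfV // mulr1 scale1r.
case: (nneg_real bg) => hg; [left | right].
  by rewrite -[B0]scale1r; apply: main; rewrite ?eqxx // mul1r.
by rewrite -scaleN1r; apply: main; rewrite ?eqxx ?orbT // mulN1r.
Qed.

End SingleBlock.

Section Unicellular.

Variable F : fieldType.

(* [T] has a single Jordan block, with eigenvalue [l]. *)
Definition unicell (n : nat) (T : 'M[F]_n) (l : F) : Prop :=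
  (T - l%:M) ^+ n = 0 /\ (T - l%:M) ^+ n.-1 != 0.

Lemma unicell_similar (n : nat) (T : 'M[F]_n.+1) (l : F) :
  unicell T l -> exists2 X : 'M[F]_n.+1, X \in unitmx & X *m T = jordan n.+1 l *m X.
Proof. by case=> h1 h2; exact: similar_jordan. Qed.

Lemma shift_exp (n k : nat) (i j : 'I_n) :
  (jordan n 0 ^+ k : 'M[F]_n) i j = (j == i + k :> nat)%N%:R.
Proof.
elim: k i j => [|k IH] i j; first by rewrite expr0 mxE addn0 eq_sym.
rewrite exprSr -mulmxE (mul_shift_r (f := fun a b => (b == a + k.+1)%N%:R)) //.
  by move=> a b; rewrite IH addnS eqSS.
by move=> a; rewrite addnS.
Qed.

Lemma unicell_jordan (n : nat) (l : F) : unicell (jordan n.+1 l) l.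
Proof.
rewrite /unicell jordanE addrC addKr; split.
  apply/matrixP => i j; rewrite shift_exp mxE.
  by case: eqP => // h; have := ltn_ord j; lia.
apply/eqP => /matrixP /(_ ord0 ord_max); rewrite shift_exp mxE /= add0n eqxx => /eqP.
by rewrite oner_eq0.
Qed.

(** Powers of [D *m U] are powers of [D] times a unit, so [T - l%:M] has the nilpotency index of
    [D]. *)
Lemma unicell_mul (n : nat) (T D U : 'M[F]_n) (l c : F) :
  T - l%:M = c *: (D *m U) -> c != 0 -> U \in unitmx -> D *m U = U *m D ->
  D ^+ n = 0 -> D ^+ n.-1 != 0 -> unicell T l.
Proof.
rewrite /unicell => -> c0 Uu DU Dn Dn1.
have comm k : (c *: (D *m U)) ^+ k = c ^+ k *: (D ^+ k *m U ^+ k).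
  elim: k => [|k IH]; first by rewrite !expr0 scale1r mulmx1.
  have UkD' : U ^+ k *m D = D *m U ^+ k by rewrite !mulmxE; apply/commr_sym/commrX.
  rewrite exprSr -mulmxE IH -scalemxAr -scalemxAl scalerA -exprS !exprSr -!mulmxE.
  by rewrite -!mulmxA; congr (_ *: (_ *m _)); rewrite !mulmxA UkD'.
split; rewrite comm; first by rewrite Dn mul0mx scaler0.
rewrite scaler_eq0 expf_eq0 (negPf c0) andbF /=.
apply: contraNneq Dn1 => h; have Uk k : U ^+ k \in unitmx.
  elim: k => [|k IH]; first by rewrite expr0 unitmx1.
  by rewrite exprS -mulmxE unitmx_mul Uu.
by rewrite -[D ^+ _](mulmxK (Uk n.-1)) h mul0mx.
Qed.

Lemma unicell_tr (n : nat) (T : 'M[F]_n) (l : F) : unicell T l -> unicell T^T l.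
Proof.
have -> : T = T^T^T by rewrite trmxK.
rewrite /unicell -{1 2}(tr_scalar_mx _ l) -linearB /= -!trmx_exp trmxK.
by case=> /(congr1 trmx) + h; rewrite trmxK trmx0; split=> //; rewrite -trmx0 (inj_eq trmx_inj) in h.
Qed.

(** The difference [invmx T - l^-1] is [- l^-1] times [(T - l) *m invmx T]. *)
Lemma unicell_inv (n : nat) (T : 'M[F]_n) (l : F) :
  T \in unitmx -> l != 0 -> unicell T l -> unicell (invmx T) l^-1.
Proof.
move=> Tu l0 [h1 h2]; have TD : (T - l%:M) *m invmx T = invmx T *m (T - l%:M).
  by rewrite mulmxBl mulmxBr mulmxV // mulVmx // mul_scalar_mx mul_mx_scalar.
apply: (@unicell_mul n _ (T - l%:M) (invmx T) _ (- l^-1)) => //.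
- rewrite mulmxBl mulmxV // mul_scalar_mx scalerBr scalerA mulNr mulVf // scaleN1r opprK.
  by rewrite scaleNr scalemx1 addrC.
- by rewrite oppr_eq0 invr_eq0.
- by rewrite unitmx_inv.
Qed.

Lemma unicell_conj (n : nat) (X T T' : 'M[F]_n) (l : F) :
  X \in unitmx -> X *m T = T' *m X -> unicell T l -> unicell T' l.
Proof.
move=> Xu XT [h1 h2].
have XD1 : X *m (T - l%:M) = (T' - l%:M) *m X.
  by rewrite mulmxBl mulmxBr XT mul_scalar_mx mul_mx_scalar.
have XD k : X *m (T - l%:M) ^+ k = (T' - l%:M) ^+ k *m X.
  elim: k => [|k IH]; first by rewrite !expr0 mulmx1 mul1mx.
  by rewrite exprSr [in RHS]exprSr -!mulmxE mulmxA IH -!mulmxA XD1.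
split.
  by rewrite -[LHS](mulmxK Xu) -XD h1 mulmx0 mul0mx.
by apply: contraNneq h2 => h; rewrite -[X in X == 0](mulKmx Xu) XD h mul0mx mulmx0.
Qed.

Lemma unicell_map (f : {rmorphism F -> F}) (n : nat) (T : 'M[F]_n) (l : F) :
  unicell T l -> unicell (map_mx f T) (f l).
Proof.
have h k : (map_mx f T - (f l)%:M) ^+ k = map_mx f ((T - l%:M) ^+ k).
  elim: k => [|k IH]; first by rewrite !expr0 map_mx1.
  by rewrite !exprS -!mulmxE map_mxM -IH map_mxB map_scalar_mx.
by rewrite /unicell !h => -[-> h2]; rewrite map_mx0 map_mx_eq0.
Qed.

Lemma rank_shift (n : nat) : \rank (jordan n 0 : 'M[F]_n) = n.-1.
Proof.
case: n => [|n]; first by apply/eqP; rewrite -leqn0 rank_leq_row.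
apply/eqP; rewrite eqn_leq; apply/andP; split.
  rewrite -ltnS ltn_neqAle rank_leq_row andbT -/(row_free _) row_free_unit.
  apply/negP => h; have : (jordan n.+1 0 : 'M[F]_n.+1) ^+ n.+1 \in unitmx.
    by rewrite unitrX.
  have [] := unicell_jordan n 0; rewrite rmorph0 subr0 => -> _.
  by rewrite unitr0.
have e : (jordan n.+1 0)^T *m jordan n.+1 0 = copid_mx 1 :> 'M[F]_n.+1.
  apply/matrixP => i j.
  rewrite (mul_shift_r (f := fun a b => ((0 < b) && (a == b))%N%:R)) //.
    rewrite !mxE -val_eqE /=; case: i j => [[|i] hi] [[|j] hj] //=; rewrite ?subrr ?subr0 //.
    by rewrite andbF subr0.
  by move=> a b; rewrite mxE shiftE.
have := mxrankM_maxr (jordan n.+1 0)^T (jordan n.+1 0 : 'M[F]_n.+1).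
by rewrite e rank_copid_mx // subn1.
Qed.

(** Sylvester's rank inequality: each factor loses at most one. For corank at most one this makes
    the power [n.-1] nonzero when n is positive. *)
Lemma rank_expmx (n k : nat) (M : 'M[F]_n) : (n.-1 <= \rank M)%N -> (n - k <= \rank (M ^+ k))%N.
Proof.
move=> rM; elim: k => [|k IH]; first by rewrite expr0 subn0 mxrank1.
by rewrite exprS -mulmxE; have := mxrank_mul_min M (M ^+ k); lia.
Qed.

End Unicellular.

(** Over an algebraically closed field the characteristic polynomial can then only be a power of
    ['X]. *)
Lemma nilpotent_of_units (F : closedFieldType) (n : nat) (M : 'M[F]_n.+1) :
  (forall t, t != 0 -> M - t%:M \in unitmx) -> M ^+ n.+1 = 0.
Proof.
move=> h; have [rs hrs] := closed_field_poly_normal (char_poly M).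
have rs0 : all (pred1 0) rs.
  apply/allP => r hr; apply: contraTT isT => r0.
  have : root (char_poly M) r by rewrite hrs rootZ ?lead_coef_eq0 ?root_prod_XsubC // (monic_neq0 (char_poly_monic _)).
  rewrite -eigenvalue_root_char => /eigenvalueP [v /eqP hv v0].
  move: v0; rewrite -(mulmxK (h r r0) v) mulmxBr mul_mx_scalar.
  by move/eqP: hv => ->; rewrite subrr mul0mx eqxx.
have e : char_poly M = 'X^(n.+1).
  have sz : size rs = n.+1.
    have := size_char_poly M; rewrite {1}hrs (monicP (char_poly_monic M)) scale1r.
    by rewrite size_prod_XsubC => -[].
  rewrite hrs (monicP (char_poly_monic M)) scale1r.
  rewrite (eq_big_seq (fun=> 'X)); first by rewrite big_const_seq count_predT iter_mulr_1 sz.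
  by move=> r /(allP rs0) /eqP ->; rewrite subr0.
by have := Cayley_Hamilton M; rewrite e rmorphXn /= horner_mx_X.
Qed.

(** * Permutation matrices and the matrices of type (i) *)

Section Selection.

Variable F : fieldType.

(** A permutation matrix when [f] restricts to a bijection; [f] acts on naturals so that index
    identities can be left to [lia]. *)
Definition selmx (n m : nat) (f : nat -> nat) : 'M[F]_(n, m) :=
  \matrix_(i < n, j < m) (f i == j)%:R.

Lemma sel_mul (n m p : nat) (f : nat -> nat) (A : 'M[F]_(m, p)) (i : 'I_n) (j : 'I_p) :
  (f i < m)%N -> (selmx n m f *m A) i j = entry A (f i) j.
Proof.
move=> hf; rewrite mxE (bigD1 (Ordinal hf)) //= mxE eqxx mul1r big1 ?addr0.
  by rewrite (entryE _ (Ordinal hf)).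
by move=> k; rewrite -val_eqE /= mxE eq_sym => /negPf ->; rewrite mul0r.
Qed.

Lemma sel_mul_tr (n m p q : nat) (f g : nat -> nat) (A : 'M[F]_(m, p)) (i : 'I_n) (j : 'I_q) :
  (f i < m)%N -> (g j < p)%N ->
  (selmx n m f *m A *m (selmx q p g)^T) i j = entry A (f i) (g j).
Proof.
move=> hf hg; rewrite -[X in X *m _]trmxK -trmx_mul mxE sel_mul //.
by rewrite (entryE _ (Ordinal hg)) mxE sel_mul.
Qed.

Lemma sel_iso (n : nat) (f : nat -> nat) m :
  n = m -> (forall i, (i < n)%N -> (f i < m)%N) ->
  (forall i j, (i < n)%N -> (j < n)%N -> f i = f j -> i = j) -> isomx (selmx n m f).
Proof.
move=> e hf inj; apply: (@isomx_rinv _ _ _ _ (selmx n m f)^T) => //.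
apply/matrixP => i j; rewrite -[selmx _ _ _ in X in X *m _]mulmx1 sel_mul_tr ?hf //.
rewrite (entryE _ (Ordinal (hf _ (ltn_ord i))) (Ordinal (hf _ (ltn_ord j)))) !mxE -!val_eqE /=.
congr (nat_of_bool _)%:R; apply/idP/idP => /eqP; first by move/inj=> ->.
by move=> ->.
Qed.

Lemma star_sel (bar : {rmorphism F -> F}) n m f : star bar (selmx n m f) = (selmx n m f)^T.
Proof. by apply/matrixP => i j; rewrite !mxE rmorph_nat. Qed.

End Selection.

Section TypeI.

Variables (F : fieldType) (bar : {rmorphism F -> F}).
Hypothesis barK : involutive bar.

Local Notation "A ^h" := (star bar A) (at level 2, format "A ^h").

(** The form that pairs two isotropic subspaces of dimension [k]; it stands between the tridiagonal
    matrix and a pair of dual chains. *)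
Definition hyper (k : nat) (l : F) : 'M[F]_(k + k) := block_mx 0 1%:M (jordan k l) 0.

(** Lists the [k] even indices first and the odd ones after. A tridiagonal matrix with zero diagonal
    couples only indices of opposite parity, so this order makes it block antidiagonal. *)
Definition evenodd (k i : nat) : nat := if (i < k)%N then i.*2 else (i - k).*2.+1.

Definition tridiag_entry (l : F) (i j : nat) : F :=
  if j == i.+1 then 1 else if i == j.+1 then l else 0.

Lemma tridiagI_cong (k h : nat) (l : F) :
  (h == k) || (h == k.+1) ->
  cong bar (tridiagI (h + k) l)
    (block_mx 0 (\matrix_(i < h, j < k) tridiag_entry l i.*2 j.*2.+1)
       (\matrix_(i < k, j < h) tridiag_entry l i.*2.+1 j.*2) 0).
Proof.
move=> hk; exists (selmx F (h + k) (h + k) (evenodd h)).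
  apply: sel_iso => // [i hi|i j hi hj]; rewrite /evenodd; first by case: ifP; lia.
  by case: ifP; case: ifP; lia.
have lt (i : 'I_(h + k)) : (evenodd h i < h + k)%N.
  by rewrite /evenodd; have := ltn_ord i; case: ifP; lia.
have eo1 (i : 'I_h) : evenodd h (lshift k i) = i.*2 by rewrite /evenodd /= ltn_ord.
have eo2 (i : 'I_k) : evenodd h (rshift h i) = i.*2.+1.
  by rewrite /evenodd /= ltnNge leq_addr /= addKn.
have ent (i j : 'I_(h + k)) : entry (tridiagI (h + k) l) (evenodd h i) (evenodd h j)
    = tridiag_entry l (evenodd h i) (evenodd h j).
  by rewrite (entryE _ (Ordinal (lt i)) (Ordinal (lt j))) mxE.
apply/matrixP => i j; rewrite star_sel sel_mul_tr // ent.
case: (split_ordP i) => i' ->; case: (split_ordP j) => j' ->; rewrite ?eo1 ?eo2.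
- rewrite block_mxEul mxE /tridiag_entry; case: eqP; try lia. by case: eqP; try lia.
- by rewrite block_mxEur mxE.
- by rewrite block_mxEdl mxE.
- rewrite block_mxEdr mxE /tridiag_entry; case: eqP; try lia. by case: eqP; try lia.
Qed.

(** A congruence by [block_mx P 0 0 R] with [P *m X *m R^h = 1] normalizes the upper block and turns
    the lower one into the conjugate of [Y *m invmx X^h] by [R]. *)
Lemma hyper_congr (k : nat) (X Y : 'M[F]_k.+1) (l : F) :
  X \in unitmx -> unicell (Y *m invmx X^h) l ->
  cong bar (block_mx 0 X Y 0) (hyper k.+1 l).
Proof.
move=> Xu /unicell_similar [R Ru RT].
have Xhu : X^h \in unitmx by rewrite star_unit.
have Rhu : R^h \in unitmx by rewrite star_unit.
exists (block_mx (invmx R^h *m invmx X) 0 0 R).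
  by apply: isomx_block; rewrite isomxE // unitmx_mul !unitmx_inv Rhu.
have sinv (Z : 'M[F]_k.+1) : Z \in unitmx -> (invmx Z)^h = invmx Z^h.
  move=> Zu; have Zhu : Z^h \in unitmx by rewrite star_unit.
  by rewrite -[LHS](mulmxK Zhu) -starM mulmxV // star1 mul1mx.
rewrite star_block_mx !star0 !mulmx_block !zsimp mulmxKV // mulVmx // starM !sinv // (starK barK).
by rewrite !mulmxA -(mulmxA R) RT mulmxK.
Qed.

(** Here [X^h = 1 + bar l N] and [Y = l + N] with [N] the shift, so [Y - l X^h = (1 - l bar l) N]:
    the modulus condition is what makes [Y *m invmx X^h] a single Jordan block. *)
Lemma tridiagI_even (k : nat) (l : F) :
  l * bar l != 1 -> cong bar (tridiagI (k.+1 + k.+1) l) (hyper k.+1 l).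
Proof.
move=> hl; have := @tridiagI_cong k.+1 k.+1 l; rewrite eqxx => /(_ isT) /(cong_trans) h.
pose N : 'M[F]_k.+1 := jordan k.+1 0.
set X := (X in block_mx _ X _ _) in h; set Y := (X in block_mx _ _ X _) in h.
have XE : X = 1%:M + l *: N^T.
  apply/matrixP => i j; rewrite [RHS]mxE [X in _ = _ + X]mxE [N^T i j]mxE shiftE !mxE.
  rewrite /tridiag_entry -val_eqE /= eqSS eq_sym (inj_eq double_inj) -doubleS (inj_eq double_inj).
  case: eqP => [->|_]; first by rewrite ltn_eqF ?mulr0 ?addr0.
  by case: eqP; rewrite ?mulr1 ?mulr0 add0r.
have YE : Y = jordan k.+1 l.
  apply/matrixP => i j; rewrite !mxE /tridiag_entry -doubleS eqSS !(inj_eq double_inj).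
  rewrite (eq_sym (i : nat)).
  by case: (altP (_ =P i.+1 :> nat)) => // ->; rewrite gtn_eqF.
have XhE : X^h = 1%:M + bar l *: N.
  rewrite XE starD star1 starZ; congr (_ + _ *: _).
  by apply/matrixP => i j; rewrite starE mxE !shiftE rmorph_nat.
have Xu : X \in unitmx.
  rewrite unitmxE det_trig.
    by rewrite big1 ?unitr1 // => i _; rewrite !mxE /tridiag_entry eqxx.
  apply/is_trig_mxP => i j lt_ij; rewrite !mxE /tridiag_entry.
  by case: eqP => [|_]; [lia | case: eqP => //; lia].
apply: h; apply: hyper_congr => //.
have Xhu : X^h \in unitmx by rewrite star_unit.
have XN : X^h *m N = N *m X^h by rewrite XhE mulmxDl mulmxDr mul1mx mulmx1 -scalemxAl -scalemxAr.
have [N1 N2] := @unicell_jordan F k 0; rewrite rmorph0 subr0 in N1 N2.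
apply: (@unicell_mul F k.+1 _ N (invmx X^h) l (1 - l * bar l)) => //.
- apply: (can_inj (mulmxK Xhu)); rewrite mulmxBl mulmxKV // YE -scalemxAl mulmxKV //.
  rewrite mul_scalar_mx XhE jordanE scalerDr scalerA scalemx1 scalerBl scale1r.
  by rewrite opprD addrACA subrr add0r.
- by rewrite subr_eq0 eq_sym.
- by rewrite unitmx_inv.
- by rewrite -[LHS](mulKmx Xhu) (mulmxA X^h) XN mulmxK.
Qed.

End TypeI.

(** * Kronecker forms of the summands *)

Section KroneckerForms.

Variables (F : fieldType) (bar : {rmorphism F -> F}).
Hypothesis barK : involutive bar.

Local Notation "A ^h" := (star bar A) (at level 2, format "A ^h").

Lemma jordan_unit (k : nat) (l : F) : l != 0 -> jordan k l \in unitmx.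
Proof.
move=> l0; rewrite -unitmx_tr unitmxE det_trig.
  by rewrite unitfE; apply/prodf_neq0 => i _; rewrite !mxE eqxx.
apply/is_trig_mxP => i j lt_ij; rewrite !mxE ltn_eqF // ltn_eqF //.
exact: ltnW.
Qed.

(** Exchanging the two halves puts [J] above and 1 below. The matrix to be brought to Jordan form
    becomes [invmx J^h], with the single eigenvalue [(bar l)^-1]. *)
Lemma hyper_swap (k : nat) (l : F) :
  l != 0 -> cong bar (hyper k.+1 l) (hyper k.+1 (bar l)^-1).
Proof.
move=> l0; set J := jordan k.+1 l.
have Ju : J \in unitmx := jordan_unit _ l0.
have Jhu : J^h \in unitmx by rewrite star_unit.
apply: (@cong_trans _ _ _ _ _ _ (block_mx 0 J 1%:M 0)).
  exists (block_mx 0 1%:M 1%:M 0).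
    apply: (@isomx_rinv _ _ _ _ (block_mx 0 1%:M 1%:M 0)) => //.
    by rewrite mulmx_block !zsimp !mulmx1 -scalar_mx_block.
  by rewrite /hyper star_block_mx !star0 !star1 !mulmx_block !zsimp !mulmx1 !mul1mx.
apply: hyper_congr => //; rewrite mul1mx.
have [U1 U2] := unicell_tr (unicell_map bar (unicell_jordan k l)).
by apply: unicell_inv => //; rewrite fmorph_eq0.
Qed.

Lemma peq_swap (m1 n1 m2 n2 : nat) (A1 B1 : 'M[F]_(m1, n1)) (A2 B2 : 'M_(m2, n2)) :
  peq (block_mx 0 A1 A2 0) (block_mx 0 B1 B2 0) (block_mx A2 0 0 A1) (block_mx B2 0 0 B1).
Proof.
exists (block_mx 0 1%:M 1%:M 0), 1%:M; split.
- apply: (@isomx_rinv _ _ _ _ (block_mx 0 1%:M 1%:M 0)); first by rewrite addnC.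
  by rewrite mulmx_block !zsimp !mulmx1 -scalar_mx_block.
- exact: isomx1.
- by rewrite mulmx1 mulmx_block !zsimp !mul1mx.
- by rewrite mulmx1 mulmx_block !zsimp !mul1mx.
Qed.

Lemma peq_conj (n : nat) (X T T' : 'M[F]_n) :
  X \in unitmx -> X *m T = T' *m X -> peq T 1%:M T' 1%:M /\ peq 1%:M T 1%:M T'.
Proof.
move=> Xu h; split; exists X, (invmx X); split; rewrite ?isomxE ?unitmx_inv // ?h ?mulmxK //.
all: by rewrite mulmx1 mulmxV.
Qed.

Lemma peq_KIJ (n : nat) (A B : 'M[F]_n.+1) (l : F) :
  A \in unitmx -> unicell (B *m invmx A) l -> peq A B 1%:M (jordan n.+1 l).
Proof.
move=> Au /unicell_similar [X Xu XT]; have [_ h] := peq_conj Xu XT.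
apply: peq_trans h; exists 1%:M, (invmx A).
by rewrite isomx1 isomxE unitmx_inv !mul1mx mulmxV.
Qed.

Lemma peq_kJnuI (k : nat) (l : F) :
  peq (jordan k.+1 l)^T 1%:M (kfst (kJnuI k.+1 l)) (ksnd (kJnuI k.+1 l)).
Proof.
have hT := unicell_tr (unicell_jordan k l); rewrite /kJnuI; case: eqVneq => [->|l0] /=.
  have [X Xu XT] := unicell_similar (unicell_tr (@unicell_jordan F k 0)).
  by have [h _] := peq_conj Xu XT.
have Ju : (jordan k.+1 l)^T \in unitmx by rewrite unitmx_tr jordan_unit.
by apply: peq_KIJ; rewrite // mul1mx; apply: unicell_inv.
Qed.

Lemma peq_dsum1 (t : ksummand F) :
  peq (kfst t) (ksnd t) (dsum (@kfst F) [:: t]) (dsum (@ksnd F) [:: t]).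
Proof. exact/peq_sym/peq_block00. Qed.

Lemma is_KCF_peq m n m' n' (A B : 'M[F]_(m, n)) (A' B' : 'M_(m', n')) K :
  peq A B A' B' -> is_KCF A' B' K -> is_KCF A B K.
Proof.
move=> h [hv /pair_equivalentP hk]; split=> //.
by apply/pair_equivalentP; exact: peq_trans hk.
Qed.

Lemma is_KCF_perm m n (A B : 'M[F]_(m, n)) K K' :
  perm_eq K K' -> is_KCF A B K -> is_KCF A B K'.
Proof.
move=> hp [hv /pair_equivalentP hk]; split; first by rewrite -(perm_all _ hp).
by apply/pair_equivalentP; apply: peq_trans hk (peq_dsum_perm hp).
Qed.

Lemma is_KCF_block m n m' n' (A B : 'M[F]_(m, n)) (A' B' : 'M_(m', n')) K K' :
  is_KCF A B K -> is_KCF A' B' K' -> is_KCF (block_mx A 0 0 A') (block_mx B 0 0 B') (K ++ K').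
Proof.
move=> [hv /pair_equivalentP hk] [hv' /pair_equivalentP hk']; split; first by rewrite all_cat hv.
apply/pair_equivalentP; apply: peq_trans (peq_block hk hk') _.
exact/peq_sym/peq_dsum_cat.
Qed.

Lemma is_KCF1 m n (A B : 'M[F]_(m, n)) t :
  kvalid t -> peq A B (kfst t) (ksnd t) -> is_KCF A B [:: t].
Proof.
move=> tv h; split; first by rewrite /= tv.
by apply/pair_equivalentP; apply: peq_trans h (peq_dsum1 _).
Qed.

Lemma is_KCF_hyper (k : nat) (l : F) :
  is_KCF (hyper k.+1 l)^h (hyper k.+1 l) [:: kJnuI k.+1 (bar l); KIJ k.+1 l].
Proof.
rewrite /hyper star_block_mx !star0 !star1; apply: is_KCF_peq (peq_swap _ _ _ _) _.
apply: (@is_KCF_perm _ _ _ _ [:: KIJ k.+1 l; kJnuI k.+1 (bar l)]).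
  by rewrite (perm_catC [:: _] [:: _]).
apply: (@is_KCF_block _ _ _ _ _ _ _ _ [:: _] [:: _]); apply: is_KCF1 => //.
- exact: peq_refl.
- by rewrite /kJnuI; case: ifP.
have -> : (jordan k.+1 l)^h = (jordan k.+1 (bar l))^T.
  rewrite /star [jordan _ l]jordanE [jordan _ (bar l)]jordanE map_mxD map_scalar_mx.
  by congr (_ + _)^T; apply/matrixP => i j; rewrite [LHS]mxE !shiftE; exact: rmorph_nat.
exact: peq_kJnuI.
Qed.

Lemma star_Fmx n : (Fmx F n)^h = (Fmx F n)^T.
Proof. by apply/matrixP => i j; rewrite !mxE rmorph_nat. Qed.

Lemma star_Gmx n : (Gmx F n)^h = (Gmx F n)^T.
Proof. by apply/matrixP => i j; rewrite !mxE rmorph_nat. Qed.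

(** Reversing the order of rows and columns exchanges [Fmx] and [Gmx]. *)
Lemma peq_GFT (k : nat) : peq (Gmx F k)^T (Fmx F k)^T (Fmx F k)^T (Gmx F k)^T.
Proof.
exists (selmx F k.+1 k.+1 (fun i => k - i)%N), (selmx F k k (fun i => k.-1 - i)%N)^T.
split.
- by apply: sel_iso => // *; lia.
- by apply/isomx_tr/sel_iso => // *; lia.
- apply/matrixP => i j.
  have hi : (k - i < k.+1)%N by lia.
  have hj : (k.-1 - j < k)%N by have := ltn_ord j; lia.
  rewrite sel_mul_tr // (entryE _ (Ordinal hi) (Ordinal hj)) !mxE /=; congr (nat_of_bool _)%:R.
  by have := ltn_ord i; have := ltn_ord j; lia.
- apply/matrixP => i j.
  have hi : (k - i < k.+1)%N by lia.
  have hj : (k.-1 - j < k)%N by have := ltn_ord j; lia.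
  rewrite sel_mul_tr // (entryE _ (Ordinal hi) (Ordinal hj)) !mxE /=; congr (nat_of_bool _)%:R.
  by have := ltn_ord i; have := ltn_ord j; lia.
Qed.

(** There are [k.+1] even and [k] odd indices, and with zero subdiagonal the off-diagonal blocks are
    [Fmx] transposed and [Gmx]. *)
Lemma is_KCF_odd (k : nat) :
  is_KCF (tridiagI (k.+1 + k) 0 : 'M[F]_(k.+1 + k))^h (tridiagI (k.+1 + k) 0) [:: KFG k; KFGT k].
Proof.
have h : cong bar (tridiagI (k.+1 + k) 0) (block_mx 0 (Fmx F k)^T (Gmx F k) 0).
  have := @tridiagI_cong F bar k k.+1 0; rewrite eqxx orbT => /(_ isT).
  congr (cong bar _ (block_mx 0 _ _ 0)); apply/matrixP => i j; rewrite !mxE /tridiag_entry.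
    by rewrite eqSS (inj_eq double_inj) eq_sym; case: eqP => //; rewrite if_same.
  by rewrite -doubleS (inj_eq double_inj); case: eqP => //; rewrite if_same.
apply: is_KCF_peq (cong_peq barK h) _; rewrite star_block_mx !star0 star_Gmx.
have -> : ((Fmx F k)^T)^h = Fmx F k by rewrite -star_Fmx starK.
apply: is_KCF_peq (peq_swap _ _ _ _) _.
apply: (@is_KCF_block _ _ _ _ _ _ _ _ [:: _] [:: _]); apply: is_KCF1 => //.
  exact: peq_refl.
exact: peq_GFT.
Qed.

End KroneckerForms.

(** * The cosquare of [Q_n] is a single Jordan block *)

Ltac nat_cases :=
  repeat (match goal with
  | |- context [@eq_op (Datatypes_nat__canonical__eqtype_Equality) ?a ?b] => case: (@eqP _ a b) => /= ?; try lia
  end).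

Section TypeII.

Variable F : closedFieldType.
Hypothesis two_neq0 : (2%:R : F) != 0.
Variable n : nat.
Hypothesis n_gt0 : (0 < n)%N.

(* The rows of Q are taken in the order n-1, n-3, ... and then back up through the
   other indices, the columns in the order n-2, n-4, ... and back; this makes [Q^T]
   lower triangular and [Q - r Q^T] zero except just below the diagonal. *)
Definition unfold_row (i : nat) : nat :=
  if (i.*2 < n)%N then (n.-1 - i.*2)%N else (i.*2 - n)%N.
Definition unfold_col (j : nat) : nat :=
  if (j.*2.+1 < n)%N then (n.-2 - j.*2)%N else (j.*2.+1 - n)%N.

Definition Qentry (i j : nat) : F :=
  if j == i.+1 then 1 else if i == j.+1 then (-1) ^+ j.+1 else if (i == 0%N) && (j == 0%N) then 1 else 0.

(** The eigenvalue of [Q *m invmx Q^T]. *)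
Let r : F := (-1) ^+ n.+1.

(** The rows and columns, joined by the nonzero entries, form a single path: down the band from
    index [n.-1] to 0, across the corner entry [(0, 0)], and back up. Rows and columns alternate on
    it, so each row meets only the column just before it and the one just after it. *)
Lemma Qentry_far i j : (i < n)%N -> (j < n)%N -> i != j -> i != j.+1 ->
  Qentry (unfold_row i) (unfold_col j) = 0 /\ Qentry (unfold_col j) (unfold_row i) = 0.
Proof.
rewrite /Qentry /unfold_row /unfold_col => hi hj h1 h2.
case: (ltnP i.*2 n) => h3; case: (ltnP j.*2.+1 n) => h4; split; nat_cases => //.
Qed.

Lemma signr_parity (a b : nat) : odd a = odd b -> (-1) ^+ a = (-1) ^+ b :> F.
Proof. by move=> h; rewrite -signr_odd h signr_odd. Qed.

(** The ratio of the entries at [(a, b)] and [(b, a)] is 1 at the corner and otherwise a sign given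
    by the parity of the smaller index. It alternates along the path, so it is [r] on the diagonal
    and [- r] just below it. *)
Lemma Qentry_diag i : (i < n)%N ->
  Qentry (unfold_row i) (unfold_col i) = r * Qentry (unfold_col i) (unfold_row i) /\
  Qentry (unfold_col i) (unfold_row i) != 0.
Proof.
rewrite /Qentry /unfold_row /unfold_col => hi.
case: (ltnP i.*2 n) => h3; case: (ltnP i.*2.+1 n) => h4; nat_cases.
- by rewrite mulr1 oner_eq0; split=> //; apply: signr_parity; lia.
- by rewrite mulr1 oner_eq0; split=> //; apply: (@signr_parity 0); lia.
- by rewrite -exprD signr_eq0; split=> //; apply: (@signr_parity 0); lia.
Qed.

Lemma Qentry_sub i : (i.+1 < n)%N ->
  Qentry (unfold_row i.+1) (unfold_col i) = - r * Qentry (unfold_col i) (unfold_row i.+1) /\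
  Qentry (unfold_col i) (unfold_row i.+1) != 0.
Proof.
have -> : - r = (-1) ^+ n.+2 by rewrite exprS mulN1r.
rewrite /Qentry /unfold_row /unfold_col => hi.
case: (ltnP i.+1.*2 n) => h3; case: (ltnP i.*2.+1 n) => h4; nat_cases.
- by rewrite -exprD signr_eq0; split=> //; apply: (@signr_parity 0); lia.
- by rewrite mulr1 oner_eq0; split=> //; apply: (@signr_parity 0); lia.
- by rewrite mulr1 oner_eq0; split=> //; apply: signr_parity; lia.
Qed.

Local Notation V := (selmx F n n unfold_row).
Local Notation W := (selmx F n n unfold_col).

Lemma unfold_row_lt i : (i < n)%N -> (unfold_row i < n)%N.
Proof. by rewrite /unfold_row; case: ifP; lia. Qed.

Lemma unfold_col_lt i : (i < n)%N -> (unfold_col i < n)%N.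
Proof. by rewrite /unfold_col; case: ifP; lia. Qed.

Lemma V_unit : V \in unitmx.
Proof.
rewrite -isomxE; apply: sel_iso => //; first exact: unfold_row_lt.
by move=> i j hi hj; rewrite /unfold_row; case: ifP; case: ifP; lia.
Qed.

Lemma W_unit : W \in unitmx.
Proof.
rewrite -isomxE; apply: sel_iso => //; first exact: unfold_col_lt.
by move=> i j hi hj; rewrite /unfold_col; case: ifP; case: ifP; lia.
Qed.

Lemma QmxE (i j : 'I_n) : Qmx F n i j = Qentry i j.
Proof. by rewrite mxE. Qed.

(** [E *m invmx L] is conjugate by [V] to [Q *m invmx Q^T - r]: [W] cancels, so rows and columns may
    be permuted independently. *)
Let E := V *m (Qmx F n - r *: (Qmx F n)^T) *m W^T.
Let L := V *m (Qmx F n)^T *m W^T.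

Lemma E_entry (i j : 'I_n) :
  E i j = Qentry (unfold_row i) (unfold_col j) - r * Qentry (unfold_col j) (unfold_row i).
Proof.
have hi := unfold_row_lt (ltn_ord i); have hj := unfold_col_lt (ltn_ord j).
rewrite sel_mul_tr // (entryE _ (Ordinal hi) (Ordinal hj)).
by rewrite mxE QmxE [X in _ + X]mxE [X in _ - X]mxE [X in _ - _ * X]mxE QmxE.
Qed.

Lemma L_entry (i j : 'I_n) : L i j = Qentry (unfold_col j) (unfold_row i).
Proof.
have hi := unfold_row_lt (ltn_ord i); have hj := unfold_col_lt (ltn_ord j).
by rewrite sel_mul_tr // (entryE _ (Ordinal hi) (Ordinal hj)) [LHS]mxE QmxE.
Qed.

Lemma L_unit : L \in unitmx.
Proof.
rewrite unitmxE det_trig.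
  rewrite unitfE; apply/prodf_neq0 => i _; rewrite L_entry.
  by have [_] := Qentry_diag (ltn_ord i).
apply/is_trig_mxP => i j lt_ij; rewrite L_entry.
have [||_ -> //] := Qentry_far (ltn_ord i) (ltn_ord j); first by rewrite ltn_eqF.
by rewrite ltn_eqF // ltnW.
Qed.

Lemma Qmx_tr_unit : (Qmx F n)^T \in unitmx.
Proof. by have := L_unit; rewrite /L !unitmx_mul => /andP [/andP []]. Qed.

Lemma rank_E : (n.-1 <= \rank E)%N.
Proof.
(* Entry 0 of [d] meets the zero row of the transposed shift; the value 1 keeps [diag_mx d]
   invertible. *)
pose d : 'rV[F]_n := \row_(i < n) if i == 0%N :> nat then 1 else E i (insubd i i.-1).
have EE : E = diag_mx d *m (jordan n 0)^T.
  apply/matrixP => i j; rewrite mul_diag_mx.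
  transitivity (d 0 i * (i == j.+1 :> nat)%:R); last first.
    by rewrite [RHS]mxE; congr (_ * _); rewrite [RHS]mxE shiftE.
  case: (eqVneq (i : nat) j.+1) => [e|h2].
    rewrite mulr1 [d 0 i]mxE e /=; congr (E i _).
    by apply: val_inj; rewrite val_insubd ltn_ord.
  rewrite mulr0 E_entry; case: (eqVneq (i : nat) j) => [->|h1].
    by have [-> _] := Qentry_diag (ltn_ord j); rewrite subrr.
  by have [-> ->] := Qentry_far (ltn_ord i) (ltn_ord j) h1 h2; rewrite mulr0 subrr.
have du : diag_mx d \in unitmx.
  rewrite unitmxE det_diag unitfE; apply/prodf_neq0 => i _; rewrite [d 0 i]mxE.
  case: (eqVneq (i : nat) 0%N) => [_|i0]; first exact: oner_neq0.
  have iE : i = i.-1.+1 :> nat by rewrite prednK // lt0n.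
  have hi : (i.-1 < n)%N by have := ltn_ord i; lia.
  rewrite E_entry val_insubd hi {1 2}iE.
  have hi1 : (i.-1.+1 < n)%N by rewrite -iE.
  have [-> q0] := Qentry_sub hi1.
  rewrite -iE in q0 *; rewrite mulNr -opprD oppr_eq0 -mulr2n -mulr_natl !mulf_eq0 !negb_or two_neq0 signr_eq0 /=.
  exact: q0.
rewrite EE -mxrank_tr trmx_mul trmxK mxrankMfree ?rank_shift //.
by rewrite row_free_unit unitmx_tr.
Qed.

(** For nonzero [t] the matrix [E - t L] is lower triangular with diagonal [- t L i i], so
    [E *m invmx L] has no nonzero eigenvalue. *)
Lemma nilp_EL : (E *m invmx L) ^+ n = 0.
Proof.
case: n n_gt0 E L E_entry L_entry L_unit Qentry_far Qentry_diag => // m _ E' L' hE hL Lu far dia.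
apply: nilpotent_of_units => t t0.
have -> : E' *m invmx L' - t%:M = (E' - t *: L') *m invmx L'.
  by rewrite mulmxBl -scalemxAl mulmxV // scalemx1.
rewrite unitmx_mul unitmx_inv Lu andbT unitmxE det_trig.
  rewrite unitfE; apply/prodf_neq0 => i _; rewrite mxE hE [X in _ + X]mxE [X in _ - X]mxE hL.
  by have [-> q0] := dia _ (ltn_ord i); rewrite subrr add0r oppr_eq0 mulf_neq0.
apply/is_trig_mxP => i j lt_ij; rewrite mxE hE [X in _ + X]mxE [X in _ - X]mxE hL.
have [||-> ->] := far _ _ (ltn_ord i) (ltn_ord j); rewrite ?mulr0 ?subrr ?subr0 //.
  by rewrite ltn_eqF.
by rewrite ltn_eqF // ltnW.
Qed.

Lemma unicell_Q (m : F) : m != 0 -> unicell (m *: (Qmx F n *m invmx (Qmx F n)^T)) (m * r).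
Proof.
move=> m0; have Qtu := Qmx_tr_unit; have Vu := V_unit; have Wu := W_unit.
have Wtu : W^T \in unitmx by rewrite unitmx_tr.
pose D := E *m invmx L.
have VD : V *m (Qmx F n *m invmx (Qmx F n)^T - r%:M) = D *m V.
  apply: (can_inj (mulmxK Qtu)); apply: (can_inj (mulmxK Wtu)).
  rewrite -!(mulmxA D) -/L mulmxKV ?L_unit //.
  rewrite -(mulmxA V) mulmxBl mulmxKV // mul_scalar_mx.
  by [].
have h : unicell (D + r%:M) r.
  split; rewrite addrK; first exact: nilp_EL.
  have rD : (n.-1 <= \rank D)%N by rewrite mxrankMfree ?rank_E // row_free_unit unitmx_inv L_unit.
  have := rank_expmx n.-1 rD.
  by apply: contraTneq => ->; rewrite mxrank0; lia.
have {}h : unicell (m *: (D + r%:M)) (m * r).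
  case: h; rewrite addrK => h1 h2.
  apply: (@unicell_mul F n _ D 1%:M _ m); rewrite ?unitmx1 ?mulmx1 ?mul1mx //.
  by rewrite scalerDr -scalemx1 scalerA -[in X in _ - X]scalemx1 addrK.
apply: (unicell_conj (X := invmx V)) h; first by rewrite unitmx_inv.
apply: (can_inj (mulKmx Vu)); rewrite mulKVmx // mulmxA -scalemxAr -scalemxAl.
congr (_ *: _); rewrite -[X in V *m X](subrK r%:M) mulmxDr VD mulmxDl mulmxK //.
by rewrite mul_mx_scalar -scalemxAl mulmxV // scalemx1.
Qed.

End TypeII.

(** * Kronecker forms of canonical sums *)

Section Blocks.

Variables (F : closedFieldType) (bar : {rmorphism F -> F}).
Hypotheses (barK : involutive bar) (bar_nonid : exists a : F, bar a != a).
Variables (im : F) (im_sqr : im ^+ 2 = -1).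

Local Notation "A ^h" := (star bar A) (at level 2, format "A ^h").

(** The eigenvalue of the cosquare of [m *: Qmx F n]; it equals [(-1) ^+ n.+1 * m ^+ 2] when [m] has
    modulus one. *)
Definition rho (n : nat) (m : F) : F := (-1) ^+ n.+1 * (bar m)^-1 * m.

Lemma star_Qmx n m : (m *: Qmx F n)^h = bar m *: (Qmx F n)^T.
Proof.
rewrite starZ; congr (_ *: _); apply/matrixP => i j; rewrite starE !mxE.
by do ![case: ifP => _]; rewrite ?rmorph1 ?rmorph0 // rmorphXn rmorphN1.
Qed.

Lemma TypeII_unit n m : m != 0 -> m *: Qmx F n.+1 \in unitmx.
Proof.
move=> m0; rewrite unitmxZ ?unitfE // -unitmx_tr Qmx_tr_unit //.
exact: (char_neq2 barK bar_nonid).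
Qed.

Lemma TypeII_unicell n m : m != 0 ->
  unicell ((m *: Qmx F n.+1) *m invmx (m *: Qmx F n.+1)^h) (rho n.+1 m).
Proof.
move=> m0; have b0 : bar m != 0 by rewrite fmorph_eq0.
have two0 := char_neq2 barK bar_nonid.
have Qtu := Qmx_tr_unit two0 (ltn0Sn n).
have -> : (m *: Qmx F n.+1) *m invmx (m *: Qmx F n.+1)^h
    = (m / bar m) *: (Qmx F n.+1 *m invmx (Qmx F n.+1)^T).
  have hu : (m *: Qmx F n.+1)^h \in unitmx by rewrite star_unit TypeII_unit.
  apply: (can_inj (mulmxK hu)); rewrite mulmxKV // star_Qmx -scalemxAr -scalemxAl mulmxKV //.
  by rewrite scalerA mulrC divfK.
have -> : rho n.+1 m = m / bar m * (-1) ^+ n.+2 by rewrite /rho; ring.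
by apply: unicell_Q; rewrite // mulf_neq0 ?invr_eq0.
Qed.

Lemma TypeII_jordan n m : m != 0 ->
  exists2 X : 'M[F]_n.+1, X \in unitmx &
    X *m (m *: Qmx F n.+1) = jordan n.+1 (rho n.+1 m) *m X *m (m *: Qmx F n.+1)^h.
Proof.
move=> m0; have [X Xu XT] := unicell_similar (TypeII_unicell n m0); exists X => //.
by rewrite -XT mulmxA mulmxKV // star_unit TypeII_unit.
Qed.

Lemma cvalidII n m : cvalid bar im (TypeII n m) -> [/\ (0 < n)%N, m * bar m = 1 & m != 0].
Proof.
move=> [n0 /(modulus1P barK bar_nonid im_sqr) e]; split=> //.
by apply: contra_eq_neq e => ->; rewrite mul0r eq_sym oner_neq0.
Qed.

Lemma cvalidI n l : cvalid bar im (TypeI n l) ->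
  [/\ (0 < n)%N, l * bar l != 1 & odd n -> l = 0].
Proof. by move=> [n0 /(modulus_neq1P barK bar_nonid im_sqr) e h]. Qed.

Lemma is_KCF_cmx (t : csummand F) : cvalid bar im t ->
  is_KCF (cmx t)^h (cmx t) (KCF_of_csummand bar t).
Proof.
case: t => [n l /cvalidI [n0 hl ho]|n m /cvalidII [n0 e m0]] /=.
  case: ifP => [odd_n|even_n].
    rewrite ho //; have e : n = (n./2.+1 + n./2)%N by lia.
    by move: (n./2) e => k ->; exact: is_KCF_odd.
  have : n = (n./2 + n./2)%N by lia.
  case: (n./2) => [|k] e; first by lia.
  rewrite e; apply: is_KCF_peq (cong_peq barK (tridiagI_even barK k hl)) _.
  exact: is_KCF_hyper.
case: n n0 => // n _; apply: is_KCF1 => //.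
by apply: peq_KIJ (TypeII_unicell n m0); rewrite star_unit TypeII_unit.
Qed.

Definition kcf (s : seq (csummand F)) : seq (ksummand F) :=
  flatten (map (KCF_of_csummand bar) s).

Lemma is_KCF_csum (s : seq (csummand F)) : (forall t, t \in s -> cvalid bar im t) ->
  is_KCF (dsum (@cmx F) s)^h (dsum (@cmx F) s) (kcf s).
Proof.
elim: s => [_|t s IH hs] /=; first by split=> //; rewrite star0; apply/pair_equivalentP/peq_refl.
rewrite star_block_mx !star0; apply: is_KCF_block.
  by apply: is_KCF_cmx; apply: hs; exact: mem_head.
by apply: IH => u hu; apply: hs; rewrite inE hu orbT.
Qed.

Lemma is_KCF_canonical (n : nat) (A : 'M[F]_n) (s : seq (csummand F)) :
  canonical_sum_of bar im A s -> is_KCF A^h A (kcf s).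
Proof.
move=> [hs /(star_congruentP barK) h].
exact: is_KCF_peq (cong_peq barK h) (is_KCF_csum hs).
Qed.

End Blocks.

(** * Uniqueness of the Kronecker form *)

Section Pairing.

Variable F : fieldType.

(** Morphisms of matrix pairs, acting on columns: [S] on the source spaces and [R] on the target
    spaces. *)
Definition phom m n m' n' (A B : 'M[F]_(m, n)) (A' B' : 'M_(m', n'))
  (R : 'M_(m', m)) (S : 'M_(n', n)) : Prop := R *m A = A' *m S /\ R *m B = B' *m S.

Lemma sum_delta n (g : 'I_n -> F) (i : nat) :
  \sum_(l < n) (i == l :> nat)%:R * g l = if insub i is Some l then g l else 0.
Proof.
case: insubP => [l hl <-|hi].
  rewrite (bigD1 l) //= eqxx mul1r big1 ?addr0 // => k; rewrite -val_eqE /= eq_sym => /negPf ->.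
  by rewrite mul0r.
rewrite big1 // => l _; case: eqP => [e|_]; last by rewrite mul0r.
by move: hi; rewrite e ltn_ord.
Qed.

Lemma mul_F p m (X : 'M[F]_(p, m)) i j : (X *m Fmx F m) i j = entry X i j.
Proof.
rewrite mxE (eq_bigr (fun l : 'I_m => ((j : nat) == l)%:R * X i l)); last first.
  by move=> l _; rewrite mxE mulrC.
by rewrite sum_delta /entry valK.
Qed.

Lemma mul_G p m (X : 'M[F]_(p, m)) i (j : 'I_m.+1) :
  (X *m Gmx F m) i j = if nat_of_ord j is j'.+1 then entry X i j' else 0.
Proof.
rewrite mxE; case: j => [[|j] hj] /=; first by rewrite big1 // => l _; rewrite mxE mulr0.
rewrite (eq_bigr (fun l : 'I_m => (j == l)%:R * X i l)); last first.
  by move=> l _; rewrite mxE mulrC /= eqSS.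
by rewrite sum_delta /entry valK.
Qed.

Lemma mul_FT p k (R : 'M[F]_(p, k.+1)) i (j : 'I_k) : (R *m (Fmx F k)^T) i j = entry R i j.
Proof.
rewrite mxE (eq_bigr (fun l : 'I_k.+1 => ((j : nat) == l)%:R * R i l)); last first.
  by move=> l _; rewrite !mxE mulrC eq_sym.
by rewrite sum_delta /entry valK.
Qed.

Lemma mul_GT p k (R : 'M[F]_(p, k.+1)) i (j : 'I_k) : (R *m (Gmx F k)^T) i j = entry R i j.+1.
Proof.
rewrite mxE (eq_bigr (fun l : 'I_k.+1 => (j.+1 == l)%:R * R i l)); last first.
  by move=> l _; rewrite !mxE mulrC eq_sym.
by rewrite sum_delta /entry valK.
Qed.

Lemma entry_tr n m (C : 'M[F]_(n, m)) i j : entry C^T i j = entry C j i.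
Proof. by rewrite /entry; case: insub => [a|]; case: insub => [b|] //; rewrite mxE. Qed.

Lemma FT_mul p k (S : 'M[F]_(k, p)) (i : 'I_k.+1) j : ((Fmx F k)^T *m S) i j = entry S i j.
Proof. by rewrite -[in LHS](trmxK S) -trmx_mul mxE mul_F entry_tr. Qed.

Lemma GT_mul p k (S : 'M[F]_(k, p)) (i : 'I_k.+1) j :
  ((Gmx F k)^T *m S) i j = if nat_of_ord i is i'.+1 then entry S i' j else 0.
Proof. by rewrite -[in LHS](trmxK S) -trmx_mul mxE mul_G; case: (nat_of_ord i) => // i'; rewrite entry_tr. Qed.

Lemma entry_eq0 n m (C : 'M[F]_(n, m)) : (forall i j, entry C i j = 0) -> C = 0.
Proof. by move=> h; apply/matrixP => i j; rewrite -entryE h mxE. Qed.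

(** The equation says that column [j] of [X] is [T] times column [j.+1], and there is no column [m];
    so the columns vanish from the last to the first. *)
Lemma FG_inj k m (X : 'M[F]_(k, m)) (T : 'M_k) : X *m Gmx F m = T *m (X *m Fmx F m) -> X = 0.
Proof.
move=> h; have step (i : 'I_k) (j : 'I_m) : (forall l : 'I_k, entry X l j.+1 = 0) -> X i j = 0.
  move=> hl; have := congr1 (fun M : 'M_(k, m.+1) => M i (lift ord0 j)) h.
  rewrite mul_G /= entryE => ->; rewrite mxE big1 // => l _.
  by rewrite mul_F hl mulr0.
suff z d (i : 'I_k) j : (m <= j + d)%N -> entry X i j = 0.
  by apply/matrixP => i j; rewrite -entryE mxE; apply: (z m); lia.
elim: d j i => [|d IH] j i hj; first by apply: entry_col; lia.
have [lt_jm|ge_jm] := ltnP j m; last exact: entry_col.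
by rewrite (entryE X i (Ordinal lt_jm)); apply: step => l; apply: IH => /=; lia.
Qed.

(** Now column [j.+1] is [T] times column [j], and column 0 is zero. *)
Lemma GF_inj k m (X : 'M[F]_(k, m)) (T : 'M_k) : X *m Fmx F m = T *m (X *m Gmx F m) -> X = 0.
Proof.
move=> h; suff z j (i : 'I_k) : entry X i j = 0.
  by apply/matrixP => i j; rewrite -entryE mxE.
elim: j i => [|j IH] i.
  have := congr1 (fun M : 'M_(k, m.+1) => M i ord0) h.
  by rewrite mul_F /= => ->; rewrite mxE big1 // => l _; rewrite mul_G mulr0.
have [lt_jm|ge_jm] := ltnP j.+1 m.+1; last by apply: entry_col; lia.
have := congr1 (fun M : 'M_(k, m.+1) => M i (Ordinal lt_jm)) h.
by rewrite mul_F /= => ->; rewrite mxE big1 // => l _; rewrite mul_G /= IH mulr0.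
Qed.

(* The multiplicity of [X] in [Y] is read off the pairing
   [Hom(Y, X) x Hom(X, Y) -> End(X) -> F] given by the corner entry of the composite. *)
Definition local_pairing r c (A0 B0 : 'M[F]_(r.+1, c)) (e : pred (ksummand F)) : Prop :=
  forall t : ksummand F, kvalid t ->
  exists (u : 'M[F]_(r.+1, krows t) -> F) (v : 'M[F]_(krows t, r.+1) -> F),
  forall R S R' S', phom A0 B0 (kfst t) (ksnd t) R S -> phom (kfst t) (ksnd t) A0 B0 R' S' ->
  (R' *m R) 0 0 = if e t then u R' * v R else 0.

Lemma mul00 r m (R' : 'M[F]_(r.+1, m)) (R : 'M_(m, r.+1)) :
  (forall j, entry R j.+1 0 = 0) -> (R' *m R) 0 0 = entry R' 0 0 * entry R 0 0.
Proof.
move=> h; rewrite mxE; case: m R' R h => [|m] R' R h; first by rewrite big_ord0 (entry_row _ _ (leqnn 0)) mulr0.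
rewrite big_ord_recl big1 ?addr0; last first.
  by move=> i _; have := h i; rewrite (entryE R (lift ord0 i) 0) => ->; rewrite mulr0.
by rewrite (entryE R' 0 0) (entryE R 0 0).
Qed.

(** Against a pair with another eigenvalue, or of any other kind, one of the two spaces of morphisms
    is zero. For the same eigenvalue the morphisms are upper triangular intertwiners of shifts, so
    the corner entry is multiplicative; between blocks of different sizes one of the two corner
    entries vanishes. *)
Lemma KIJ_local n l : local_pairing (kfst (KIJ n.+1 l)) (ksnd (KIJ n.+1 l)) (pred1 (KIJ n.+1 l)).
Proof.
case=> [m l'|m|m|m] /= tv.
- exists (fun R' => entry R' 0 0), (fun R => entry R 0 0) => R S R' S' [].
  rewrite mulmx1 mul1mx => <- RB []; rewrite mulmx1 mul1mx => <- RB'.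
  have [el|nel] := eqVneq l' l; last first.
    rewrite (_ : (_ == _) = false); last by apply/eqP => -[_ e]; rewrite e eqxx in nel.
    suff -> : R = 0 by rewrite mulmx0 mxE.
    have Tu : jordan m (l' - l) \in unitmx by rewrite jordan_unit // subr_eq0.
    have RN1 : R *m jordan n.+1 0 = jordan m (l' - l) *m R.
      apply: (addrI (l *: R)); rewrite -[in LHS]mul_mx_scalar -mulmxDr -jordanE RB.
      by rewrite (jordanE m l') [jordan m (l' - l)]jordanE -mul_scalar_mx -mulmxDl addrA -raddfD /= [l + _]addrC subrK.
    have RN k : R *m jordan n.+1 0 ^+ k = jordan m (l' - l) ^+ k *m R.
      elim: k => [|k IH]; first by rewrite !expr0 mulmx1 mul1mx.
      by rewrite exprSr [in RHS]exprSr -!mulmxE mulmxA IH -!mulmxA RN1.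
    have [Nn _] := @unicell_jordan F n 0; rewrite rmorph0 subr0 in Nn.
    have Tk k : jordan m (l' - l) ^+ k \in unitmx.
      elim: k => [|k IH]; first by rewrite expr0 unitmx1.
      by rewrite exprS -mulmxE unitmx_mul Tu.
    by have := RN n.+1; rewrite Nn mulmx0 => e; rewrite -[R](mulKmx (Tk n.+1)) -e mulmx0.
  rewrite {l'}el in RB RB' *.
  have sR : jordan m 0 *m R = R *m jordan n.+1 0.
    apply: (addrI (l *: R)); rewrite -{1}mul_scalar_mx -mulmxDl -jordanE -RB.
    by rewrite jordanE mulmxDr mul_mx_scalar.
  have sR' : jordan n.+1 0 *m R' = R' *m jordan m 0.
    apply: (addrI (l *: R')); rewrite -{1}mul_scalar_mx -mulmxDl -jordanE -RB'.
    by rewrite jordanE mulmxDr mul_mx_scalar.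
  rewrite mul00; last by move=> j; exact: intertwiner_col0 sR _.
  have [em|nem] := eqVneq m n.+1.
    by rewrite (introT eqP (_ : KIJ m l = KIJ n.+1 l)) // em.
  rewrite (_ : (_ == _) = false); last by apply/eqP => -[e]; rewrite e eqxx in nem.
  move: nem; rewrite neq_ltn => /orP [lt_mn|lt_nm].
    by rewrite [entry R 0 0](intertwiner_row0 sR) ?mulr0 //= subn0.
  by rewrite (intertwiner_row0 sR') ?mul0r //; lia.
- exists (fun=> 0), (fun=> 0) => R S R' S' [RA RB] _; rewrite /= ?if_same.
  suff -> : R = 0 by rewrite mulmx0 mxE.
  rewrite mulmx1 in RA; rewrite mul1mx in RB.
  have RNJ : R = jordan m 0 *m R *m jordan n.+1 l by rewrite -mulmxA RB.
  have RN k : R = jordan m 0 ^+ k *m R *m jordan n.+1 l ^+ k.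
    elim: k => [|k IH]; first by rewrite !expr0 mulmx1 mul1mx.
    by rewrite {1}IH {1}RNJ exprSr exprS -!mulmxE !mulmxA.
  have Nm : (jordan m 0 : 'M[F]_m) ^+ m = 0.
    by case: (m) tv => // a _; have [+ _] := @unicell_jordan F a 0; rewrite rmorph0 subr0.
  by rewrite (RN m) Nm !mul0mx.
- exists (fun=> 0), (fun=> 0) => R S R' S' _ [RA RB]; rewrite /= ?if_same.
  suff -> : R' = 0 by rewrite mul0mx mxE.
  by apply: (FG_inj (T := jordan n.+1 l)); rewrite RB RA mul1mx.
- exists (fun=> 0), (fun=> 0) => R S R' S' [RA RB] _; rewrite /= ?if_same.
  rewrite mulmx1 in RA; suff S0 : S = 0 by rewrite RA S0 mulmx0 mulmx0 mxE.
  apply: trmx_inj; rewrite trmx0; apply: (FG_inj (T := (jordan n.+1 l)^T)).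
  by apply: trmx_inj; rewrite !trmx_mul !trmxK -RA -RB.
Qed.

(** [R] and [S] share entries and are constant along diagonals. If [m < k], the main diagonal of [R]
    continues into row [m] of [S], which lies outside [S]. *)
Lemma KFGT_hom k m R S :
  phom (Fmx F k)^T (Gmx F k)^T (Fmx F m)^T (Gmx F m)^T R S ->
  (forall j, entry R 0 j.+1 = 0) /\ ((m < k)%N -> entry R 0 0 = 0).
Proof.
move=> [RA RB].
have a i j : (i < m.+1)%N -> (j < k)%N -> entry R i j = entry S i j.
  move=> hi hj; have := congr1 (fun M : 'M_(m.+1, k) => M (Ordinal hi) (Ordinal hj)) RA.
  by rewrite mul_FT FT_mul.
have b i j : (i < m.+1)%N -> (j < k)%N -> entry R i j.+1 = if i is i'.+1 then entry S i' j else 0.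
  move=> hi hj; have := congr1 (fun M : 'M_(m.+1, k) => M (Ordinal hi) (Ordinal hj)) RB.
  by rewrite mul_GT GT_mul.
split=> [j|lt_mk].
  by have [lt_jk|ge_jk] := ltnP j k; [rewrite b | rewrite entry_col].
have d i : (i <= m)%N -> entry R i i = entry R 0 0.
  elim: i => // i IH hi; rewrite b //; last by lia.
  by rewrite -a; [apply: IH | |]; lia.
by rewrite -(d m) // a // entry_row.
Qed.

Lemma KFGT_local k : local_pairing (kfst (KFGT k)) (ksnd (KFGT k)) (pred1 (KFGT k)).
Proof.
case=> [m l|m|m|m] /= tv.
- exists (fun=> 0), (fun=> 0) => R S R' S' _ [RA RB]; rewrite /= ?if_same.
  rewrite mulmx1 in RA; suff S0 : S' = 0 by rewrite RA S0 mulmx0 mul0mx mxE.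
  apply: trmx_inj; rewrite trmx0; apply: (FG_inj (T := (jordan m l)^T)).
  by apply: trmx_inj; rewrite !trmx_mul !trmxK -RA -RB.
- exists (fun=> 0), (fun=> 0) => R S R' S' _ [RA RB]; rewrite /= ?if_same.
  rewrite mulmx1 in RB; suff S0 : S' = 0 by rewrite RB S0 mulmx0 mul0mx mxE.
  apply: trmx_inj; rewrite trmx0; apply: (GF_inj (T := (jordan m 0)^T)).
  by apply: trmx_inj; rewrite !trmx_mul !trmxK -RA -RB.
- exists (fun=> 0), (fun=> 0) => R S R' S' _ [RA RB]; rewrite /= ?if_same.
  suff -> : R' = 0 by rewrite mul0mx mxE.
  have a i j : (i < k.+1)%N -> (j < m.+1)%N -> entry R' i j = entry S' i j.
    move=> hi hj; have := congr1 (fun M : 'M_(k.+1, m.+1) => M (Ordinal hi) (Ordinal hj)) RA.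
    by rewrite mul_F FT_mul.
  have b i j : (i < k.+1)%N -> (j < m)%N ->
      entry R' i j = if i is i'.+1 then entry S' i' j.+1 else 0.
    move=> hi hj; have := congr1 (fun M : 'M_(k.+1, m.+1) => M (Ordinal hi) (lift ord0 (Ordinal hj))) RB.
    by rewrite mul_G GT_mul.
  apply: entry_eq0; elim=> [|i IH] j.
    by have [lt_jm|ge_jm] := ltnP j m; [rewrite b | rewrite entry_col].
  have [lt_jm|ge_jm] := ltnP j m; last by rewrite entry_col.
  have [lt_ik|ge_ik] := ltnP i.+1 k.+1; last by rewrite entry_row.
  by rewrite b // -a // ltnW.
- exists (fun R' => entry R' 0 0), (fun R => entry R 0 0) => R S R' S' hR hR'.
  have [_ R0] := KFGT_hom hR; have [R'j R'0] := KFGT_hom hR'.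
  have -> : (R' *m R) 0 0 = entry R' 0 0 * entry R 0 0.
    (* [mul00] needs a first column that vanishes off the corner; here it is the first row of [R']
       that does. *)
    rewrite -[R' *m R]trmxK trmx_mul mxE mul00; last by move=> j; rewrite entry_tr.
    by rewrite !entry_tr mulrC.
  have [em|nem] := eqVneq m k.
    by rewrite (introT eqP (_ : KFGT m = KFGT k)) // em.
  rewrite (_ : (_ == _) = false); last by apply/eqP => -[e]; rewrite e eqxx in nem.
  move: nem; rewrite neq_ltn => /orP [lt_mk|lt_km].
    by rewrite R0 // mulr0.
  by rewrite R'0 // mul0r.
Qed.

End Pairing.

(** * Multiplicities as ranks of pairings *)

Section Multiplicity.

Variables (F : fieldType) (r c : nat) (A0 B0 : 'M[F]_(r.+1, c)) (t0 : ksummand F).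
Hypothesis loc : local_pairing A0 B0 (pred1 t0).

Local Notation ksum1 := (dsum (@kfst F)).
Local Notation ksum2 := (dsum (@ksnd F)).

Definition pairing_mx p m (R' : 'I_p -> 'M[F]_(r.+1, m)) (R : 'I_p -> 'M_(m, r.+1)) : 'M_p :=
  \matrix_(a, b) (R' a *m R b) 0 0.

(** The pairing is a sum over the summands of [K]: a copy of [t0] contributes a column times a row,
    hence rank at most one, and any other summand contributes 0. *)
Lemma pairing_rank (K : seq (ksummand F)) (p : nat) (R : 'I_p -> 'M_(_, _)) S R' S' :
  all (@kvalid F) K ->
  (forall b, phom A0 B0 (ksum1 K) (ksum2 K) (R b) (S b)) ->
  (forall a, phom (ksum1 K) (ksum2 K) A0 B0 (R' a) (S' a)) ->
  (\rank (pairing_mx R' R) <= count_mem t0 K)%N.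
Proof.
elim: K R S R' S' => [|t K IH] R S R' S' /=.
  move=> _ _ _; rewrite (_ : pairing_mx _ _ = 0) ?mxrank0 //.
  by apply/matrixP => a b; rewrite !mxE big_ord0.
move=> /andP [tv Kv] hR hR'.
have hR1 b : phom A0 B0 (kfst t) (ksnd t) (usubmx (R b)) (usubmx (S b)).
  have [] := hR b; rewrite -{1 2}[R b]vsubmxK -{1 2}[S b]vsubmxK.
  by rewrite !mul_block_col !mul_col_mx !zsimp => /eq_col_mx [e1 _] /eq_col_mx [e2 _].
have hR2 b : phom A0 B0 (ksum1 K) (ksum2 K) (dsubmx (R b)) (dsubmx (S b)).
  have [] := hR b; rewrite -{1 2}[R b]vsubmxK -{1 2}[S b]vsubmxK.
  by rewrite !mul_block_col !mul_col_mx !zsimp => /eq_col_mx [_ e1] /eq_col_mx [_ e2].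
have hR1' a : phom (kfst t) (ksnd t) A0 B0 (lsubmx (R' a)) (lsubmx (S' a)).
  have [] := hR' a; rewrite -{1 2}[R' a]hsubmxK -{1 2}[S' a]hsubmxK.
  by rewrite !mul_row_block !mul_mx_row !zsimp => /eq_row_mx [e1 _] /eq_row_mx [e2 _].
have hR2' a : phom (ksum1 K) (ksum2 K) A0 B0 (rsubmx (R' a)) (rsubmx (S' a)).
  have [] := hR' a; rewrite -{1 2}[R' a]hsubmxK -{1 2}[S' a]hsubmxK.
  by rewrite !mul_row_block !mul_mx_row !zsimp => /eq_row_mx [_ e1] /eq_row_mx [_ e2].
have [u [v uv]] := loc tv.
have -> : pairing_mx R' R
  = (if t == t0 then 1 else 0) *: ((\col_a u (lsubmx (R' a))) *m (\row_b v (usubmx (R b))))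
    + pairing_mx (fun a => rsubmx (R' a)) (fun b => dsubmx (R b)).
  apply/matrixP => a b; rewrite mxE -{1}[R' a]hsubmxK -{1}[R b]vsubmxK mul_row_col mxE.
  rewrite (uv _ _ _ _ (hR1 b) (hR1' a)) [RHS]mxE [X in _ = _ + X]mxE; congr (_ + _).
  rewrite mxE mxE big_ord1 !mxE /=.
  by case: ifP; rewrite ?mul1r ?mul0r.
apply: leq_trans (mxrank_add _ _) _; apply: leq_add (IH _ _ _ _ Kv hR2 hR2').
case: ifP => _; last by rewrite scale0r mxrank0.
by rewrite scale1r; apply: leq_trans (mxrankM_maxl _ _) (rank_leq_col _).
Qed.

(** A certificate that the multiplicity is at least [p]: the pairing matrix of the two families is
    the identity. *)
Definition dual_families p m n (A B : 'M[F]_(m, n)) : Prop :=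
  exists (R : 'I_p -> 'M_(m, r.+1)) (S : 'I_p -> 'M_(n, c))
    (R' : 'I_p -> 'M_(r.+1, m)) (S' : 'I_p -> 'M_(c, n)),
  [/\ forall b, phom A0 B0 A B (R b) (S b), forall a, phom A B A0 B0 (R' a) (S' a)
    & forall a b, (R' a *m R b) 0 0 = (a == b)%:R].

Lemma dual_families_peq p m n m' n' (A B : 'M[F]_(m, n)) (A' B' : 'M_(m', n')) :
  peq A B A' B' -> dual_families p A B -> dual_families p A' B'.
Proof.
move=> [U [V [/isomxP [U' [_ UU' U'U]] /isomxP [V' [_ VV' V'V]] <- <-]]].
move=> [R [S [R' [S' [hR hR' h1]]]]].
exists (fun b => U *m R b), (fun b => V' *m S b), (fun a => R' a *m U'), (fun a => S' a *m V).
split=> [b|a|a b].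
- by have [h2 h3] := hR b; split; rewrite -!mulmxA (mulmxA V) VV' mul1mx ?h2 ?h3.
- by have [h2 h3] := hR' a; split; rewrite !mulmxA -(mulmxA _ U') U'U mulmx1 ?h2 ?h3.
- by rewrite mulmxA -(mulmxA _ U') U'U mulmx1.
Qed.

Lemma dual_families0 m n (A B : 'M[F]_(m, n)) : dual_families 0 A B.
Proof. by exists (fun=> 0), (fun=> 0), (fun=> 0), (fun=> 0); split; case. Qed.

Lemma dual_families_block p q m n m' n' (A B : 'M[F]_(m, n)) (A' B' : 'M_(m', n')) :
  dual_families p A B -> dual_families q A' B' ->
  dual_families (p + q) (block_mx A 0 0 A') (block_mx B 0 0 B').
Proof.
move=> [R [S [R' [S' [hR hR' h1]]]]] [T [U [T' [U' [hT hT' h2]]]]].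
exists (fun i => match split i with inl a => col_mx (R a) 0 | inr b => col_mx 0 (T b) end).
exists (fun i => match split i with inl a => col_mx (S a) 0 | inr b => col_mx 0 (U b) end).
exists (fun i => match split i with inl a => row_mx (R' a) 0 | inr b => row_mx 0 (T' b) end).
exists (fun i => match split i with inl a => row_mx (S' a) 0 | inr b => row_mx 0 (U' b) end).
split=> [i|i|i j].
- case: (split i) => a; split; rewrite mul_block_col mul_col_mx !zsimp.
  + by have [-> _] := hR a.
  + by have [_ ->] := hR a.
  + by have [-> _] := hT a.
  + by have [_ ->] := hT a.
- case: (split i) => a; split; rewrite mul_row_block mul_mx_row !zsimp.
  + by have [-> _] := hR' a.
  + by have [_ ->] := hR' a.
  + by have [-> _] := hT' a.
  + by have [_ ->] := hT' a.
have sl (a : 'I_p) : split (lshift q a) = inl a := unsplitK (inl a).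
have sr (a : 'I_q) : split (rshift p a) = inr a := unsplitK (inr a).
case: (split_ordP i) => a ->; case: (split_ordP j) => b ->; rewrite ?sl ?sr mul_row_col !zsimp.
- by rewrite h1 eq_lshift.
- by rewrite mxE eq_lrshift.
- by rewrite mxE eq_rlshift.
- by rewrite h2 eq_rshift.
Qed.

Hypothesis self_dual : dual_families 1 (kfst t0) (ksnd t0).

Lemma dual_families_count (K : seq (ksummand F)) :
  dual_families (count_mem t0 K) (ksum1 K) (ksum2 K).
Proof.
elim: K => [|t K IH] /=; first exact: dual_families0.
apply: dual_families_block IH; case: eqP => [->|_] //; exact: dual_families0.
Qed.

Lemma KCF_count_le m n (A B : 'M[F]_(m, n)) K K' :
  is_KCF A B K -> is_KCF A B K' -> (count_mem t0 K <= count_mem t0 K')%N.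
Proof.
move=> [Kv /pair_equivalentP hK] [K'v /pair_equivalentP hK'].
have := dual_families_count K; move/(dual_families_peq (peq_sym hK))/(dual_families_peq hK').
move=> [R [S [R' [S' [hR hR' h1]]]]]; apply: leq_trans (pairing_rank K'v hR hR').
rewrite (_ : pairing_mx R' R = 1%:M) ?mxrank1 //.
by apply/matrixP => a b; rewrite !mxE -h1 mxE.
Qed.

(** A nonzero value, rescaled to 1, would be a dual family of length one and force an occurrence of
    [t0]. *)
Lemma KCF_pairing0 m n (A B : 'M[F]_(m, n)) K R S R' S' :
  is_KCF A B K -> t0 \notin K -> phom A0 B0 A B R S -> phom A B A0 B0 R' S' ->
  (R' *m R) 0 0 = 0.
Proof.
move=> [Kv /pair_equivalentP hK] t0K hR hR'.
set x := LHS; apply: contraNeq t0K => x0.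
have : dual_families 1 A B.
  exists (fun=> x^-1 *: R), (fun=> x^-1 *: S), (fun=> R'), (fun=> S'); split=> // [b|a b].
    by have [h1 h2] := hR; split; rewrite -scalemxAl -scalemxAr ?h1 ?h2.
  by rewrite -scalemxAr mxE mulVf // !ord1.
move/(dual_families_peq hK) => [R1 [S1 [R1' [S1' [hR1 hR1' h1]]]]].
have := pairing_rank Kv hR1 hR1'.
rewrite (_ : pairing_mx R1' R1 = 1%:M); last by apply/matrixP => a b; rewrite !mxE -h1 mxE.
by rewrite mxrank1 -has_count has_pred1.
Qed.

End Multiplicity.

Lemma dual_families_self (F : fieldType) r c (A B : 'M[F]_(r.+1, c)) : dual_families A B 1 A B.
Proof.
exists (fun=> 1%:M), (fun=> 1%:M), (fun=> 1%:M), (fun=> 1%:M); split=> [b|a|a b].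
- by split; rewrite mulmx1 mul1mx.
- by split; rewrite mulmx1 mul1mx.
- by rewrite mulmx1 mxE !ord1.
Qed.

Lemma KCF_count_KIJ (F : fieldType) k l m n (A B : 'M[F]_(m, n)) K K' :
  is_KCF A B K -> is_KCF A B K' -> count_mem (KIJ k.+1 l) K = count_mem (KIJ k.+1 l) K'.
Proof.
move=> h h'; apply/eqP; rewrite eqn_leq.
apply/andP; split; apply: (KCF_count_le (@KIJ_local F k l)); try exact: dual_families_self.
- exact: h.
- exact: h'.
- exact: h'.
- exact: h.
Qed.

Lemma KCF_count_KFGT (F : fieldType) k m n (A B : 'M[F]_(m, n)) K K' :
  is_KCF A B K -> is_KCF A B K' -> count_mem (KFGT k) K = count_mem (KFGT k) K'.
Proof.
move=> h h'; apply/eqP; rewrite eqn_leq.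
apply/andP; split; apply: (KCF_count_le (@KFGT_local F k)); try exact: dual_families_self.
- exact: h.
- exact: h'.
- exact: h'.
- exact: h.
Qed.

(** * The signs of the summands of type (ii) *)

Section Inertia.

Variables (F : closedFieldType) (bar : {rmorphism F -> F}).
Hypotheses (barK : involutive bar) (bar_nonid : exists a : F, bar a != a).
Variables (im : F) (im_sqr : im ^+ 2 = -1).

Local Notation "A ^h" := (star bar A) (at level 2, format "A ^h").

Lemma commutant_mul00 n (X Y : 'M[F]_n.+1) :
  jordan n.+1 0 *m Y = Y *m jordan n.+1 0 -> (X *m Y) 0 0 = X 0 0 * Y 0 0.
Proof.
move=> hY; rewrite mul00 => [|j]; last exact: intertwiner_col0 hY _.
by rewrite (entryE X 0 0) (entryE Y 0 0).
Qed.

Lemma commute_shift n l (X : 'M[F]_n) :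
  jordan n l *m X = X *m jordan n l -> jordan n 0 *m X = X *m jordan n 0.
Proof. by rewrite jordanE mulmxDl mulmxDr mul_scalar_mx mul_mx_scalar => /addrI. Qed.

Lemma trace_commutant n (X : 'M[F]_n.+1) :
  jordan n.+1 0 *m X = X *m jordan n.+1 0 -> \tr X = X 0 0 * n.+1%:R.
Proof.
move=> hX; rewrite /mxtrace (eq_bigr (fun=> X 0 0)).
  by rewrite sumr_const card_ord mulr_natr.
by move=> i _; exact: commutant_diag.
Qed.

Lemma commutant_unit00 n (X : 'M[F]_n.+1) :
  jordan n.+1 0 *m X = X *m jordan n.+1 0 -> X \in unitmx -> X 0 0 != 0.
Proof.
move=> hX Xu; apply/eqP => e; have := commutant_nilp hX; rewrite e rmorph0 subr0 => h.
have : X ^+ n.+1 \is a GRing.unit by rewrite unitrX.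
by rewrite h unitr0.
Qed.

Variables (n : nat) (m : F).
Hypothesis m_norm : m * bar m = 1.

Let r : F := rho bar n.+1 m.
Let J : 'M[F]_n.+1 := jordan n.+1 r.

Lemma m_neq0 : m != 0.
Proof. by apply: contra_eq_neq m_norm => ->; rewrite mul0r eq_sym oner_neq0. Qed.

Lemma rhoE n' m' : m' * bar m' = 1 -> rho bar n' m' = (-1) ^+ n'.+1 * m' ^+ 2.
Proof.
move=> h; have m0 : m' != 0 by apply: contra_eq_neq h => ->; rewrite mul0r eq_sym oner_neq0.
by rewrite /rho (_ : bar m' = m'^-1) ?invrK ?expr2 ?mulrA //; apply: (mulfI m0); rewrite h mulfV.
Qed.

Lemma rho_norm n' m' : m' * bar m' = 1 -> rho bar n' m' * bar (rho bar n' m') = 1.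
Proof.
move=> h; rewrite rhoE // rmorphM !rmorphXn rmorphN1 mulrACA -!exprMn h expr1n mulr1.
by rewrite mulrNN mulr1 expr1n.
Qed.

Lemma r_neq0 : r != 0.
Proof. by rewrite /r; apply: contra_eq_neq (rho_norm n.+1 m_norm) => ->; rewrite mul0r eq_sym oner_neq0. Qed.

Lemma J_unit : J \in unitmx. Proof. exact: jordan_unit r_neq0. Qed.

(** As [r] has modulus one, [invmx J^h] has the single eigenvalue [r] too. *)
Lemma JhV_jordan : exists2 Q : 'M[F]_n.+1, Q \in unitmx & Q *m invmx J^h = J *m Q.
Proof.
have Jhu : J^h \in unitmx by rewrite star_unit J_unit.
apply: unicell_similar.
have -> : r = (bar r)^-1.
  by apply: (mulIf (_ : bar r != 0)); rewrite ?fmorph_eq0 ?r_neq0 // (rho_norm _ m_norm) mulVf // fmorph_eq0 r_neq0.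
apply: unicell_inv => //; first by rewrite fmorph_eq0 r_neq0.
exact/unicell_tr/unicell_map/unicell_jordan.
Qed.

Section Chains.

Variable Q : 'M[F]_n.+1.
Hypotheses (Qu : Q \in unitmx) (QJ : Q *m invmx J^h = J *m Q).

(** For nonsingular [A] the rows of [S] satisfy the Jordan chain relations for [A *m invmx A^h]; in
    this form the condition also covers singular summands. It makes [S] part of a morphism from
    [(A^h, A)] to [(1, J)]. *)
Definition chain N (A : 'M[F]_N) (S : 'M_(n.+1, N)) : Prop := S *m A = J *m S *m A^h.

(* [S *m A^h *m T^h *m invmx Q] lies in the centralizer of [J], where taking the
   corner entry is multiplicative. *)
Definition cform N (A : 'M[F]_N) (S T : 'M_(n.+1, N)) : F := (S *m A^h *m T^h *m invmx Q) 0 0.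

Lemma QVJ : invmx J^h *m invmx Q = invmx Q *m J.
Proof. by rewrite -[LHS](mulKmx Qu) (mulmxA Q) QJ mulmxK. Qed.

Lemma chain_left N (A : 'M[F]_N) S : chain A S -> phom A^h A 1%:M J S (S *m A^h).
Proof. by move=> h; split; rewrite ?mul1mx // h mulmxA. Qed.

(** The conjugate transpose of a chain is a morphism out of [(1, invmx J^h)], and [Q] turns that
    pair back into [(1, J)]. Thus [cform] is an instance of the corner pairing. *)
Lemma chain_right N (A : 'M[F]_N) S : chain A S ->
  phom 1%:M J A^h A (A^h *m S^h *m invmx Q) (S^h *m invmx Q).
Proof.
move=> h; split; first by rewrite mulmx1 mulmxA.
have Jhu : J^h \in unitmx by rewrite star_unit J_unit.
have e : A *m S^h = A^h *m S^h *m invmx J^h.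
  by apply: (can_inj (mulmxK Jhu)); rewrite mulmxKV // -starM h !starM (starK barK) mulmxA.
by rewrite -mulmxA -QVJ !mulmxA e.
Qed.

Lemma cform_pairing N (A : 'M[F]_N) S T :
  cform A S T = (S *m (A^h *m T^h *m invmx Q)) 0 0.
Proof. by rewrite /cform !mulmxA. Qed.

Lemma cform0 N (A : 'M[F]_N) K S T :
  is_KCF A^h A K -> KIJ n.+1 r \notin K -> chain A S -> chain A T -> cform A S T = 0.
Proof.
move=> hK hn /chain_left hS /chain_right hT; rewrite cform_pairing.
exact: (KCF_pairing0 (@KIJ_local F n r) hK hn hT hS).
Qed.

Lemma cform_block N1 N2 (A1 : 'M[F]_N1) (A2 : 'M_N2) S T :
  cform (block_mx A1 0 0 A2) S T
    = cform A1 (lsubmx S) (lsubmx T) + cform A2 (rsubmx S) (rsubmx T).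
Proof.
rewrite /cform -{1}[S]hsubmxK -{1}[T]hsubmxK star_block_mx !star0 star_row_mx mul_row_block !zsimp.
by rewrite mul_row_col mulmxDl mxE.
Qed.

Lemma chain_block N1 N2 (A1 : 'M[F]_N1) (A2 : 'M_N2) S :
  chain (block_mx A1 0 0 A2) S <-> chain A1 (lsubmx S) /\ chain A2 (rsubmx S).
Proof.
rewrite /chain -{1 2}[S]hsubmxK star_block_mx !star0 mul_mx_row !mul_row_block !zsimp.
by split=> [/eq_row_mx//|[-> ->]].
Qed.

Lemma chainZ N (A : 'M[F]_N) e S : bar e = e -> e != 0 -> chain (e *: A) S <-> chain A S.
Proof.
move=> be e0; rewrite /chain starZ be -!scalemxAr; split=> [|->//].
by move/(congr1 ( *:%R e^-1)); rewrite !scalerA mulVf // !scale1r.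
Qed.

Let B0 : 'M[F]_n.+1 := m *: Qmx F n.+1.

Section Model.

Variable S0 : 'M[F]_n.+1.
Hypotheses (S0u : S0 \in unitmx) (S0B : chain B0 S0).

Let h : F := cform B0 S0 S0.
(** Every chain of the model is [C *m S0] with [C] in the centralizer of [J]; this is the residue of
    [C]. *)
Let coord (S : 'M[F]_n.+1) : F := (S *m invmx S0) 0 0.

Lemma B0_unit : B0 \in unitmx.
Proof. by apply: (TypeII_unit barK bar_nonid); exact: m_neq0. Qed.

Lemma coord_comm S : chain B0 S ->
  jordan n.+1 0 *m (S *m invmx S0) = (S *m invmx S0) *m jordan n.+1 0.
Proof.
move=> hS; apply: (@commute_shift _ r); rewrite -/J.
have Bhu : B0^h \in unitmx by rewrite star_unit B0_unit.
apply: (can_inj (mulmxK S0u)); apply: (can_inj (mulmxK Bhu)).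
rewrite -(mulmxA J) mulmxKV // -hS -!(mulmxA (S *m _)).
by rewrite -S0B mulmxA mulmxKV.
Qed.

Lemma phom_comm (R R' : 'M[F]_n.+1) S S' (A B : 'M_n.+1) :
  phom 1%:M J A B R S -> phom A B 1%:M J R' S' -> J *m (R' *m R) = (R' *m R) *m J.
Proof.
move=> [h1 h2] [h3 h4]; rewrite -[RHS]mulmxA h2 [RHS]mulmxA h4 -[RHS]mulmxA; congr (_ *m _).
by rewrite mulmx1 in h1; rewrite mul1mx in h3; rewrite h1 mulmxA h3.
Qed.

Lemma h_comm : jordan n.+1 0 *m (S0 *m B0^h *m S0^h *m invmx Q)
  = (S0 *m B0^h *m S0^h *m invmx Q) *m jordan n.+1 0.
Proof.
apply: (@commute_shift _ r); have := phom_comm (chain_right S0B) (chain_left S0B).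
by rewrite !mulmxA.
Qed.

Lemma h_neq0 : h != 0.
Proof.
apply: (commutant_unit00 h_comm).
by rewrite !unitmx_mul unitmx_inv S0u Qu !star_unit S0u B0_unit.
Qed.

(** Sending [D] to [Q *m D^h *m invmx Q] maps the centralizer of [J] to itself and conjugates corner
    entries, as the traces show: diagonals are constant and the characteristic is zero. So the form
    has rank one on the model. *)
Lemma cform_model S T : chain B0 S -> chain B0 T -> cform B0 S T = h * (coord S * bar (coord T)).
Proof.
move=> hS hT; set C := S *m invmx S0; set D := T *m invmx S0.
have cC : _ := coord_comm hS; have cD : _ := coord_comm hT.
pose D' := Q *m D^h *m invmx Q.
have JD : J *m D = D *m J.
  by rewrite /J jordanE mulmxDl mulmxDr mul_scalar_mx mul_mx_scalar cD.
have Jhu : J^h \in unitmx by rewrite star_unit J_unit.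
have DJ : D^h *m invmx J^h = invmx J^h *m D^h.
  apply: (can_inj (mulmxK Jhu)); apply: (can_inj (mulKmx Jhu)).
  by rewrite mulmxKV // -(mulmxA _ D^h) mulKVmx // -!starM JD.
have D'J : J *m D' = D' *m J.
  by rewrite /D' !mulmxA -QJ -(mulmxA Q) -DJ mulmxA -!mulmxA QVJ.
have D'00 : D' 0 0 = bar (D 0 0).
  apply: (mulIf (natr_neq0 barK bar_nonid im_sqr (ltn0Sn n))).
  rewrite -(trace_commutant (commute_shift D'J)) /D' mxtrace_mulC mulKmx //.
  rewrite -(rmorph_nat bar) -rmorphM /= -(trace_commutant cD) /mxtrace rmorph_sum.
  by apply: eq_bigr => i _; rewrite starE.
have -> : cform B0 S T = (C *m (S0 *m B0^h *m S0^h *m invmx Q) *m D') 0 0.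
  rewrite /cform /D' -[in LHS](mulmxKV S0u S) -[in LHS](mulmxKV S0u T) starM -/C -/D.
  by rewrite !mulmxA (mulmxKV Qu).
rewrite commutant_mul00; last exact: commute_shift D'J.
rewrite commutant_mul00; last exact: h_comm.
by rewrite D'00 mulrAC mulrC.
Qed.

Lemma cformN N (A : 'M[F]_N) S T : cform (- A) S T = - cform A S T.
Proof. by rewrite /cform starN mulmxN !mulNmx mxE. Qed.

Lemma KCF_notin t : cvalid bar im t -> t != TypeII n.+1 m -> t != TypeII n.+1 (- m) ->
  KIJ n.+1 r \notin KCF_of_csummand bar t.
Proof.
have rr : r * bar r = 1 := rho_norm _ m_norm.
case: t => [n' l /(cvalidI barK bar_nonid im_sqr) [_ hl _] _ _|n' m'] /=.
  case: ifP => _; rewrite !inE ?orbF //=; apply/norP; split; apply/eqP.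
    rewrite /kJnuI; case: ifP => // /negbT l0 [_ e].
    move: rr; rewrite e fmorphV barK -invfM => /(congr1 GRing.inv).
    by rewrite invrK invr1 mulrC => e1; move: hl; rewrite e1 eqxx.
  by case=> _ e; move: hl; rewrite -e rr eqxx.
move=> /(cvalidII barK bar_nonid im_sqr) [_ hm' _] h1 h2.
rewrite inE; apply/eqP => -[en]; rewrite -/(rho bar n' m') -en /r !rhoE // => /(mulfI).
rewrite signr_eq0 => /(_ isT) /eqP; rewrite eqf_sqr => /orP [] /eqP em.
  by move: h1; rewrite em -en eqxx.
by move: h2; rewrite em opprK -en eqxx.
Qed.

(** Each copy of [TypeII n.+1 m] adds a term [k *m k^h] to the first product, each copy of
    [TypeII n.+1 (- m)] one to the second, and the form vanishes on every other summand. *)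
Lemma gram_csum (s : seq (csummand F)) (p : nat) (S : 'I_p -> 'M_(_, _)) :
  (forall t, t \in s -> cvalid bar im t) -> (forall a, chain (dsum (@cmx F) s) (S a)) ->
  exists (q : nat) (U : 'M[F]_(p, count_mem (TypeII n.+1 m) s)) (V : 'M_(p, q)),
  forall a b, cform (dsum (@cmx F) s) (S a) (S b) = h * ((U *m U^h) a b - (V *m V^h) a b).
Proof.
elim: s S => [|t s IH] S hs hS.
  exists 0%N, 0, 0 => a b; rewrite !mul0mx mxE subrr mulr0 /cform.
  by rewrite /= star0 mulmx0 !mul0mx mxE.
have hS1 a : chain (cmx t) (lsubmx (S a)) by have /chain_block [] := hS a.
have hS2 a : chain (dsum (@cmx F) s) (rsubmx (S a)) by have /chain_block [] := hS a.
have [|q [U [V hUV]]] := IH _ _ hS2; first by move=> u hu; apply: hs; rewrite inE hu orbT.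
have tv : cvalid bar im t by apply: hs; exact: mem_head.
have k_sq (k : 'cV[F]_p) a b : (k *m k^h) a b = k a 0 * bar (k b 0).
  by rewrite mxE big_ord1 starE.
rewrite /=; case: (eqVneq t (TypeII n.+1 m)) hS1 => [et|nt1] hS1 /=.
  move: S hS hS1 hS2 hUV tv; rewrite et => S hS hS1 hS2 hUV tv.
  exists q, (row_mx (\col_a coord (lsubmx (S a))) U), V => a b.
  rewrite cform_block hUV cform_model // star_row_mx mul_row_col.
  rewrite [X in _ = _ * (X - _)]mxE k_sq 2![(\col__ _) _ _]mxE.
  by rewrite -mulrDr addrA.
rewrite add0n; case: (eqVneq t (TypeII n.+1 (- m))) hS1 => [et|nt2] hS1.
  move: S hS hS1 hS2 hUV tv; rewrite et => S hS hS1 hS2 hUV tv.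
  exists (1 + q)%N, U, (row_mx (\col_a coord (lsubmx (S a))) V) => a b.
  have hc c : chain B0 (lsubmx (S c)).
    have hb : bar (-1) = -1 by rewrite rmorphN1.
    have hn : -1 != 0 :> F by rewrite oppr_eq0 oner_neq0.
    by have := hS1 c; rewrite /= scaleNr -scaleN1r => /(@chainZ _ _ _ _ hb hn).
  rewrite cform_block hUV /= scaleNr cformN cform_model // star_row_mx mul_row_col.
  rewrite [X in _ = _ * (_ - X)]mxE k_sq 2![(\col__ _) _ _]mxE.
  by rewrite -mulrN -mulrDr; congr (_ * _); rewrite opprD addrCA.
exists q, U, V => a b; rewrite cform_block hUV (cform0 _ (KCF_notin tv nt1 nt2)) ?add0r //.
exact: (is_KCF_cmx barK bar_nonid im_sqr tv).
Qed.

(** An orthonormal family for the form divided by [h]; this gives the sign of the form a meaning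
    although [h] need not be real. *)
Definition pos_family p N (A : 'M[F]_N) : Prop :=
  exists S : 'I_p -> 'M_(n.+1, N), (forall a, chain A (S a)) /\
    forall a b, cform A (S a) (S b) = h * (a == b)%:R.

Lemma pos_family_cong p N N' (A : 'M[F]_N) (A' : 'M_N') :
  cong bar A A' -> pos_family p A -> pos_family p A'.
Proof.
move=> [U /isomxP [U' [_ UU' U'U]] <-] [S [hS hS2]].
exists (fun a => S a *m U'); split=> [a|a b].
  rewrite /chain !starM (starK barK) !mulmxA -(mulmxA _ U') U'U mulmx1 hS.
  by rewrite -(mulmxA _ U') U'U mulmx1.
rewrite -hS2 /cform !starM (starK barK) !mulmxA -(mulmxA _ U') U'U mulmx1.
by rewrite -(mulmxA _ U^h) -starM U'U star1 mulmx1.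
Qed.

Lemma cform_0l N (A : 'M[F]_N) T : cform A 0 T = 0.
Proof. by rewrite /cform !mul0mx mxE. Qed.

Lemma cform_0r N (A : 'M[F]_N) S : cform A S 0 = 0.
Proof. by rewrite /cform star0 mulmx0 mul0mx mxE. Qed.

Lemma pos_family_csum (s : seq (csummand F)) :
  pos_family (count_mem (TypeII n.+1 m) s) (dsum (@cmx F) s).
Proof.
elim: s => [|t s [S [hS hS2]]]; first by exists (fun=> 0); split; case.
rewrite /=; case: eqP => [->|_]; last first.
  rewrite add0n; exists (fun a => row_mx 0 (S a)); split=> [a|a b].
    by apply/chain_block; rewrite row_mxKl row_mxKr; split=> //; rewrite /chain mulmx0 !mul0mx.
  by rewrite cform_block !row_mxKl !row_mxKr hS2 cform_0l add0r.
rewrite -[nat_of_bool true]/1%N.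
exists (fun i => match split i with inl _ => row_mx S0 0 | inr a => row_mx 0 (S a) end).
have sl q (a : 'I_1) : split (lshift q a) = inl a := unsplitK (inl a).
have sr q (a : 'I_q) : split (rshift 1 a) = inr a := unsplitK (inr a).
split=> [i|i j].
  case: (split_ordP i) => a _; apply/chain_block; rewrite row_mxKl row_mxKr.
    by split; rewrite /chain // mulmx0 !mul0mx.
  by split=> //; rewrite /chain mulmx0 !mul0mx.
case: (split_ordP i) => a ->; case: (split_ordP j) => b ->;
  rewrite ?sl ?sr cform_block !row_mxKl !row_mxKr ?hS2 ?cform_0l ?cform_0r ?(add0r, addr0).
- by rewrite !ord1 eqxx mulr1.
- by rewrite eq_lrshift mulr0.
- by rewrite eq_rlshift mulr0.
- by rewrite eq_rshift.
Qed.

(** Here [U *m U^h = 1 + V *m V^h]. If [U] had fewer than [p] columns, some nonzero [x] would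
    satisfy [x *m U = 0], and a sum of norms including [x *m x^h] would vanish. *)
Lemma pos_family_le (s : seq (csummand F)) p :
  (forall t, t \in s -> cvalid bar im t) -> pos_family p (dsum (@cmx F) s) ->
  (p <= count_mem (TypeII n.+1 m) s)%N.
Proof.
move=> hs [S [hS hS2]]; have [q [U [V hUV]]] := gram_csum hs hS.
have UV : U *m U^h = 1%:M + V *m V^h.
  apply/matrixP => a b; have := hUV a b; rewrite hS2 => /(mulfI h_neq0) e.
  transitivity ((a == b)%:R + (V *m V^h) a b); first by rewrite e subrK.
  by rewrite [RHS]mxE; congr (_ + _); rewrite mxE.
rewrite leqNgt; apply/negP => lt_cp.
have : kermx U != 0.
  by rewrite kermx_eq0 -row_leq_rank -ltnNge; apply: leq_ltn_trans (rank_leq_col _) lt_cp.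
case/rowV0Pn => x /sub_kermxP xU; apply/negP; rewrite negbK.
have nn k (y : 'rV[F]_k) : (y *m y^h) 0 0 = \sum_i y 0 i * bar (y 0 i).
  by rewrite mxE; apply: eq_bigr => i _; rewrite starE.
have pos k (y : 'rV[F]_k) : nneg bar ((y *m y^h) 0 0).
  by rewrite nn; apply: (nneg_sum barK bar_nonid im_sqr) => i _; exact: nneg_norm.
have : (x *m x^h) 0 0 + ((x *m V) *m (x *m V)^h) 0 0 = 0.
  transitivity ((x *m (U *m U^h) *m x^h) 0 0).
    by rewrite UV mulmxDr mulmx1 mulmxDl [RHS]mxE starM !mulmxA.
  by rewrite mulmxA xU !mul0mx mxE.
move/(nneg_add_eq0 barK bar_nonid im_sqr (pos _ x) (pos _ _)); rewrite nn => x0.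
apply/eqP/rowP => i; rewrite mxE; apply/eqP; rewrite -(norm_eq0 bar); apply/eqP.
move: x0; rewrite (bigD1 i) //=; apply: (nneg_add_eq0 barK bar_nonid im_sqr); first exact: nneg_norm.
by apply: (nneg_sum barK bar_nonid im_sqr) => j _; exact: nneg_norm.
Qed.

End Model.

End Chains.

Lemma TypeII_count_le (s s' : seq (csummand F)) :
  (forall t, t \in s' -> cvalid bar im t) -> cong bar (dsum (@cmx F) s) (dsum (@cmx F) s') ->
  (count_mem (TypeII n.+1 m) s <= count_mem (TypeII n.+1 m) s')%N.
Proof.
move=> hs' h; have [Q Qu QJ] := JhV_jordan.
have [S0 S0u S0B] := TypeII_jordan barK bar_nonid n m_neq0.
apply: (pos_family_le Qu QJ S0u S0B hs'); apply: pos_family_cong h _.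
exact: pos_family_csum.
Qed.

End Inertia.

(** * Counting summands and permuting them *)

(** Equivalent elements are removed in pairs; equal class sizes guarantee a partner for each element
    of [s'] and leave none over. *)
Lemma perm_upto_count (T : eqType) (e : rel T) (s s' : seq T) :
  equivalence_rel e ->
  (forall t, (t \in s) || (t \in s') -> count (e t) s = count (e t) s') ->
  perm_upto e s s'.
Proof.
move=> eqv; have er x : e x x by have [] := eqv x x x.
have el x y z : e x y -> e x z = e y z by have [_] := eqv x y z.
have es x y : e x y -> e y x by move=> h; rewrite -(el _ _ _ h) er.
have ex u x y : e x y -> e u x = e u y.
  by move=> h; apply/idP/idP => /es hu; apply: es; [rewrite -(el _ _ _ h) | rewrite (el _ _ _ h)].
elim: s' s => [|t' s' IH] s h.
  case: s h => [|t s] h; first by exists [::].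
  by have := h t; rewrite mem_head /= er => /(_ isT).
have : has (e t') s by rewrite has_count h ?mem_head ?orbT //= er.
case/hasP => t ts et; have ps := perm_to_rem ts.
have [|u pu au] := IH (rem t s).
  move=> x hx; have := h x; rewrite (seq.permP ps) (perm_mem ps) /= (ex x t' t) //.
  rewrite !inE orbCA; case: (x \in rem t s) hx => /= hx; last by rewrite orbC in hx *; rewrite /= hx !orbT => /(_ isT) /addnI.
  by rewrite !orbT /= => /(_ isT) /addnI.
exists (t :: u); last by rewrite /= au (es _ _ et).
by rewrite (perm_trans ps) // perm_cons.
Qed.

Section Uniqueness.

Variables (F : closedFieldType) (bar : {rmorphism F -> F}).
Hypotheses (barK : involutive bar) (bar_nonid : exists a : F, bar a != a).
Variables (im : F) (im_sqr : im ^+ 2 = -1).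

Local Notation "A ^h" := (star bar A) (at level 2, format "A ^h").

Lemma inv_equivalence :
  equivalence_rel (fun l l' : F => (l' == l) || (l != 0) && (l' == (bar l)^-1)).
Proof.
move=> x y z; split; first by rewrite eqxx.
have inv u : (bar (bar u)^-1)^-1 = u by rewrite fmorphV barK invrK.
move=> /orP [/eqP ->//|/andP [x0 /eqP ->]].
rewrite invr_eq0 fmorph_eq0 x0 /= inv.
by rewrite orbC.
Qed.

Lemma same_upto_inv_sign_equiv : equivalence_rel (same_upto_inv_sign bar).
Proof.
have two0 := char_neq2 barK bar_nonid.
move=> [n x|n x] [n' y|n' y] [n'' z|n'' z] //=; split=> //; rewrite ?eqxx //=.
- by move=> /andP [/eqP <- /(inv_equivalence x y z).2 ->].
- by move=> /andP [/eqP <- /orP [] /eqP ->]; rewrite // opprK orbC.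
Qed.

Lemma same_upto_inv_equiv : equivalence_rel (same_upto_inv bar).
Proof.
move=> [n x|n x] [n' y|n' y] [n'' z|n'' z] //=; split=> //; rewrite ?eqxx //=.
- by move=> /andP [/eqP <- /(inv_equivalence x y z).2 ->].
- by move=> /andP [/eqP <- /eqP ->].
Qed.

(** A Kronecker summand that occurs exactly once for the valid summands in the class of [t] up to
    inverse and sign, and for no other valid one; its multiplicity counts that class. *)
Definition kcf_witness (t : csummand F) : ksummand F :=
  match t with
  | TypeI n l => if odd n then KFGT n./2 else KIJ n./2 l
  | TypeII n m => KIJ n (rho bar n m)
  end.

Lemma rho_eq n m m' : m * bar m = 1 -> m' * bar m' = 1 ->
  (rho bar n m' == rho bar n m) = (m' == m) || (m' == - m).
Proof.
by move=> h h'; rewrite !rhoE // (inj_eq (mulfI _)) ?signr_eq0 // eqf_sqr.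
Qed.

Lemma KIJ_eq a b (x y : F) : (KIJ a x == KIJ b y) = (a == b) && (x == y).
Proof. by apply/eqP/andP => [[-> ->]|[/eqP -> /eqP ->]]. Qed.

Lemma inv_eqC (l l' : F) :
  (l != 0) && (l' == (bar l)^-1) = (l' != 0) && ((bar l')^-1 == l).
Proof.
have inv u : (bar (bar u)^-1)^-1 = u by rewrite fmorphV barK invrK.
apply/andP/andP => -[x0 /eqP e]; first by rewrite e invr_eq0 fmorph_eq0 inv.
by rewrite -e invr_eq0 fmorph_eq0 inv.
Qed.

Lemma kcf_witness_count (t0 t : csummand F) : cvalid bar im t0 -> cvalid bar im t ->
  count_mem (kcf_witness t0) (KCF_of_csummand bar t) = same_upto_inv_sign bar t0 t.
Proof.
case: t0 => [n l /(cvalidI barK bar_nonid im_sqr) [n0 hl hn]|n m /(cvalidII barK bar_nonid im_sqr) [n0 hm m0]];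
case: t => [n' l' /(cvalidI barK bar_nonid im_sqr) [n0' hl' hn']|n' m' /(cvalidII barK bar_nonid im_sqr) [n0' hm' m0']] /=.
- case: ifP => on; case: ifP => on' /=.
  + rewrite hn // hn' // eqxx andbT addn0 add0n; congr nat_of_bool; apply/eqP/eqP => [[]|->//]; lia.
  + rewrite /kJnuI; case: ifP => _ /=; rewrite (_ : (n == n') = false) //; apply/eqP; lia.
  + by rewrite (_ : (n == n') = false) //; apply/eqP; lia.
  + have -> : (n == n') = (n./2 == n'./2) by apply/eqP/eqP; lia.
    rewrite addn0 KIJ_eq (eq_sym n'./2) inv_eqC /kJnuI fmorph_eq0.
    case: (eqVneq l' 0) => [l0|l0] /=; first by rewrite orbF.
    rewrite KIJ_eq (eq_sym n'./2); case: (_ == _) => //=.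
    (* Both equalities together would give [l'] modulus one, so the count is never two. *)
    case: (eqVneq (bar l')^-1 l) => [e|_]; case: (eqVneq l' l) => [e'|_] //.
    by move: hl'; rewrite -{1}e' in e; rewrite -{1}e mulVf ?eqxx // fmorph_eq0.
- case: ifP => //= _; rewrite addn0 KIJ_eq; case: eqP => //= _.
  case: eqP => // e; by move: hl; rewrite -e (rho_norm n' hm') eqxx.
- case: ifP => //= _; rewrite /kJnuI !addn0 KIJ_eq.
  rewrite (_ : (l' == _) = false) ?andbF ?addn0; last first.
    by apply/eqP => e; move: hl'; rewrite e (rho_norm n hm) eqxx.
  case: ifP => //= l0; rewrite KIJ_eq; case: eqP => //= _; case: eqP => // e.
  have := rho_norm n hm; rewrite -e fmorphV barK -invfM => /(congr1 GRing.inv).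
  by rewrite invrK invr1 mulrC => e1; move: hl'; rewrite e1 eqxx.
- by rewrite addn0 KIJ_eq -/(rho bar n' m') (eq_sym n'); case: eqP => //= <-; rewrite rho_eq.
Qed.

Lemma kcf_count (t0 : csummand F) (s : seq (csummand F)) :
  cvalid bar im t0 -> (forall t, t \in s -> cvalid bar im t) ->
  count_mem (kcf_witness t0) (kcf bar s) = count (same_upto_inv_sign bar t0) s.
Proof.
move=> h0; elim: s => //= t s IH hs; rewrite /kcf /= count_cat -/(kcf bar s) IH.
  by rewrite kcf_witness_count //; apply: hs; exact: mem_head.
by move=> u hu; apply: hs; rewrite inE hu orbT.
Qed.

Lemma KCF_determines (m n : nat) (A B : 'M[F]_(m, n)) (s s' : seq (csummand F)) :
  (forall t, t \in s -> cvalid bar im t) -> (forall t, t \in s' -> cvalid bar im t) ->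
  is_KCF A B (kcf bar s) -> is_KCF A B (kcf bar s') ->
  forall t, cvalid bar im t ->
  count (same_upto_inv_sign bar t) s = count (same_upto_inv_sign bar t) s'.
Proof.
move=> hs hs' h h' t ht; rewrite -!kcf_count //.
case: t ht => [n' l /(cvalidI barK bar_nonid im_sqr) [n0 _ _]|n' m' /(cvalidII barK bar_nonid im_sqr) [n0 _ _]] /=.
  case: ifP => on; first exact: KCF_count_KFGT h h'.
  case e : (n'./2) => [|k]; first by lia.
  exact: KCF_count_KIJ h h'.
by case: n' n0 => // k _; exact: KCF_count_KIJ h h'.
Qed.

Lemma KCF_of_csummand_sign (t t' : csummand F) :
  same_upto_inv_sign bar t t' -> perm_eq (KCF_of_csummand bar t) (KCF_of_csummand bar t').
Proof.
case: t t' => [n l|n m] [n' l'|n' m'] //= /andP [/eqP <-].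
  case: ifP => // _ /orP [/eqP ->//|/andP [l0 /eqP ->]].
  have b0 : bar l != 0 by rewrite fmorph_eq0.
  rewrite /kJnuI fmorphV barK invr_eq0 (negPf l0) (negPf b0) invrK.
  by rewrite (perm_catC [:: _] [:: _]).
by move=> /orP [] /eqP -> //; rewrite rmorphN invrN !mulrN mulNr opprK.
Qed.

Lemma kcf_perm (s s' : seq (csummand F)) :
  perm_upto (same_upto_inv_sign bar) s s' -> perm_eq (kcf bar s) (kcf bar s').
Proof.
move=> [u su us']; apply: (@perm_trans _ (kcf bar u)).
  by rewrite /kcf perm_flatten // perm_map.
elim: u s' us' {su} => [|t u IH] [|t' s'] //= /andP [h hu].
by rewrite /kcf /= perm_cat ?KCF_of_csummand_sign // -!/(kcf bar _) IH.
Qed.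

Lemma kronecker_determines (n n' : nat) (A : 'M[F]_n) (A' : 'M[F]_n') (s s' : seq (csummand F)) :
  canonical_sum_of bar im A s -> canonical_sum_of bar im A' s' ->
  ((exists2 K : seq (ksummand F), is_KCF A^h A K & is_KCF A'^h A' K) <->
   perm_upto (same_upto_inv_sign bar) s s').
Proof.
move=> hA hA'; have kA := is_KCF_canonical barK bar_nonid im_sqr hA.
have kA' := is_KCF_canonical barK bar_nonid im_sqr hA'.
split=> [[K [Kv /pair_equivalentP h] [_ /pair_equivalentP h']]|hp].
  have kA2 : is_KCF A^h A (kcf bar s') := is_KCF_peq (peq_trans h (peq_sym h')) kA'.
  apply: perm_upto_count; first exact: same_upto_inv_sign_equiv.
  move=> t ht; apply: (KCF_determines hA.1 hA'.1 kA kA2).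
  by case/orP: ht; [exact: hA.1 | exact: hA'.1].
exists (kcf bar s) => //.
by apply: is_KCF_perm kA'; rewrite perm_sym kcf_perm.
Qed.

Lemma cong_inv (t t' : csummand F) : cvalid bar im t -> cvalid bar im t' ->
  same_upto_inv bar t t' -> cong bar (cmx t) (cmx t').
Proof.
case: t t' => [n l|n m] [n' l'|n' m'] //= hv hv' /andP [/eqP <-]; last first.
  by move=> /eqP ->; exact: cong_refl.
move=> /orP [/eqP ->|/andP [l0 /eqP el]]; first exact: cong_refl.
have [n0 hl ho] := cvalidI barK bar_nonid im_sqr hv.
have [_ hl' _] := cvalidI barK bar_nonid im_sqr hv'.
have even_n : ~~ odd n by apply: contraNN l0 => /ho ->.
have : n = (n./2 + n./2)%N by lia.
case: (n./2) => [|k] e; first by lia.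
rewrite e; apply: cong_trans (tridiagI_even barK k hl) _.
apply: cong_trans (hyper_swap barK k l0) _; rewrite -el.
exact: cong_sym (tridiagI_even barK k hl').
Qed.

Lemma canonical_unique (n : nat) (A : 'M[F]_n) (s s' : seq (csummand F)) :
  canonical_sum_of bar im A s -> (forall t, t \in s' -> cvalid bar im t) ->
  (canonical_sum_of bar im A s' <-> perm_upto (same_upto_inv bar) s s').
Proof.
move=> hA hs'; have [hs /(star_congruentP barK) cA] := hA.
split=> [hA'|[u su us']].
  have [_ /(star_congruentP barK) cA'] := hA'.
  have cs := cong_trans (cong_sym cA) cA'.
  apply: perm_upto_count; first exact: same_upto_inv_equiv.
  move=> t ht; have tv : cvalid bar im t by case/orP: ht; [exact: hs | exact: hs'].
  (* On type (i) the relations with and without sign coincide, so the Kronecker form decides; type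
     (ii) needs inertia. *)
  case: t tv {ht} => [k l|k m] tv.
    exact: KCF_determines hs hs' (is_KCF_canonical barK bar_nonid im_sqr hA)
      (is_KCF_canonical barK bar_nonid im_sqr hA') _ tv.
  have [k0 hm _] := cvalidII barK bar_nonid im_sqr tv.
  have e : same_upto_inv bar (TypeII k m) =1 pred1 (TypeII k m).
    move=> [n' l|n' m'] //=; apply/andP/eqP => [[/eqP -> /eqP ->] //|[-> ->]].
    by rewrite !eqxx.
  rewrite !(eq_count e); case: k k0 {tv e} => // k _; apply/eqP; rewrite eqn_leq.
  rewrite (TypeII_count_le barK bar_nonid im_sqr k hm hs' cs).
  by rewrite (TypeII_count_le barK bar_nonid im_sqr k hm hs (cong_sym cs)).
split=> //; apply/(star_congruentP barK)/(cong_trans cA)/(cong_trans (@cong_dsum_perm _ bar _ _ su)).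
apply: cong_dsum_all2 us' => x y xu ys' exy; apply: cong_inv => //; last exact: hs'.
by apply: hs; rewrite (perm_mem su).
Qed.

End Uniqueness.

(** * Existence *)

Section Extension.

Variables (F : closedFieldType) (bar : {rmorphism F -> F}).
Hypotheses (barK : involutive bar) (bar_nonid : exists a : F, bar a != a).
Variables (im : F) (im_sqr : im ^+ 2 = -1).

Local Notation "A ^h" := (star bar A) (at level 2, format "A ^h").
Local Notation csum := (dsum (@cmx F)).

Definition canon n (A : 'M[F]_n) : Prop :=
  exists2 s : seq (csummand F), forall t, t \in s -> cvalid bar im t & cong bar A (csum s).

Lemma canon_cong m n (A : 'M[F]_m) (B : 'M_n) : cong bar A B -> canon B -> canon A.
Proof. by move=> h [s hs hB]; exists s => //; exact: cong_trans hB. Qed.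

Lemma canon_block m n (A : 'M[F]_m) (B : 'M_n) :
  canon A -> canon B -> canon (block_mx A 0 0 B).
Proof.
move=> [s hs hA] [t ht hB]; exists (s ++ t).
  by move=> u; rewrite mem_cat => /orP []; [exact: hs | exact: ht].
exact: cong_trans (cong_block hA hB) (cong_sym (cong_dsum_cat _ _ _)).
Qed.

Lemma canon_cmx t : cvalid bar im t -> canon (cmx t).
Proof.
move=> tv; exists [:: t]; first by move=> u; rewrite inE => /eqP ->.
exact/cong_sym/cong_block00.
Qed.

Lemma canon0 (A : 'M[F]_0) : canon A.
Proof. by exists [::] => //; rewrite (flatmx0 A); exact: cong_refl. Qed.

Lemma cvalid_nil n : (0 < n)%N -> cvalid bar im (TypeI n 0).
Proof.
move=> n0; split=> //; apply/(modulus_neq1P barK bar_nonid im_sqr).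
by rewrite mul0r eq_sym oner_neq0.
Qed.

(* [Mform] glues two copies of the last [p] coordinates to [D] along [B]; bordering
   [tridiagI n 0] by its last unit column in this way gives [tridiagI (n + 2) 0]. *)
Definition Mform d p (D : 'M[F]_d) (B : 'M_(d, p)) : 'M_(d + (p + p)) :=
  block_mx D (row_mx B 0) 0 (block_mx 0 1%:M 0 0).

Lemma Mform_gram d p d1 p1 d2 p2 (D : 'M[F]_d) (B : 'M_(d, p))
  (a : 'M_(d1, d)) (b : 'M_(p1, p)) (a' : 'M_(d2, d)) (b' : 'M_(p2, p)) :
  block_mx a 0 0 (block_mx b 0 0 b) *m Mform D B *m (block_mx a' 0 0 (block_mx b' 0 0 b'))^h
  = block_mx (a *m D *m a'^h) (row_mx (a *m B *m b'^h) 0) 0 (block_mx 0 (b *m b'^h) 0 0).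
Proof.
rewrite /Mform !star_block_mx !star0 !mulmx_block !zsimp mulmx1 mul_mx_row mul_row_block !zsimp.
by rewrite mulmx_block !zsimp.
Qed.

(** [X] and [U] select the coordinates of the two summands, so that summands can be bordered one at
    a time. *)
Lemma cong_Mform_block d1 d2 p1 p2 (D1 : 'M[F]_d1) (D2 : 'M_d2) (B1 : 'M_(d1, p1)) (B2 : 'M_(d2, p2)) :
  cong bar (Mform (block_mx D1 0 0 D2) (block_mx B1 0 0 B2))
    (block_mx (Mform D1 B1) 0 0 (Mform D2 B2)).
Proof.
pose l m n : 'M[F]_(m, m + n) := row_mx 1%:M 0.
pose r m n : 'M[F]_(n, m + n) := row_mx 0 1%:M.
pose X := block_mx (l d1 d2) 0 0 (block_mx (l p1 p2) 0 0 (l p1 p2)).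
pose U := block_mx (r d1 d2) 0 0 (block_mx (r p1 p2) 0 0 (r p1 p2)).
have ll m n : l m n *m (l m n)^h = 1%:M by rewrite !starmxE mul_row_col !zsimp mulmx1.
have rr m n : r m n *m (r m n)^h = 1%:M by rewrite !starmxE mul_row_col !zsimp mulmx1.
have lr m n : l m n *m (r m n)^h = 0 by rewrite !starmxE mul_row_col !zsimp.
have rl m n : r m n *m (l m n)^h = 0 by rewrite !starmxE mul_row_col !zsimp.
have iso : isomx (col_mx X U).
  apply: (@isomx_rinv _ _ _ _ (col_mx X U)^h); first by lia.
  rewrite star_col_mx mul_col_row /X /U !star_block_mx !star0 !mulmx_block !zsimp.
  by rewrite !ll !rr !lr !rl -!scalar_mx_block !block_mx0 -scalar_mx_block.
have lB q1 q2 (C1 : 'M_(d1, q1)) (C2 : 'M_(d2, q2)) : l d1 d2 *m block_mx C1 0 0 C2 = row_mx C1 0.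
  by rewrite mul_row_block !zsimp mul1mx.
have rB q1 q2 (C1 : 'M_(d1, q1)) (C2 : 'M_(d2, q2)) : r d1 d2 *m block_mx C1 0 0 C2 = row_mx 0 C2.
  by rewrite mul_row_block !zsimp mul1mx.
have lh q m n (C : 'M_(q, m)) (C' : 'M_(q, n)) : row_mx C C' *m (l m n)^h = C.
  by rewrite !starmxE mul_row_col !zsimp mulmx1.
have rh q m n (C : 'M_(q, m)) (C' : 'M_(q, n)) : row_mx C C' *m (r m n)^h = C'.
  by rewrite !starmxE mul_row_col !zsimp mulmx1.
pose M := Mform (block_mx D1 0 0 D2) (block_mx B1 0 0 B2).
have XX : X *m M *m X^h = Mform D1 B1 by rewrite Mform_gram !lB !lh.
have UU : U *m M *m U^h = Mform D2 B2 by rewrite Mform_gram !rB !rh.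
rewrite -XX -UU; apply: cong_split => //.
  by rewrite Mform_gram !lB !rh row_mx0 !block_mx0.
by rewrite Mform_gram !rB !lh row_mx0 !block_mx0.
Qed.

(** The corank of a valid summand: only [tridiagI n 0] is singular, and it is a nilpotent shift. *)
Definition ctz (t : csummand F) : nat :=
  match t with TypeI _ l => nat_of_bool (l == 0) | TypeII _ _ => 0%N end.

Definition lastcol (t : csummand F) : 'M[F]_(csize t, ctz t) :=
  \matrix_(i < csize t, j < ctz t) (i.+1 == csize t)%:R.

Lemma canon_Mform_csummand t : cvalid bar im t -> canon (Mform (cmx t) (lastcol t)).
Proof.
move=> tv.
have [c0|[n e]] : ctz t = 0%N \/ exists n, t = TypeI n 0.
  by case: t {tv} => [n l|n m] /=; [case: eqVneq => [->|]; [right; exists n | left] | left].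
  apply: (@canon_cong _ _ _ _ _ (canon_cmx tv)).
  rewrite /Mform; move: (lastcol t); rewrite c0 => B.
  rewrite (_ : row_mx _ _ = 0); last by apply/matrixP => i [].
  exact: cong_block00.
have n0 : (0 < n + (1 + 1))%N by lia.
suff : canon (Mform (tridiagI n (0 : F)) (\matrix_(i < n, j < 1) (i.+1 == n)%:R)).
  by move: tv; rewrite e => _; rewrite /lastcol /= eqxx.
rewrite (_ : Mform _ _ = tridiagI (n + (1 + 1)) 0); first exact: canon_cmx (cvalid_nil n0).
apply/matrixP => i j; rewrite /Mform.
case: (split_ordP i) => i' ->; case: (split_ordP j) => j' ->.
- by rewrite block_mxEul !mxE.
- rewrite block_mxEur; case: (split_ordP (j' : 'I_(1 + 1))) => k ->.
    by rewrite row_mxEl !mxE /= !ord1 /= addn0 eq_sym; case: eqP => //; rewrite if_same.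
  rewrite row_mxEr !mxE /= !ord1 /= ifF ?if_same //; have := ltn_ord i'; lia.
- by rewrite block_mxEdl !mxE /= ifF ?if_same //; have := ltn_ord j'; lia.
rewrite block_mxEdr; case: (split_ordP (i' : 'I_(1 + 1))) => a ->; case: (split_ordP (j' : 'I_(1 + 1))) => b ->.
- by rewrite block_mxEul !mxE /= !ord1 /= ifF ?if_same //; lia.
- by rewrite block_mxEur !mxE /= !ord1 /= ifT //; lia.
- by rewrite block_mxEdl !mxE /= !ord1 /= ifF ?if_same //; lia.
- by rewrite block_mxEdr !mxE /= !ord1 /= ifF ?if_same //; lia.
Qed.

Definition cosum (s : seq (csummand F)) := dsum lastcol s.

Lemma canon_Mform_csum (s : seq (csummand F)) :
  (forall t, t \in s -> cvalid bar im t) -> canon (Mform (csum s) (cosum s)).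
Proof.
elim: s => [_|t s IH hs]; first exact: canon0.
apply: canon_cong (cong_Mform_block _ _ _ _) _; apply: canon_block.
  by apply/canon_Mform_csummand/hs; exact: mem_head.
by apply: IH => u hu; apply: hs; rewrite inE hu orbT.
Qed.

(** With nothing to border, each column contributes a separate block [tridiagI 2 0]. *)
Lemma canon_Mform_empty q : canon (Mform (0 : 'M_0) (0 : 'M[F]_(0, q))).
Proof.
elim: q => [|q IH]; first exact: canon0.
have := cong_Mform_block (0 : 'M_0) (0 : 'M_0) (0 : 'M[F]_(0, 1)) (0 : 'M_(0, q)).
rewrite !block_mx0 => h; apply: canon_cong h (canon_block _ IH).
have e : Mform (0 : 'M_0) (0 : 'M[F]_(0, 1)) = block_mx 0 1%:M 0 0 :> 'M_(1 + 1).
  by rewrite /Mform {1}/block_mx col_flat_mx row_thin_mx.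
suff -> : Mform (0 : 'M_0) (0 : 'M[F]_(0, 1)) = tridiagI (1 + 1) 0.
  exact: canon_cmx (cvalid_nil _).
apply: (etrans e); have : block_mx 0 1%:M 0 0 = tridiagI (1 + 1) 0 :> 'M[F]_(1 + 1); last by [].
apply/matrixP => i j.
case: (split_ordP i) => a ->; case: (split_ordP j) => b ->.
- by rewrite block_mxEul !mxE !ord1.
- by rewrite block_mxEur !mxE !ord1.
- by rewrite block_mxEdl !mxE !ord1.
- by rewrite block_mxEdr !mxE !ord1.
Qed.

Lemma canon_Mform (s : seq (csummand F)) q :
  (forall t, t \in s -> cvalid bar im t) ->
  canon (Mform (csum s) (row_mx (0 : 'M_(_, q)) (cosum s))).
Proof.
move=> hs; have := cong_Mform_block (0 : 'M_0) (csum s) (0 : 'M[F]_(0, q)) (cosum s).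
have -> : block_mx (0 : 'M[F]_0) 0 0 (csum s) = (csum s : 'M_(0 + _, 0 + _)).
  by rewrite /block_mx col_flat_mx row_thin_mx.
have -> : block_mx (0 : 'M[F]_(0, q)) 0 0 (cosum s) = (row_mx 0 (cosum s) : 'M_(0 + _, _)).
  by rewrite /block_mx col_flat_mx.
by move=> h; apply: canon_cong h (canon_block (canon_Mform_empty _) (canon_Mform_csum hs)).
Qed.

End Extension.

(** * Existence for singular matrices *)

Section Singular.

Variables (F : closedFieldType) (bar : {rmorphism F -> F}).
Hypotheses (barK : involutive bar) (bar_nonid : exists a : F, bar a != a).
Variables (im : F) (im_sqr : im ^+ 2 = -1).

Local Notation "A ^h" := (star bar A) (at level 2, format "A ^h").
Local Notation csum := (dsum (@cmx F)).

(* The columns of [E] span a complement of the column space of [D], and [E^T]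
   is the corresponding coordinate map modulo that space. *)
Definition cokernel d c (D : 'M[F]_d) (E : 'M_(d, c)) : Prop :=
  [/\ E^T *m D = 0, E^T *m E = 1%:M &
      forall k (M : 'M_(d, k)), E^T *m M = 0 -> exists Y, M = D *m Y].

Lemma cokernel_block d1 d2 c1 c2 (D1 : 'M[F]_d1) (D2 : 'M_d2) (E1 : 'M_(d1, c1)) (E2 : 'M_(d2, c2)) :
  cokernel D1 E1 -> cokernel D2 E2 -> cokernel (block_mx D1 0 0 D2) (block_mx E1 0 0 E2).
Proof.
move=> [h1 h2 h3] [k1 k2 k3]; rewrite /cokernel tr_block_mx !trmx0; split.
- by rewrite mulmx_block !zsimp h1 k1 block_mx0.
- by rewrite mulmx_block !zsimp h2 k2 -scalar_mx_block.
move=> k M; rewrite -[M]vsubmxK mul_block_col !zsimp -[0]vsubmxK !linear0 => /eq_col_mx [hu hd].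
have [Y1 ->] := h3 _ _ hu; have [Y2 ->] := k3 _ _ hd.
by exists (col_mx Y1 Y2); rewrite mul_block_col !zsimp.
Qed.

Lemma cokernel_unit d (D : 'M[F]_d) (E : 'M_(d, 0)) : D \in unitmx -> cokernel D E.
Proof.
move=> Du; split=> [||k M _]; rewrite ?(flatmx0 (_ *m _)) ?(flatmx0 1%:M) //.
by exists (invmx D *m M); rewrite mulKVmx.
Qed.

Lemma cokernel_nilp n : (0 < n)%N ->
  cokernel (tridiagI n (0 : F)) (\matrix_(i < n, j < 1) (i.+1 == n)%:R).
Proof.
case: n => // n _; have -> : tridiagI n.+1 (0 : F) = jordan n.+1 0.
  by apply/matrixP => i j; rewrite shiftE mxE; case: eqP => //; rewrite if_same.
have -> : \matrix_(i < n.+1, j < 1) (i.+1 == n.+1)%:R = delta_mx ord_max 0 :> 'M[F]_(n.+1, 1).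
  by apply/matrixP => i j; rewrite !mxE ord1 eqxx andbT eqSS.
rewrite /cokernel trmx_delta; split.
- rewrite -rowE; apply/matrixP => i j; rewrite mxE shiftE mxE /=.
  by rewrite ltn_eqF.
- by rewrite mul_delta_mx; apply/matrixP => i j; rewrite !mxE !ord1 eqxx.
(* The shift times its transpose is the identity except in the last row, where [M] vanishes. *)
move=> k M; rewrite -rowE => M0; exists ((jordan n.+1 0)^T *m M).
apply/matrixP => i j; rewrite (mul_shift_l (f := fun a b => entry ((jordan n.+1 0)^T *m M) a b)).
- have [lt_in|ge_in] := ltnP i.+1 n.+1; last first.
    rewrite entry_row // (_ : i = ord_max); first by move/matrixP/(_ 0 j): M0; rewrite !mxE.
    by apply: val_inj => /=; have := ltn_ord i; lia.
  rewrite (entryE _ (Ordinal lt_in) j) mxE (bigD1 i) //= mxE shiftE /= eqxx mul1r big1 ?addr0 //.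
  by move=> l hl; rewrite mxE shiftE /= eqSS eq_sym (negPf (_ : (l : nat) != i)) ?mul0r // val_eqE.
- by move=> a b; rewrite entryE.
- by move=> b; rewrite entry_row.
Qed.

Lemma hyper_unit k (l : F) : l != 0 -> hyper k l \in unitmx.
Proof.
move=> l0; have Ju := jordan_unit k l0.
apply: (mulmx1_unit (B := block_mx 0 (invmx (jordan k l)) 1%:M 0) _).1.
by rewrite mulmx_block !zsimp !mulmx1 mulmxV // -scalar_mx_block.
Qed.

Lemma cong_unit m n (A : 'M[F]_m) (B : 'M_n) : cong bar A B -> B \in unitmx -> A \in unitmx.
Proof.
move=> [S /andP [/eqP e _] <-] Bu; move: S Bu; rewrite e => S.
by rewrite !unitmx_mul => /andP [/andP []].
Qed.

Lemma cokernel_csummand t : cvalid bar im t -> cokernel (cmx t) (lastcol t).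
Proof.
case: t => [n l|n m] tv.
  have [n0 hl ho] := cvalidI barK bar_nonid im_sqr tv; rewrite /lastcol /=.
  case: eqVneq => [l0|l0] /=; first by rewrite l0; exact: cokernel_nilp.
  apply: cokernel_unit; have even_n : ~~ odd n by apply: contraNN l0 => /ho ->.
  have : n = (n./2 + n./2)%N by lia.
  case: (n./2) => [|k] e; first by lia.
  by rewrite e; apply: cong_unit (tridiagI_even barK k hl) (hyper_unit _ l0).
have [n0 _ m0] := cvalidII barK bar_nonid im_sqr tv.
by apply: cokernel_unit; case: n n0 {tv} => // n _; apply: (TypeII_unit barK bar_nonid).
Qed.

Lemma cokernel_csum (s : seq (csummand F)) : (forall t, t \in s -> cvalid bar im t) ->
  cokernel (csum s) (cosum s).
Proof.
elim: s => [_|t s IH hs].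
  split=> [||k M _]; rewrite ?(flatmx0 (_ *m _)) ?(flatmx0 1%:M) //.
  by exists M; rewrite (flatmx0 M) (flatmx0 (_ *m _)).
apply: cokernel_block; first by apply/cokernel_csummand/hs; exact: mem_head.
by apply: IH => u hu; apply: hs; rewrite inE hu orbT.
Qed.

Lemma isomx_compl n k (X : 'M[F]_(k, n)) : row_free X -> isomx (col_mx X (row_base (X^C)%MS)).
Proof.
move=> Xf; have rX : \rank X = k by apply/eqP.
have e : (k + \rank (X^C)%MS)%N = n by rewrite mxrank_compl rX subnKC // -rX rank_leq_col.
apply/andP; split; first exact/eqP.
have full : \rank (col_mx X (row_base (X^C)%MS)) = n.
  rewrite -addsmxE; have -> : \rank (X + row_base (X^C))%MS = \rank (X + X^C)%MS.
    by rewrite (adds_eqmx (eqmx_refl X) (eq_row_base (X^C)%MS)).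
  by apply/eqP; exact: addsmx_compl_full.
by rewrite -row_leq_rank full e.
Qed.

Lemma canon_radical n (A : 'M[F]_n) (z : 'rV_n) :
  z != 0 -> z *m A = 0 -> z *m A^h = 0 ->
  (forall N (B : 'M[F]_N), (N < n)%N -> canon bar im B) -> canon bar im A.
Proof.
move=> z0 zA zAh IH.
have zf : row_free z by rewrite -row_leq_rank rank_rV z0.
have iso := isomx_compl zf; set U := row_base _ in iso.
have Azh : A *m z^h = 0 by rewrite -[A](starK barK) -starM zAh star0.
have h1 : z *m A *m U^h = 0 by rewrite zA mul0mx.
have h2 : U *m A *m z^h = 0 by rewrite -mulmxA Azh mulmx0.
apply: canon_cong (cong_split iso h1 h2) _; rewrite zA mul0mx.
apply: canon_block; last first.
  by apply: IH; have /andP [/eqP e _] := iso; rewrite -[X in (_ < X)%N]e.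
have -> : 0 = tridiagI 1 (0 : F) by apply/matrixP => i j; rewrite !mxE !ord1.
exact: canon_cmx (cvalid_nil barK bar_nonid im_sqr (ltn0Sn 0)).
Qed.

(** A basis of the kernel of [G^h] gives the zero columns, and a right inverse of [G] the identity
    block. *)
Lemma row_free_split p q (G : 'M[F]_(p, q)) : row_free G ->
  exists c (C : 'M_(c + p, q)), isomx C /\ G *m C^h = row_mx 0 1%:M.
Proof.
move=> Gf; have [H GH] := row_freeP Gf.
pose K2 := row_base (kermx G^h); exists (\rank (kermx G^h)), (col_mx K2 H^h).
have K2h : K2 *m G^h = 0 by apply/sub_kermxP; rewrite eq_row_base.
have K2G : G *m K2^h = 0 by rewrite -[LHS](starK barK) starM (starK barK) K2h star0.
split; last by rewrite star_col_mx (starK barK) mul_mx_row K2G GH.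
apply/andP; split.
  rewrite mxrank_ker mxrank_star (eqP Gf) subnK //.
  by rewrite -[X in (X <= _)%N](eqP Gf) rank_leq_col.
apply: inj_row_free => v; rewrite -[v]hsubmxK mul_row_col => e.
have r0 : rsubmx v = 0.
  have := congr1 (fun M => M *m G^h) e.
  by rewrite mulmxDl mul0mx -(mulmxA _ K2) K2h mulmx0 add0r -mulmxA -starM GH star1 mulmx1.
move: e; rewrite r0 mul0mx addr0 -[X in _ = X -> _](mul0mx 1 K2).
by move=> /(row_free_inj (row_base_free _)) ->; rewrite row_mx0.
Qed.

Section Stack.

Variables (n a b : nat) (A : 'M[F]_n) (V1 : 'M[F]_(a, n)) (V2 Z : 'M[F]_(b, n)).
Hypotheses (size_eq : (a + (b + b))%N = n) (ZA : Z *m A = 0)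
  (V1Z : V1 *m A *m Z^h = 0) (V2Z : V2 *m A *m Z^h = 1%:M)
  (Z_free : row_free Z)
  (V1_free : forall (x : 'rV_a) (w : 'rV_b), x *m V1 = w *m Z -> x = 0).

(** Multiplying a vanishing combination by [A *m Z^h] reads off its coordinates along [V2];
    [V1_free] then disposes of those along [V1] modulo the left kernel. *)
Lemma isomx_stack : isomx (col_mx V1 (col_mx V2 Z)).
Proof.
apply/andP; split; first exact/eqP.
apply: inj_row_free => v; rewrite -[v]hsubmxK -[rsubmx v]hsubmxK.
set v1 := lsubmx v; set v2 := lsubmx _; set z := rsubmx _.
rewrite !mul_row_col => e; have v20 : v2 = 0.
  have := congr1 (fun M => M *m A *m Z^h) e.
  have t c (x : 'rV_c) (V : 'M_(c, n)) : x *m V *m A *m Z^h = x *m (V *m A *m Z^h) by rewrite !mulmxA.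
  by rewrite !mulmxDl !mul0mx !t V1Z V2Z ZA mul0mx !zsimp mulmx1.
have v10 : v1 = 0.
  apply: (V1_free (w := - z)); apply/eqP; rewrite mulNmx -addr_eq0; apply/eqP.
  by move: e; rewrite v20 mul0mx add0r.
have z0 : z = 0.
  by move: e; rewrite v10 v20 !mul0mx !add0r -[X in _ = X -> _](mul0mx 1 Z) => /(row_free_inj Z_free).
by rewrite v10 v20 z0 !row_mx0.
Qed.

End Stack.

Lemma canon_singular n (A : 'M[F]_n) :
  A \notin unitmx -> (forall N (B : 'M[F]_N), (N < n)%N -> canon bar im B) -> canon bar im A.
Proof.
move=> Asing IH.
case: (eqVneq (kermx A :&: kermx A^h)%MS 0) => [cap0|]; last first.
  case/rowV0Pn => z; rewrite sub_capmx => /andP [/sub_kermxP zA /sub_kermxP zAh] z0.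
  exact: canon_radical zAh IH.
(* [Z0] spans the left kernel, [V20] is dual to it, and [V10] spans a complement
   of the left kernel in [{v | v *m A *m Z0^h = 0}]. *)
set Z0 := row_base (kermx A); set b := \rank (kermx A) in Z0 *.
have b0 : (0 < b)%N.
  by rewrite lt0n /b mxrank_eq0 kermx_eq0 row_free_unit.
have Z0f : row_free Z0 := row_base_free _.
have Z0A : Z0 *m A = 0 by apply/sub_kermxP; rewrite eq_row_base.
have Zsub p (y : 'M_(p, n)) : y *m A = 0 -> exists w, y = w *m Z0.
  by move/sub_kermxP; rewrite -(eq_row_base (kermx A)) => /submxP.
(* With trivial radical no nonzero vector of the left kernel is killed by [A^h], so the pairing
   against the left kernel is onto. *)
have AZfull : row_full (A *m Z0^h).
  have : row_free (Z0 *m A^h).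
    apply: inj_row_free => v; rewrite mulmxA => vZ.
    have : (v *m Z0 <= kermx A :&: kermx A^h)%MS.
      rewrite sub_capmx; apply/andP; split; apply/sub_kermxP => //.
      by rewrite -mulmxA Z0A mulmx0.
    rewrite cap0 submx0 => /eqP; rewrite -[X in _ = X -> _](mul0mx 1 Z0).
    exact: (row_free_inj Z0f).
  by rewrite /row_free /row_full -(mxrank_star bar) starM (starK barK).
pose V20 : 'M_(b, n) := pinvmx (A *m Z0^h).
have V2Z0 : V20 *m A *m Z0^h = 1%:M by rewrite -mulmxA mulVpmx.
pose Kk := kermx (A *m Z0^h).
have ZK : (kermx A <= Kk)%MS by apply/sub_kermxP; rewrite mulmxA mulmx_ker mul0mx.
pose V10 := row_base (Kk :\: kermx A)%MS.
have V1Z0 : V10 *m A *m Z0^h = 0.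
  by rewrite -mulmxA; apply/sub_kermxP; rewrite eq_row_base diffmxSl.
have V1f0 (x : 'rV_(\rank (Kk :\: kermx A)%MS)) (w : 'rV_b) : x *m V10 = w *m Z0 -> x = 0.
  move=> e; have : (x *m V10 <= (Kk :\: kermx A) :&: kermx A)%MS.
    rewrite sub_capmx {2}e; apply/andP; split.
      by apply: submx_trans (submxMl _ _) _; rewrite eq_row_base.
    by apply: submx_trans (submxMl _ _) _; rewrite eq_row_base.
  rewrite capmx_diff submx0 => /eqP; rewrite -[X in _ = X -> _](mul0mx 1 V10).
  exact: (row_free_inj (row_base_free _)).
have size0 : (\rank (Kk :\: kermx A)%MS + (b + b))%N = n.
  have := mxrank_cap_compl Kk (kermx A); rewrite (capmx_idPr ZK) -/b /Kk mxrank_ker.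
  by rewrite (eqP AZfull); have := rank_leq_row (kermx A); rewrite -/b; lia.
have [s hs [R Ri hR]] : canon bar im (V10 *m A *m V10^h) by apply: IH; lia.
pose V1 := R *m V10; pose D := csum s; pose E := cosum s.
have V1A : V1 *m A *m V1^h = D by rewrite /V1 /D -hR starM !mulmxA.
have [R' [/andP [/eqP eR _] RR' R'R]] := isomxP Ri.
have V1Z : V1 *m A *m Z0^h = 0 by rewrite /V1 -!(mulmxA R) V1Z0 mulmx0.
have V1f (x : 'rV_(_)) (w : 'rV_b) : x *m V1 = w *m Z0 -> x = 0.
  by rewrite /V1 mulmxA => /V1f0 xR; rewrite -[x]mulmx1 -RR' mulmxA xR mul0mx.
have size1 : (sumn (map (@csize F) s) + (b + b))%N = n by rewrite -eR.
have stack1 := isomx_stack size1 Z0A V1Z V2Z0 Z0f V1f.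
pose B := V1 *m A *m V20^h.
(* A combination of rows of [V1] orthogonal to [V1] and [V20] is also orthogonal to [Z0], hence lies
   in the left kernel and is zero. *)
have DBf : row_free (row_mx D B).
  apply: inj_row_free => x; rewrite mul_mx_row -[0]hsubmxK !linear0 => /eq_row_mx [xD xB].
  have [T [_ _ TW]] := isomxP stack1.
  have xA : x *m V1 *m A = 0.
    have t c (Y : 'M_(n, c)) : x *m V1 *m A *m Y = x *m (V1 *m A *m Y) by rewrite !mulmxA.
    rewrite -[LHS]mulmx1 -(star1 bar) -TW starM mulmxA !star_col_mx !mul_mx_row !t.
    by rewrite V1A xD xB V1Z mulmx0 !row_mx0 mul0mx.
  have [w hw] := Zsub _ _ xA.
  exact: V1f hw.
have [ED EE Ecok] := cokernel_csum hs; rewrite -/D -/E in ED EE Ecok.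
(* A row relation on the border modulo the range of [D] would be a relation on [row_mx D B], because
   [E^T *m D = 0]. *)
have G'f : row_free (E^T *m B).
  apply: inj_row_free => x; rewrite mulmxA => xE.
  have : x *m E^T *m row_mx D B = 0 by rewrite mul_mx_row xE -mulmxA ED mulmx0 row_mx0.
  rewrite -[X in _ = X -> _](mul0mx 1 (row_mx D B)) => /(row_free_inj DBf) xE0.
  by rewrite -[x]mulmx1 -EE mulmxA xE0 mul0mx.
(* Change the basis of the left kernel so that the border becomes [row_mx 0 E]
   modulo the columns of [D], then clear the rest. *)
have [c' [C [Ci GC]]] := row_free_split G'f.
have [C' [/andP [/eqP eC C'f] CC' C'C]] := isomxP Ci.
pose V2a := C *m V20; pose Z := C'^h *m Z0.
have [Y hY] : exists Y, V1 *m A *m V2a^h - row_mx 0 E = D *m Y.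
  apply: Ecok; rewrite mulmxBr mul_mx_row EE mulmx0 /V2a starM (mulmxA _ V20^h) mulmxA GC subrr.
  by [].
pose V2b := V2a - Y^h *m V1.
have ZZA : Z *m A = 0 by rewrite /Z -mulmxA Z0A mulmx0.
have V1ZZ : V1 *m A *m Z^h = 0 by rewrite /Z starM mulmxA V1Z mul0mx.
have V2Z : V2b *m A *m Z^h = 1%:M.
  rewrite /V2b !mulmxBl -!(mulmxA Y^h) V1ZZ mulmx0 subr0 /V2a /Z starM (starK barK).
  have t : V20 *m A *m (Z0^h *m C') = C' by rewrite mulmxA V2Z0 mul1mx.
  have -> : C *m V20 *m A = C *m (V20 *m A) by rewrite mulmxA.
  by rewrite -(mulmxA C) t CC'.
have V1V2 : V1 *m A *m V2b^h = row_mx 0 E.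
  by rewrite /V2b starB mulmxBr starM (starK barK) mulmxA V1A -hY opprB addrC subrK.
(* Since [Z *m A = 0], adding left kernel vectors matters only in the right argument: this clears
   the products of [V2b] with [V1] and with itself and leaves those of [V1] alone. *)
pose V1c := V1 - (V2b *m A *m V1^h)^h *m Z.
pose V2c := V2b - (V2b *m A *m V2b^h)^h *m Z.
have subA p (M : 'M_(p, n)) q (X : 'M_(p, q)) (Z' : 'M_(q, n)) : Z' *m A = 0 -> (M - X *m Z') *m A = M *m A.
  by move=> e; rewrite mulmxBl -mulmxA e mulmx0 subr0.
have V1cA : V1c *m A = V1 *m A by apply: subA.
have V2cA : V2c *m A = V2b *m A by apply: subA.
have V1cs p (M : 'M_(p, n)) : M *m V1c^h = M *m V1^h - M *m Z^h *m (V2b *m A *m V1^h).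
  by rewrite /V1c starB starM (starK barK) mulmxBr !mulmxA.
have V2cs p (M : 'M_(p, n)) : M *m V2c^h = M *m V2b^h - M *m Z^h *m (V2b *m A *m V2b^h).
  by rewrite /V2c starB starM (starK barK) mulmxBr !mulmxA.
have Zf : row_free Z.
  apply: inj_row_free => v; rewrite /Z mulmxA -[X in _ = X -> _](mul0mx 1 Z0) => /(row_free_inj Z0f) e.
  by rewrite -[v]mulmx1 -(star1 bar) -CC' starM mulmxA e mul0mx.
have V1cf (x : 'rV_(_)) (w : 'rV_(c' + _)) : x *m V1c = w *m Z -> x = 0.
  rewrite /V1c mulmxBr => /eqP; rewrite subr_eq => /eqP e.
  apply: (V1f _ (w *m C'^h + x *m (V2b *m A *m V1^h)^h *m C'^h)).
  by rewrite e /Z mulmxDl !mulmxA.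
have V1cZ : V1c *m A *m Z^h = 0 by rewrite V1cA.
have V2cZ : V2c *m A *m Z^h = 1%:M by rewrite V2cA.
have iso : isomx (col_mx V1c (col_mx V2c Z)).
  by apply: isomx_stack V1cZ V2cZ Zf V1cf => //; rewrite -eC.
apply: canon_cong (cong_gram bar A iso) _.
rewrite (_ : _ *m _ = Mform D (row_mx 0 E)); first exact: canon_Mform.
have V11 : V1c *m A *m V1c^h = D by rewrite V1cA V1cs V1ZZ mul0mx subr0.
have V12 : V1c *m A *m V2c^h = row_mx 0 E by rewrite V1cA V2cs V1ZZ mul0mx subr0.
have V21 : V2c *m A *m V1c^h = 0 by rewrite V2cA V1cs V2Z mul1mx subrr.
have V22 : V2c *m A *m V2c^h = 0 by rewrite V2cA V2cs V2Z mul1mx subrr.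
rewrite !star_col_mx !mul_col_mx ZZA !mul_mx_row V11 V12 V1cZ V21 V22 V2cZ !mul0mx.
by congr col_mx; rewrite -[LHS]/(block_mx _ _ _ _) block_mxEh col_mx0.
Qed.

End Singular.

(** * Existence for nonsingular matrices *)

Section Nonsingular.

Variables (F : closedFieldType) (bar : {rmorphism F -> F}).
Hypotheses (barK : involutive bar) (bar_nonid : exists a : F, bar a != a).
Variables (im : F) (im_sqr : im ^+ 2 = -1).

Local Notation "A ^h" := (star bar A) (at level 2, format "A ^h").

(** From [W *m A = K *m W *m A^h], left orthogonality to [W] implies right orthogonality, so the
    complement [U] splits off on both sides. *)
Lemma canon_split k n (A : 'M[F]_n) (W : 'M_(k, n)) (K : 'M_k) :
  (0 < k)%N -> W *m A *m W^h \in unitmx -> W *m A = K *m W *m A^h ->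
  canon bar im (W *m A *m W^h) ->
  (forall N (B : 'M[F]_N), (N < n)%N -> canon bar im B) -> canon bar im A.
Proof.
move=> k0 Gu WA hW IH; pose U := row_base (kermx (A *m W^h)).
have UW : U *m A *m W^h = 0 by rewrite -mulmxA; apply/sub_kermxP; rewrite eq_row_base.
have WU : W *m A *m U^h = 0.
  have t : W *m A^h *m U^h = (U *m A *m W^h)^h by rewrite !starM (starK barK) mulmxA.
  by rewrite WA -2!(mulmxA K) t UW star0 mulmx0.
have rk : \rank (A *m W^h) = k.
  apply/eqP; rewrite eqn_leq rank_leq_col /=.
  by rewrite -[X in (X <= _)%N](mxrank_unit Gu) -mulmxA mxrankM_maxr.
have kn : (k <= n)%N by rewrite -rk rank_leq_row.
have iso : isomx (col_mx W U).
  apply/andP; split; first by rewrite mxrank_ker rk subnKC.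
  apply: inj_row_free => v; rewrite -[v]hsubmxK mul_row_col => e.
  have l0 : lsubmx v = 0.
    have := congr1 (fun M => M *m A *m W^h) e.
    rewrite !mulmxDl !mul0mx -2!(mulmxA (lsubmx v)) -2!(mulmxA (rsubmx v)) UW mulmx0 addr0.
    by move/(canRL (mulmxK Gu)); rewrite mul0mx.
  move: e; rewrite l0 mul0mx add0r -[X in _ = X -> _](mul0mx 1 U).
  by move=> /(row_free_inj (row_base_free _)) ->; rewrite row_mx0.
apply: canon_cong (cong_split iso WU UW) (canon_block hW (IH _ _ _)).
by rewrite mxrank_ker rk; lia.
Qed.

Lemma sylvester_nilp m n (M : 'M[F]_m) (U : 'M[F]_n) (X : 'M_(m, n)) k :
  U \in unitmx -> M *m X = X *m U -> M ^+ k = 0 -> X = 0.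
Proof.
move=> Uu MX M0; have : M ^+ k *m X = 0 by rewrite M0 mul0mx.
elim: {M0} k => [|k IH]; first by rewrite expr0 mul1mx.
by rewrite exprSr -mulmxE -mulmxA MX mulmxA => /(canRL (mulmxK Uu)); rewrite mul0mx.
Qed.

(** The Gram matrix of [X] intertwines [J] with [invmx J^h], that of [Y] does so in reverse. The
    eigenvalues [l] and [(bar l)^-1] differ, so both vanish and only the pairing between [X] and [Y]
    remains. *)
Lemma hyper_step k n (A : 'M[F]_n) (X Y : 'M_(k.+1, n)) (l : F) :
  let J := jordan k.+1 l in
  l != 0 -> l * bar l != 1 ->
  X *m A = J *m X *m A^h -> Y *m A = invmx J^h *m Y *m A^h -> X *m A *m Y^h = 1%:M ->
  (forall N (B : 'M[F]_N), (N < n)%N -> canon bar im B) -> canon bar im A.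
Proof.
move=> J l0 hl XA YA XY IH.
have Ju : J \in unitmx := jordan_unit _ l0.
have Jhu : J^h \in unitmx by rewrite star_unit.
set T := invmx J^h in YA *; have Tu : T \in unitmx by rewrite unitmx_inv.
have bl0 : bar l != 0 by rewrite fmorph_eq0.
have Uu : T - l%:M \in unitmx.
  have : J - (bar l)^-1%:M \in unitmx.
    have -> : J - (bar l)^-1%:M = jordan k.+1 (l - (bar l)^-1).
      by rewrite /J jordanE [RHS]jordanE raddfB addrAC.
    by apply: jordan_unit; rewrite subr_eq0; apply: contra hl => /eqP {1}->; rewrite mulVf.
  rewrite -(star_unit bar) starB star_scalar fmorphV barK => h.
  have -> : T - l%:M = - l *: (T *m (J^h - l^-1%:M)).
    rewrite mulmxBr /T mulVmx // mul_mx_scalar scalerBr scalerA mulNr mulfV //.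
    by rewrite scaleN1r opprK scaleNr scalemx1 addrC.
  by rewrite unitmxZ ?unitfE ?oppr_eq0 // unitmx_mul Tu.
have [Nnil _] := @unicell_jordan F k l; rewrite -/J in Nnil.
have star2 (S S' : 'M_(k.+1, n)) : S *m A^h *m S'^h = (S' *m A *m S^h)^h.
  by rewrite !starM (starK barK) mulmxA.
have XX : X *m A *m X^h = 0.
  set G := X *m A *m X^h; have GJ : G = J *m G^h by rewrite {1}/G XA -2!(mulmxA J) star2.
  have JG : J *m G = G *m T.
    have Gh : G^h = G *m J^h by rewrite {1}GJ starM (starK barK).
    by rewrite [in RHS]GJ Gh -(mulmxA J) mulmxK.
  apply: (@sylvester_nilp _ _ (J - l%:M) (T - l%:M) G k.+1) => //.
  by rewrite mulmxBl mulmxBr JG mul_scalar_mx mul_mx_scalar.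
have YY : Y *m A *m Y^h = 0.
  set H := Y *m A *m Y^h; have HT : H = T *m H^h by rewrite {1}/H YA -2!(mulmxA T) star2.
  have TH : T *m H = H *m J.
    rewrite {2}HT; have -> : H^h = H *m T^h by rewrite {1}HT starM (starK barK).
    have TJ : T^h *m J = 1%:M by rewrite -[J](starK barK) -starM mulmxV // star1.
    by rewrite -(mulmxA T) -(mulmxA H) TJ mulmx1.
  apply: (can_inj (@trmxK _ _ _)); rewrite trmx0.
  apply: (@sylvester_nilp _ _ (J - l%:M)^T (T - l%:M)^T _ k.+1).
  - by rewrite unitmx_tr.
  - by rewrite -!trmx_mul mulmxBl mulmxBr TH mul_scalar_mx mul_mx_scalar.
  - by rewrite -trmx_exp Nnil trmx0.
have YX : Y *m A *m X^h = T by rewrite YA -2!(mulmxA T) star2 XY star1 mulmx1.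
have G : col_mx X Y *m A *m (col_mx X Y)^h = block_mx 0 1%:M T 0.
  by rewrite star_col_mx !mul_col_mx !mul_mx_row XX XY YX YY.
have hl' : (bar l)^-1 * bar (bar l)^-1 != 1.
  by rewrite fmorphV barK -invfM invr_eq1 mulrC.
apply: (@canon_split _ _ A (col_mx X Y) (block_mx J 0 0 T)) => //.
- rewrite G; apply: (mulmx1_unit (B := block_mx 0 (invmx T) 1%:M 0) _).1.
  by rewrite mulmx_block !zsimp mulmx1 mulmxV // -scalar_mx_block.
- by rewrite mul_block_col !zsimp !mul_col_mx XA YA.
rewrite G; have U1 : unicell (T *m invmx (1%:M : 'M[F]_k.+1)^h) (bar l)^-1.
  rewrite star1 invmx1 mulmx1; apply: unicell_inv => //.
  exact/unicell_tr/unicell_map/unicell_jordan.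
apply: (canon_cong (hyper_congr barK (unitmx1 _ _) U1)).
apply: (canon_cong (cong_sym (tridiagI_even barK k hl'))).
have tv : cvalid bar im (TypeI (k.+1 + k.+1) (bar l)^-1).
  by split=> //; [exact/(modulus_neq1P barK bar_nonid im_sqr) | rewrite addnn odd_double].
exact: canon_cmx tv.
Qed.

(** For a square root m of [l], the norm [m * bar m] is 1 or -1, and -1 is not a norm. *)
Lemma unit_norm_sqrt (l : F) : l * bar l = 1 -> exists2 m, m * bar m = 1 & m ^+ 2 = l.
Proof.
move=> hl; have [m hm] := exists_sqrt l; exists m => //.
have : (m * bar m) ^+ 2 = 1 by rewrite exprMn -rmorphXn hm.
move/eqP; rewrite sqrf_eq1 => /orP [/eqP //|/eqP e].
have : nneg bar (- 1) by rewrite -e; exact: nneg_norm.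
by move/(nneg_anti barK bar_nonid im_sqr (nneg1 bar))/eqP; rewrite oner_eq0.
Qed.

Lemma commutant_00unit k (C : 'M[F]_k.+1) :
  jordan k.+1 0 *m C = C *m jordan k.+1 0 -> C 0 0 != 0 -> C \in unitmx.
Proof.
move=> hC c0; rewrite -unitmx_tr unitmxE det_trig ?commutant_trig //.
rewrite unitfE; apply/prodf_neq0 => i _; by rewrite mxE (commutant_diag hC).
Qed.

(** If the form vanished on [x], [y], [x + y] and [x + im y], then [c x y + c y x] and
    [c y x - c x y] would both be zero. *)
Lemma polarization (V : lmodType F) (c : V -> V -> F) (x y : V) :
  (forall e, c (x + e *: y) (x + e *: y) = c x x + bar e * c x y + e * c y x + e * bar e * c y y) ->
  c x y != 0 -> exists a b, c (a *: x + b *: y) (a *: x + b *: y) != 0.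
Proof.
move=> hc xy0.
have t (a b : F) : c (a *: x + b *: y) (a *: x + b *: y) != 0 ->
    exists a b, c (a *: x + b *: y) (a *: x + b *: y) != 0 by exists a, b.
have [xx|] := eqVneq (c x x) 0; last by have := t 1 0; rewrite scale1r scale0r addr0.
have [yy|] := eqVneq (c y y) 0; last by have := t 0 1; rewrite scale1r scale0r add0r.
have [e1|] := eqVneq (c (x + 1 *: y) (x + 1 *: y)) 0; last by have := t 1 1; rewrite scale1r.
have [e2|] := eqVneq (c (x + im *: y) (x + im *: y)) 0; last by have := t 1 im; rewrite scale1r.
move: e1 e2; rewrite !hc xx yy rmorph1 !mul1r (bar_im barK bar_nonid im_sqr) !mulr0 !addr0 !add0r.
move=> e1 e2; case/eqP: xy0; apply: (mulfI (char_neq2 barK bar_nonid)).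
have im0 : im != 0 by apply: contra_eq_neq im_sqr => ->; rewrite expr0n eq_sym oppr_eq0 oner_neq0.
have e3 : - c x y + c y x = 0.
  by apply: (mulfI im0); rewrite mulr0 mulrDr mulrN -mulNr.
have -> : 2%:R * c x y = (c x y + c y x) - (- c x y + c y x) by ring.
by rewrite e1 e3 subrr mulr0.
Qed.

(** As [l] has modulus one, [Q] turns the dual chain [Y] into a second chain for [J] itself. The
    product [M X Z] is then a unit of the centralizer, so polarization of its corner entry applies
    to [X] and [Z]. *)
Lemma chain_step k n (A : 'M[F]_n) (X Y : 'M_(k.+1, n)) (l : F) :
  let J := jordan k.+1 l in
  l * bar l = 1 ->
  X *m A = J *m X *m A^h -> Y *m A = invmx J^h *m Y *m A^h -> X *m A *m Y^h = 1%:M ->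
  (forall N (B : 'M[F]_N), (N < n)%N -> canon bar im B) -> canon bar im A.
Proof.
move=> J hl XA YA XY IH.
(* [m] is chosen so that the cosquare of [m *: Qmx F k.+1] has eigenvalue [l]. *)
have [m hm m2] : exists2 m, m * bar m = 1 & m ^+ 2 = (-1) ^+ k.+2 * l.
  apply: unit_norm_sqrt; rewrite rmorphM rmorphXn rmorphN1 mulrACA hl mulr1.
  by rewrite -exprMn mulrNN mulr1 expr1n.
have lE : l = rho bar k.+1 m.
  by rewrite (rhoE _ hm) m2 mulrA -exprMn mulrNN mulr1 expr1n mul1r.
have [Q Qu QJ] := JhV_jordan k hm; rewrite -lE -/J in QJ.
have QVJ : invmx J^h *m invmx Q = invmx Q *m J.
  by rewrite -[LHS](mulKmx Qu) (mulmxA Q) QJ mulmxK.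
have l0 : l != 0 by apply: contra_eq_neq hl => ->; rewrite mul0r eq_sym oner_neq0.
have Ju : J \in unitmx := jordan_unit _ l0.
have Jhu : J^h \in unitmx by rewrite star_unit.
pose Z := Q *m Y.
have ZA : Z *m A = J *m Z *m A^h by rewrite /Z -mulmxA YA !mulmxA QJ.
pose M (S T : 'M_(k.+1, n)) := S *m A *m T^h *m invmx Q.
have MJ S T : S *m A = J *m S *m A^h -> T *m A = J *m T *m A^h ->
    jordan k.+1 0 *m M S T = M S T *m jordan k.+1 0.
  move=> hS hT; apply: (@commute_shift _ _ l); rewrite -/J.
  have h : S *m A *m T^h = J *m (S *m A *m T^h) *m J^h.
    have t : A^h *m T^h = A *m T^h *m J^h by rewrite -starM hT !starM (starK barK) mulmxA.
    by rewrite {1}hS -(mulmxA _ A^h) t !mulmxA.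
  rewrite /M -[RHS]mulmxA -QVJ [in RHS]h !mulmxA.
  by rewrite mulmxK.
have MXZ : M X Z 0 0 != 0.
  apply: commutant_unit00; first exact: MJ.
  by rewrite /M /Z starM mulmxA XY mul1mx unitmx_mul star_unit Qu unitmx_inv.
have [a [b hab]] : exists a b, M (a *: X + b *: Z) (a *: X + b *: Z) 0 0 != 0.
  apply: (@polarization _ (fun S T => M S T 0 0)) MXZ => e.
  rewrite /M starD starZ !mulmxDl !mulmxDr !mulmxDl -!scalemxAl -!scalemxAr -!scalemxAl.
  by rewrite !mxE; ring.
set S := a *: X + b *: Z in hab.
have SA : S *m A = J *m S *m A^h.
  by rewrite /S mulmxDl mulmxDr mulmxDl -!scalemxAl XA ZA -!scalemxAr -!scalemxAl.
have Bu : S *m A *m S^h \in unitmx.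
  have := commutant_00unit (MJ _ _ SA SA) hab.
  by rewrite /M unitmx_mul => /andP [].
apply: (canon_split (ltn0Sn k) Bu SA _ IH).
have [X0 X0u hX0] := TypeII_jordan barK bar_nonid k (m_neq0 hm); rewrite -lE -/J in hX0.
have gramJ q (V : 'M[F]_(k.+1, q)) (C : 'M[F]_q) : V *m C = J *m V *m C^h ->
    V *m C *m V^h = J *m (V *m C *m V^h)^h.
  by move=> h; rewrite {1}h !starM (starK barK) !mulmxA.
have B0u : X0 *m (m *: Qmx F k.+1) *m X0^h \in unitmx.
  by rewrite !unitmx_mul star_unit X0u (TypeII_unit barK bar_nonid) // (m_neq0 hm).
have canon_m e : e * bar e = 1 -> canon bar im (X0 *m (e *: Qmx F k.+1) *m X0^h).
  move=> he; have iso : isomx X0 by rewrite isomxE.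
  apply: (canon_cong (cong_sym (cong_gram bar (e *: Qmx F k.+1) iso))).
  have tv : cvalid bar im (TypeII k.+1 e) by split=> //; exact/(modulus1P barK bar_nonid im_sqr).
  exact: canon_cmx tv.
have [h|h] := single_block_cong barK bar_nonid im_sqr l0 Bu B0u (gramJ _ _ _ SA) (gramJ _ _ _ hX0).
  exact: canon_cong h (canon_m m hm).
apply: canon_cong h _; rewrite -mulNmx -mulmxN -scaleNr; apply: canon_m.
by rewrite rmorphN mulrNN.
Qed.

Lemma canon_nonsingular n (A : 'M[F]_n) : (0 < n)%N -> A \in unitmx ->
  (forall N (B : 'M[F]_N), (N < n)%N -> canon bar im B) -> canon bar im A.
Proof.
case: n A => // n A _ Au IH.
have Ahu : A^h \in unitmx by rewrite star_unit.
pose T := A *m invmx A^h.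
have [l hl] : exists l, T - l%:M \notin unitmx.
  have /closed_rootP [l] : size (char_poly T) != 1%N by rewrite size_char_poly.
  rewrite -eigenvalue_root_char => /eigenvalueP [v hv v0]; exists l.
  apply: contra v0 => Tu; apply/eqP/(can_inj (mulmxK Tu)).
  by rewrite mul0mx mulmxBr hv mul_mx_scalar subrr.
have Tu : T \in unitmx by rewrite unitmx_mul unitmx_inv Au.
have l0 : l != 0 by apply: contraNneq hl => ->; rewrite rmorph0 subr0.
have [k [X [P [XP XT TP]]]] := jordan_summand hl.
set J := jordan k.+1 l in XT TP.
have Jhu : J^h \in unitmx by rewrite star_unit; exact: jordan_unit.
have XA : X *m A = J *m X *m A^h by rewrite -XT /T mulmxA mulmxKV.
(* The conjugate transpose of the dual chain [P], adapted to [A]; the factor [invmx J^h] normalizes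
   its pairing with [X] to 1. *)
pose Y := invmx J^h *m P^h *m invmx A.
have iAh : (invmx A)^h = invmx A^h.
  by rewrite -[LHS](mulmxK Ahu) -starM mulmxV // star1 mul1mx.
have iAhh : (invmx A^h)^h = invmx A by rewrite -iAh (starK barK).
have PJ : J^h *m P^h = P^h *m invmx A *m A^h.
  by rewrite -starM -TP /T !starM iAhh !mulmxA.
have YA : Y *m A = invmx J^h *m Y *m A^h.
  by rewrite /Y mulmxKV // -!(mulmxA (invmx J^h)) -PJ mulKmx.
have iJh : (invmx J^h)^h *m J = 1%:M by rewrite -{2}[J](starK barK) -starM mulmxV ?star1.
have Ju : J \in unitmx by rewrite -(star_unit bar).
have XY : X *m A *m Y^h = 1%:M.
  rewrite /Y !starM iAh (starK barK) !mulmxA -/T.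
  have -> : X *m A *m invmx A^h = J *m X by rewrite -XT /T mulmxA.
  rewrite -(mulmxA J) XP mulmx1 -[(invmx _)^h](mulmxK Ju) iJh mul1mx mulmxV //.
have [e|e] := eqVneq (l * bar l) 1.
  exact: chain_step e XA YA XY IH.
exact: hyper_step l0 e XA YA XY IH.
Qed.

Lemma canon_exists n (A : 'M[F]_n) : canon bar im A.
Proof.
elim/ltn_ind: n A => n IH A.
have [Au|Au] := boolP (A \in unitmx); last first.
  by apply: (canon_singular barK bar_nonid im_sqr Au) => N B lt_Nn; exact: IH.
case: (posnP n) => [n0|n0]; first by move: {Au IH} A; rewrite n0 => A; exact: canon0.
by apply: (canon_nonsingular n0 Au) => N B lt_Nn; exact: IH.
Qed.

End Nonsingular.

(** * Normalizing the modulus in type (i) *)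

Section Normalization.

Variables (F : closedFieldType) (bar : {rmorphism F -> F}).
Hypotheses (barK : involutive bar) (bar_nonid : exists a : F, bar a != a).
Variables (im : F) (im_sqr : im ^+ 2 = -1).

Lemma canonical_sum_exists n (A : 'M[F]_n) :
  exists s : seq (csummand F), canonical_sum_of bar im A s.
Proof.
have [s hs h] := canon_exists barK bar_nonid im_sqr A.
by exists s; split=> //; apply/(star_congruentP barK).
Qed.

Lemma nneg_Plt (r : F) : nneg bar (1 - r) -> r != 1 -> Plt bar r 1.
Proof.
move=> h r1; have [c [bc _] hc] := nneg_sqrt barK h; exists c; split=> //.
by apply: contraNneq r1 => c0; rewrite -subr_eq0 -oppr_eq0 opprB -hc c0 expr0n.
Qed.

(** Replacing [l] by [(bar l)^-1] inverts the modulus. *)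
Lemma normal_summand (t : csummand F) : cvalid bar im t ->
  exists t', [/\ same_upto_inv bar t t', cvalid bar im t' & cnormal bar im t'].
Proof.
case: t => [n l|n m] tv; last by exists (TypeII n m); split=> //=; rewrite !eqxx.
have [on|en] := boolP (odd n); first by exists (TypeI n l); split=> //=; rewrite ?eqxx ?on.
have [n0 [r hr r1] _] := tv; have [br nr r2] := (modulusP barK bar_nonid im_sqr l r).1 hr.
have b1r : bar (1 - r) = 1 - r by rewrite rmorphB rmorph1 br.
case: (nneg_real b1r) => h.
  by exists (TypeI n l); split=> //=; rewrite ?eqxx // => _; exists r => //; exact: nneg_Plt.
rewrite opprB in h.
have r0 : r != 0.
  apply: contraNneq r1 => e; move: h; rewrite e sub0r.
  by move/(nneg_anti barK bar_nonid im_sqr (nneg1 bar)) => /esym/eqP; rewrite eq_sym.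
have l0 : l != 0 by apply: contraNneq r0 => l0; rewrite -sqrf_eq0 r2 l0 mul0r.
have hr' : modulus bar im (bar l)^-1 r^-1.
  apply/(modulusP barK bar_nonid im_sqr); split; first by rewrite fmorphV br.
    by case: nr => c ->; exists c^-1; rewrite fmorphV invfM.
  by rewrite fmorphV barK exprVn r2 invfM mulrC.
have rV1 : r^-1 != 1 by rewrite invr_eq1.
exists (TypeI n (bar l)^-1); split=> /=.
- by rewrite !eqxx l0 orbT.
- by split=> //; [exists r^-1 | rewrite (negPf en)].
move=> _; exists r^-1 => //; apply: nneg_Plt => //.
have -> : 1 - r^-1 = (r - 1) * r^-1 by rewrite mulrBl mulfV // mul1r.
case: h nr => c -> [d ->]; exists (c * d^-1).
by rewrite rmorphM fmorphV invfM mulrACA.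
Qed.

Lemma normal_summands (s : seq (csummand F)) : (forall t, t \in s -> cvalid bar im t) ->
  exists s', [/\ all2 (same_upto_inv bar) s s', forall t, t \in s' -> cvalid bar im t &
                 forall t, t \in s' -> cnormal bar im t].
Proof.
elim: s => [_|t s IH hs]; first by exists [::].
have [t' [tt' tv tn]] := normal_summand (hs t (mem_head _ _)).
have [|s' [ss' sv sn]] := IH; first by move=> u hu; apply: hs; rewrite inE hu orbT.
exists (t' :: s'); split=> /=; first by rewrite tt'.
  by move=> u; rewrite inE => /predU1P [->|/sv].
by move=> u; rewrite inE => /predU1P [->|/sn].
Qed.

End Normalization.

Theorem theorem1p2 (F : closedFieldType) (bar : {rmorphism F -> F})
    (bar_invol : involutive bar) (bar_nonid : exists a : F, bar a != a)
    (im : F) (im_sqr : im ^+ 2 = -1) :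
  [/\ forall (n : nat) (A : 'M[F]_n),
        exists s : seq (csummand F), canonical_sum_of bar im A s,
      forall (n : nat) (A : 'M[F]_n) (s s' : seq (csummand F)),
        canonical_sum_of bar im A s ->
        (forall t, t \in s' -> cvalid bar im t) ->
        (canonical_sum_of bar im A s' <-> perm_upto (same_upto_inv bar) s s') &
      forall (n : nat) (A : 'M[F]_n),
        exists2 s : seq (csummand F), canonical_sum_of bar im A s &
          forall t, t \in s -> cnormal bar im t]
  /\
  (forall (n n' : nat) (A : 'M[F]_n) (A' : 'M[F]_n') (s s' : seq (csummand F)),
     canonical_sum_of bar im A s -> canonical_sum_of bar im A' s' ->
     ((exists2 K : seq (ksummand F),
         is_KCF (star bar A) A K & is_KCF (star bar A') A' K) <->
      perm_upto (same_upto_inv_sign bar) s s'))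
  /\
  (forall t : csummand F, cvalid bar im t ->
     is_KCF (star bar (cmx t)) (cmx t) (KCF_of_csummand bar t)).
Proof.
have unique := canonical_unique bar_invol bar_nonid im_sqr.
split; last split.
- split=> // n A; first exact: canonical_sum_exists.
  have [s hs] := canonical_sum_exists bar_invol bar_nonid im_sqr A.
  have [s' [ss' sv sn]] := normal_summands bar_invol bar_nonid im_sqr hs.1.
  by exists s' => //; apply/(unique _ _ _ _ hs sv); exists s.
- exact: kronecker_determines.
- exact: is_KCF_cmx.
Qed.
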